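(* Fix a coefficient ring $R$, which is either a finite cyclic ring $\mathbb{Z}_d=\mathbb{Z}/d\mathbb{Z}$ or a subring of $\mathbb{Q}$. For a group $\pi$, let $\{\pi^n\}$, $\{\pi^{\{n\}}\}$, $\{\pi^{(n)}\}$ and $\{\pi^{(n)}_H\}$ be, respectively, the $R$-coefficient derived series, the Vogel universal $R$-local derived series, the Vogel-Cohn $R$-local derived series (over the trivial group $\Gamma=\{e\}$), and the Harvey series of $\pi$. Then for any group $\pi$ and for any $n$, $$\pi^n\subset\pi^{\{n\}}\subset\pi^{(n)}\subset\pi^{(n)}_H.$$
   Context: Each series is indexed by ordinals $n$, has 0-th term $\pi$, and at a limit ordinal its term is the intersection of the preceding terms. The successor terms are as follows. $R$-derived series: $\pi^{n+1}=\ker\{\pi^n\to\frac{\pi^n}{[\pi^n,\pi^n]}\otimes_{\mathbb{Z}}R\}$. Vogel localization: let $\Omega_0$ be the collection of homomorphisms $\pi\to G$ of finitely presented groups inducing an isomorphism on $H_1(-;R)$ and an epimorphism on $H_2(-;R)$. A group $A$ is local if for each $\pi\to G$ in $\Omega_0$ every homomorphism $\pi\to A$ extends uniquely to $G\to A$. The Vogel localization is the functor $\pi\mapsto\widehat\pi=E(\pi)$ to local groups, with a natural map $\pi\to\widehat\pi$ initial among homomorphisms from $\pi$ to local groups; it exists. Vogel universal $R$-local derived series: $\pi^{\{n+1\}}=\ker\{\pi^{\{n\}}\to E(\pi)^{\{n\}}\to\frac{E(\pi)^{\{n\}}}{[E(\pi)^{\{n\}},E(\pi)^{\{n\}}]}\otimes_{\mathbb{Z}}R\}$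 (defined simultaneously for all groups; equivalently $\pi^{\{n\}}$ is the preimage of $E(\pi)^n$ under $\pi\to E(\pi)$). Vogel-Cohn $R$-local derived series: for a group $G$, the Cohn localization $RG\to L(G)$ of the augmentation $RG\to R$ is the initial ring homomorphism $RG\to\Lambda$ such that $\alpha\otimes1_\Lambda$ is an isomorphism for every homomorphism $\alpha$ of free right $RG$-modules of the same finite rank with $\alpha\otimes_{RG}1_R$ an isomorphism. Then, simultaneously for all groups, $$\pi^{(n+1)}=\ker\Big\{\pi^{(n)}\to\frac{\pi^{(n)}}{[\pi^{(n)},\pi^{(n)}]}=H_1\big(\pi;\mathbb{Z}[\pi/\pi^{(n)}]\big)\to H_1\big(\pi;L(\widehat\pi/\widehat\pi^{(n)})\big)\Big\},$$ the last map being induced by $\mathbb{Z}[\pi/\pi^{(n)}]\to R[\widehat\pi/\widehat\pi^{(n)}]\to L(\widehat\pi/\widehat\pi^{(n)})$. Harvey series: $\pi_H^{(n+1)}=\ker\{\pi_H^{(n)}\to H_1(\pi;\mathbb{Z}[\pi/\pi_H^{(n)}])\to H_1(\pi;\mathcal{K}(\pi/\pi_H^{(n)}))\}$, where $\mathcal{K}(G)=\mathbb{Z}G(\mathbb{Z}G-\{0\})^{-1}$ is the Ore localization of $\mathbb{Z}G$ for a group $G$ whose integral group ring is an Ore domain; $\mathcal{K}$ is taken to be well-defined wherever it is used.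
   Formalization: The last inclusion π^(n) ⊂ π_H^(n) is asserted only for R a subring of Q; for R = Z_d (d ≥ 2) it is false, e.g. π = Z, n = 1, where π^1 = dZ but π_H^(1) = 0. The first two inclusions are proved for both kinds of R. *)

(* Defs.v *)
From HB Require Import structures.
From mathcomp Require Import all_boot all_order all_algebra.
From mathcomp Require Import finmap boolp.
From mathcomp.multinomials Require Import monalg.

Set Implicit Arguments.
Unset Strict Implicit.
Unset Printing Implicit Defensive.

Import Order.TTheory GRing.Theory.
Local Open Scope ring_scope.
Local Open Scope quotient_scope.

(** [normal_closure N] is the normal subgroup generated by [N], and [quo N] is
   the quotient of [G] by it.  Taking the normal closure makes [quo N] a group
   for every predicate [N]; when [N] is a normal subgroup, as are all the terms
   of the series below, [normal_closure N] is [N] and [quo N] is [G / N]. *)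

Inductive normal_closure (G : groupType) (N : G -> Prop) : G -> Prop :=
| nc_in x : N x -> normal_closure N x
| nc_one : normal_closure N 1%g
| nc_mul x y :
    normal_closure N x -> normal_closure N y -> normal_closure N (x * y)%g
| nc_inv x : normal_closure N x -> normal_closure N (x^-1)%g
| nc_conj x y : normal_closure N x -> normal_closure N (x ^ y)%g.

Section Quotient.
Variables (G : groupType) (N : G -> Prop).
Local Open Scope group_scope.
Local Notation ncl := (normal_closure N).

Definition quo_rel : rel G := fun x y => `[< ncl (x^-1 * y) >].

Fact quo_rel_equiv : equiv_class_of quo_rel.
Proof.
split=> [x | x y | y x z].
- by apply/asboolP; rewrite mulVg; apply: nc_one.
- by apply/asboolP/asboolP => /nc_inv; rewrite invgM invgK.
move=> /asboolP xy /asboolP yz; apply/asboolP.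
by have := nc_mul xy yz; rewrite -mulgA mulVKg.
Qed.

Canonical quo_equiv := EquivRelPack quo_rel_equiv.

Definition quo := {eq_quot quo_equiv}.
HB.instance Definition _ := Choice.on quo.
HB.instance Definition _ := Quotient.on quo.

Definition quo_mk (x : G) : quo := \pi_quo x.

Lemma quo_mkP x y : quo_mk x = quo_mk y <-> ncl (x^-1 * y).
Proof.
split=> [/eqmodP/asboolP // | xy]; exact/eqmodP/asboolP.
Qed.

Lemma quo_reprK (u : quo) : quo_mk (repr u) = u.
Proof. exact: reprK. Qed.

Definition quo_one : quo := quo_mk 1.
Definition quo_mul (u v : quo) : quo := quo_mk (repr u * repr v).
Definition quo_inv (u : quo) : quo := quo_mk (repr u)^-1.

Lemma quo_mk_mul x y : quo_mul (quo_mk x) (quo_mk y) = quo_mk (x * y).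
Proof.
apply/quo_mkP; set a := repr _; set b := repr _.
have /quo_mkP xa : quo_mk a = quo_mk x by apply: quo_reprK.
have /quo_mkP yb : quo_mk b = quo_mk y by apply: quo_reprK.
have -> : (a * b)^-1 * (x * y) = (a^-1 * x) ^ b * (b^-1 * y).
  by rewrite conjgE invgM !mulgA mulgK.
by apply: nc_mul => //; apply: nc_conj.
Qed.

Lemma quo_mk_inv x : quo_inv (quo_mk x) = quo_mk x^-1.
Proof.
apply/quo_mkP; set a := repr _.
have /quo_mkP xa : quo_mk a = quo_mk x by apply: quo_reprK.
have -> : (a^-1)^-1 * x^-1 = ((a^-1 * x)^-1) ^ a^-1.
  by rewrite conjgE invgM !invgK !mulgA mulgK.
by apply: nc_conj; apply: nc_inv.
Qed.

Fact quo_mulA : associative quo_mul.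
Proof.
move=> u v w; rewrite -(quo_reprK u) -(quo_reprK v) -(quo_reprK w).
by rewrite !quo_mk_mul mulgA.
Qed.

Fact quo_mul1 : left_id quo_one quo_mul.
Proof. by move=> u; rewrite -(quo_reprK u) quo_mk_mul mul1g. Qed.

Fact quo_1mul : right_id quo_one quo_mul.
Proof. by move=> u; rewrite -(quo_reprK u) quo_mk_mul mulg1. Qed.

Fact quo_mulV : left_inverse quo_one quo_inv quo_mul.
Proof. by move=> u; rewrite -(quo_reprK u) quo_mk_inv quo_mk_mul mulVg. Qed.

Fact quo_Vmul : right_inverse quo_one quo_inv quo_mul.
Proof. by move=> u; rewrite -(quo_reprK u) quo_mk_inv quo_mk_mul mulgV. Qed.

HB.instance Definition _ :=
  isGroup.Build quo quo_mulA quo_mul1 quo_1mul quo_mulV quo_Vmul.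

Fact quo_mk_morphism : monoid.monoid_morphism quo_mk.
Proof. by split=> // x y; rewrite -quo_mk_mul. Qed.

HB.instance Definition _ :=
  isUMagmaMorphism.Build G quo quo_mk quo_mk_morphism.

End Quotient.

Definition gring (R : pzRingType) (G : groupType) : Type := {malg R[G]}.

Section GroupRing.
Variables (R : pzRingType) (G : groupType).

HB.instance Definition _ := GRing.Zmodule.on (gring R G).
Implicit Types a b c : gring R G.

Definition gring_one : gring R G := << 1 *g 1%g >>.

Definition gring_mul a b : gring R G :=
  \sum_(x <- msupp a) \sum_(y <- msupp b) << a@_x * b@_y *g (x * y)%g >>.

Fact gring_mulw (d e : {fset G}) a b :
    (msupp a `<=` d)%fset -> (msupp b `<=` e)%fset ->
  gring_mul a b =
    \sum_(x <- d) \sum_(y <- e) << a@_x * b@_y *g (x * y)%g >>.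
Proof.
move=> ad be; rewrite /gring_mul (big_fset_incl _ ad) /=.
  apply/eq_bigr => x _; apply/big_fset_incl => // y _ /mcoeff_outdom ->.
  by rewrite mulr0 monalgU0.
move=> x _ /mcoeff_outdom ax.
by rewrite big1 // => y _; rewrite ax mul0r monalgU0.
Qed.

Fact gring_mulDl : left_distributive gring_mul +%R.
Proof.
move=> a b c.
rewrite (gring_mulw (msuppD_le a b) (fsubset_refl _)).
rewrite (gring_mulw (fsubsetUl (msupp a) (msupp b)) (fsubset_refl (msupp c))).
rewrite (gring_mulw (fsubsetUr (msupp a) (msupp b)) (fsubset_refl (msupp c))).
rewrite -big_split /=; apply/eq_bigr => x _.
rewrite -big_split /=; apply/eq_bigr => y _.
by rewrite mcoeffD mulrDl monalgUD.
Qed.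

Fact gring_mulDr : right_distributive gring_mul +%R.
Proof.
move=> a b c.
rewrite (gring_mulw (fsubset_refl _) (msuppD_le b c)).
rewrite (gring_mulw (fsubset_refl (msupp a)) (fsubsetUl (msupp b) (msupp c))).
rewrite (gring_mulw (fsubset_refl (msupp a)) (fsubsetUr (msupp b) (msupp c))).
rewrite -big_split /=; apply/eq_bigr => x _.
rewrite -big_split /=; apply/eq_bigr => y _.
by rewrite mcoeffD mulrDr monalgUD.
Qed.

Fact gring_mul0 : left_zero 0 gring_mul.
Proof. by move=> a; rewrite /gring_mul msupp0 big_seq_fset0. Qed.

Fact gring_0mul : right_zero 0 gring_mul.
Proof.
by move=> a; rewrite /gring_mul msupp0 big1 // => x _; rewrite big_seq_fset0.
Qed.

Fact gring_mulUU r s x y :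
  gring_mul << r *g x >> << s *g y >> = << r * s *g (x * y)%g >>.
Proof.
by rewrite (gring_mulw msuppU_le msuppU_le) !big_seq_fset1 !mcoeffUU.
Qed.

Fact gring_ind (P : gring R G -> Prop) :
    P 0 -> (forall a b, P a -> P b -> P (a + b)) ->
    (forall r x, P << r *g x >>) ->
  forall a, P a.
Proof. by move=> P0 PD PU a; rewrite [a]monalgE; apply: big_ind. Qed.

Fact gring_mul1 : left_id gring_one gring_mul.
Proof.
elim/gring_ind => [|a b IHa IHb|r x]; first exact: gring_0mul.
  by rewrite gring_mulDr IHa IHb.
by rewrite gring_mulUU mul1r mul1g.
Qed.

Fact gring_1mul : right_id gring_one gring_mul.
Proof.
elim/gring_ind => [|a b IHa IHb|r x]; first exact: gring_mul0.
  by rewrite gring_mulDl IHa IHb.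
by rewrite gring_mulUU mulr1 mulg1.
Qed.

Fact gring_mulA : associative gring_mul.
Proof.
elim/gring_ind => [|a a' IHa IHa'|r x] b c; first by rewrite !gring_mul0.
  by rewrite !gring_mulDl IHa IHa'.
elim/gring_ind: b => [|b b' IHb IHb'|s y].
- by rewrite !(gring_mul0, gring_0mul).
- by rewrite !(gring_mulDl, gring_mulDr) IHb IHb'.
elim/gring_ind: c => [|c c' IHc IHc'|t z]; first by rewrite !gring_0mul.
  by rewrite !gring_mulDr IHc IHc'.
by rewrite !gring_mulUU mulrA mulgA.
Qed.

HB.instance Definition _ := GRing.Zmodule_isPzRing.Build (gring R G)
  gring_mulA gring_mul1 gring_1mul gring_mulDl gring_mulDr.

Definition gring_of (x : G) : gring R G := << 1 *g x >>.

Definition augmentation (a : gring R G) : R := \sum_(x <- msupp a) a@_x.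

End GroupRing.

(** The bar complex [C_n(G; M) = M (x)_{ZG} B_n(G)] of a group [G], where the
   right action of [G] on the abelian group [M] is [act].  An [n]-chain is a
   finitely supported [M]-valued function on [n]-tuples, [<< m *g (g, h) >>]
   being the elementary chain [m [g | h]]. *)

Section Homology.
Variables (G : groupType) (M : zmodType) (act : M -> G -> M).

Definition bar1 (c : {malg M[G]}) : M :=
  \sum_(g <- msupp c) (act c@_g g - c@_g).

Definition bar2 (c : {malg M[(G * G)%type]}) : {malg M[G]} :=
  \sum_(p <- msupp c)
    let: (g, h) := p in
    (<< act c@_p g *g h >> - << c@_p *g (g * h)%g >> + << c@_p *g g >>).

Definition bar3 (c : {malg M[(G * G * G)%type]}) : {malg M[(G * G)%type]} :=
  \sum_(p <- msupp c)
    let: (g, h, k) := p in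
    (<< act c@_p g *g (h, k) >> - << c@_p *g ((g * h)%g, k) >>
     + << c@_p *g (g, (h * k)%g) >> - << c@_p *g (g, h) >>).

End Homology.

Definition chain_map (M : zmodType) (K K' : choiceType) (f : K -> K')
    (c : {malg M[K]}) : {malg M[K']} :=
  \sum_(k <- msupp c) << c@_k *g f k >>.

Section HomologyMaps.
Variables (R : zmodType) (G H : groupType) (f : G -> H).

Local Notation triv := (fun r _ => r).
Local Notation f1 := (chain_map f).
Local Notation f2 := (chain_map (fun p : G * G => (f p.1, f p.2))).

(** [f] induces an injection, resp. a surjection, on homology with trivial
   coefficients [R]. *)
Definition H1_inj := forall z : {malg R[G]}, bar1 triv z = 0 ->
  (exists b, f1 z = bar2 triv b) -> exists b, z = bar2 triv b.

Definition H1_surj := forall z' : {malg R[H]}, bar1 triv z' = 0 ->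
  exists z b, bar1 triv z = 0 /\ z' = f1 z + bar2 triv b.

Definition H2_surj := forall z' : {malg R[(H * H)%type]}, bar2 triv z' = 0 ->
  exists z b, bar2 triv z = 0 /\ z' = f2 z + bar3 triv b.

End HomologyMaps.

(** For a subgroup [N] of [G] acting trivially on [S] through the monoid map
   [rho], the composite [N -> N/[N,N] = H_1(G; Z[G/N]) -> H_1(G; S)] sends [x]
   to the class of the cycle [1 [x]]; [S] is a right [ZG]-module through [rho].
   [H1_null rho x] says that this class is zero. *)
Definition H1_null (G : groupType) (S : pzRingType) (rho : G -> S) (x : G) :=
  exists b : {malg S[(G * G)%type]},
    << 1 *g x >> = bar2 (fun s g => s * rho g) b.

(** [N/[N,N] (x)_Z R] is the free abelian group on the symbols [x (x) r] modulo
   biadditivity; commutators of [N] die because the quotient is abelian. *)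

Inductive subgroup_gen (V : zmodType) (P : V -> Prop) : V -> Prop :=
| sg_in v : P v -> subgroup_gen P v
| sg_zero : subgroup_gen P 0
| sg_sub v w : subgroup_gen P v -> subgroup_gen P w -> subgroup_gen P (v - w).

Inductive biadditivity (R : zmodType) (G : groupType) (N : G -> Prop) :
    {malg int[(G * R)%type]} -> Prop :=
| biadd_l x y r : N x -> N y ->
    biadditivity N
      (<< 1 *g ((x * y)%g, r) >> - << 1 *g (x, r) >> - << 1 *g (y, r) >>)
| biadd_r x r s : N x ->
    biadditivity N
      (<< 1 *g (x, r + s) >> - << 1 *g (x, r) >> - << 1 *g (x, s) >>).

(** [x] is in [N] and is sent to zero by [N -> N/[N,N] (x)_Z R]. *)
Definition ab_tensor_null (R : pzRingType) (G : groupType) (N : G -> Prop)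
    (x : G) :=
  N x /\ subgroup_gen (biadditivity (R := R) N) << 1 *g (x, 1) >>.

(** A letter [(i, b)] stands for the generator [i] if [b], else for its inverse.
   [word_eq rels] is the congruence on words whose quotient is the group
   presented by the relators [rels]. *)

Definition word (k : nat) := seq ('I_k * bool).

Inductive word_eq (k : nat) (rels : seq (word k)) : word k -> word k -> Prop :=
| we_refl w : word_eq rels w w
| we_sym w w' : word_eq rels w w' -> word_eq rels w' w
| we_trans w w' w'' :
    word_eq rels w w' -> word_eq rels w' w'' -> word_eq rels w w''
| we_cancel u v i b : word_eq rels (u ++ [:: (i, b); (i, ~~ b)] ++ v) (u ++ v)
| we_rel u v r : r \in rels -> word_eq rels (u ++ r ++ v) (u ++ v).

Definition word_eval (G : groupType) (k : nat) (x : 'I_k -> G) (w : word k)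
    : G :=
  (\prod_(l <- w) (if l.2 then x l.1 else (x l.1)^-1))%g.

Definition finitely_presented (G : groupType) :=
  exists (k : nat) (x : 'I_k -> G) (rels : seq (word k)),
    (forall g, exists w, word_eval x w = g) /\
    (forall w w', word_eval x w = word_eval x w' <-> word_eq rels w w').

Definition Omega0 (R : pzRingType) (P G : groupType)
    (f : {multiplicative P -> G}) :=
  [/\ finitely_presented P, finitely_presented G,
      H1_inj R f /\ H1_surj R f & H2_surj R f].

Definition unique_extension (P G A : groupType) (f : P -> G) (h : P -> A) :=
  exists2 k : {multiplicative G -> A}, k \o f =1 h &
    forall k' : {multiplicative G -> A}, k' \o f =1 h -> k' =1 k.

Definition local_group (R : pzRingType) (A : groupType) :=
  forall (P G : groupType) (f : {multiplicative P -> G}), Omega0 R f ->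
  forall h : {multiplicative P -> A}, unique_extension f h.

Record vogel_localization (R : pzRingType) := VogelLocalization {
  vogel :> groupType -> groupType;
  vogel_map : forall G : groupType, {multiplicative G -> vogel G};
  vogel_local : forall G : groupType, local_group R (vogel G);
  vogel_initial : forall (G A : groupType) (h : {multiplicative G -> A}),
    local_group R A -> unique_extension (vogel_map G) h
}.

(** A homomorphism [RG^k -> RG^k] of free right modules is left multiplication
   by a matrix over [RG]; its base change along a ring homomorphism [phi] is
   [map_mx phi], and being an isomorphism means being invertible. *)

Definition invertible_mx (S : pzRingType) (k : nat) (A : 'M[S]_k) :=
  exists B : 'M[S]_k, A *m B = 1%:M /\ B *m A = 1%:M.

Definition cohn_inverting (R : pzRingType) (G : groupType) (S : pzRingType)
    (phi : gring R G -> S) :=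
  forall (k : nat) (A : 'M[gring R G]_k),
    invertible_mx (map_mx (@augmentation R G) A) -> invertible_mx (map_mx phi A).

Record cohn_localization (R : pzRingType) := CohnLocalization {
  cohn :> groupType -> pzRingType;
  cohn_map : forall G : groupType, {rmorphism gring R G -> cohn G};
  cohn_map_inverting : forall G : groupType, cohn_inverting (cohn_map G);
  cohn_initial :
    forall (G : groupType) (S : pzRingType) (phi : {rmorphism gring R G -> S}),
    cohn_inverting phi ->
    exists2 psi : {rmorphism cohn G -> S}, psi \o cohn_map G =1 phi &
      forall psi' : {rmorphism cohn G -> S},
        psi' \o cohn_map G =1 phi -> psi' =1 psi
}.

(** [phi] exhibits [K] as the ring of right fractions [A (A - 0)^-1] of the
   domain [A]; such a [K] exists exactly when [A] is a right Ore domain, and it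
   is then unique.  (For a group ring the left and the right Ore conditions are
   equivalent.) *)

Definition ore_localization (A K : pzRingType) (phi : {rmorphism A -> K}) :=
  [/\ (1 : A) != 0, injective phi,
      forall s : A, s != 0 -> exists t, phi s * t = 1 /\ t * phi s = 1 &
      forall q : K, exists a s : A, s != 0 /\ q * phi s = phi a].

(** A choice, for each [G], of a ring with a homomorphism from [ZG].  It is only
   asked to be the Ore localization for the groups [G] where it gets used. *)
Record ZG_rings := ZGRings {
  zg_ring :> groupType -> pzRingType;
  zg_map : forall G : groupType, {rmorphism gring int G -> zg_ring G}
}.

(** [n] ranges over an arbitrary well-ordered set [W], so that it can be any
   ordinal.  The series of all groups are constructed simultaneously. *)

Definition subgroup_family := forall G : groupType, G -> Prop.

Definition covers (d : Order.disp_t) (W : porderType d) (m n : W) :=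
  (m < n)%O /\ forall k : W, (k < n)%O -> (k <= m)%O.

Section Series.
Variables (d : Order.disp_t) (W : orderType d).
Hypothesis wfW : well_founded (fun m n : W => (m < n)%O).
Variable step : subgroup_family -> subgroup_family.

(** The second clause is vacuous at a successor; the first one is vacuous at
   the other elements, the least of which gets the whole group. *)
Definition series : W -> subgroup_family :=
  Fix wfW (fun _ => subgroup_family) (fun n prev G x =>
    (forall m (mn : (m < n)%O), covers m n -> step (prev m mn) x) /\
    ((forall m, ~ covers m n) -> forall m (mn : (m < n)%O), prev m mn G x)).

Lemma series_unfold n (G : groupType) (x : G) :
  series n x <->
    (forall m, covers m n -> step (series m) x) /\
    ((forall m, ~ covers m n) -> forall m, (m < n)%O -> series m x).
Proof.
rewrite /series Fix_eq => [|k f g fg].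
  split=> -[hs hl]; split=> // m mn; last exact: hs.
  exact: hs mn.1 mn.
suff -> : f = g by [].
apply: functional_extensionality_dep => m.
by apply: functional_extensionality_dep => mk; apply: fg.
Qed.

Lemma series_bottom n (G : groupType) (x : G) :
  (forall m, (n <= m)%O) -> series n x.
Proof.
move=> n0; apply/series_unfold; split=> [m [mn _]|_ m mn];
  by have := n0 m; rewrite leNgt mn.
Qed.

Lemma series_succ m n (G : groupType) (x : G) :
  covers m n -> series n x <-> step (series m) x.
Proof.
move=> mn; rewrite series_unfold; split=> [[hs _]|sx]; first exact: hs.
split=> [k kn|/(_ m)//]; suff -> : k = m by [].
by apply: le_anti; rewrite mn.2 ?kn.1 // kn.2 // mn.1.
Qed.

Lemma series_limit n (G : groupType) (x : G) :
  (forall m, ~ covers m n) ->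
  series n x <-> forall m, (m < n)%O -> series m x.
Proof.
move=> lim; rewrite series_unfold; split=> [[_ h]|h]; first exact: h.
by split=> // m /lim.
Qed.

End Series.

Definition derived_step (R : pzRingType) (S : subgroup_family)
    : subgroup_family :=
  fun G x => S G x /\ ab_tensor_null R (S G) x.

Definition vogel_step (R : pzRingType) (E : vogel_localization R)
    (S : subgroup_family) : subgroup_family :=
  fun G x => S G x /\ ab_tensor_null R (S (E G)) (vogel_map E G x).

Definition vogel_cohn_step (R : pzRingType) (E : vogel_localization R)
    (L : cohn_localization R) (S : subgroup_family) : subgroup_family :=
  fun G x => S G x /\
    H1_null (fun g => cohn_map L (quo (S (E G)))
                        (gring_of R (quo_mk (S (E G)) (vogel_map E G g)))) x.

Definition harvey_step (K : ZG_rings) (S : subgroup_family)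
    : subgroup_family :=
  fun G x => S G x /\
    H1_null (fun g => zg_map K (quo (S G))
                        (gring_of int (quo_mk (S G) g))) x.

Section FourSeries.
Variables (d : Order.disp_t) (W : orderType d).
Variable wfW : well_founded (fun m n : W => (m < n)%O).
Variable R : pzRingType.

Definition derived_series : W -> subgroup_family :=
  series wfW (derived_step R).

Definition vogel_series (E : vogel_localization R) : W -> subgroup_family :=
  series wfW (vogel_step E).

Definition vogel_cohn_series (E : vogel_localization R)
    (L : cohn_localization R) : W -> subgroup_family :=
  series wfW (vogel_cohn_step E L).

Definition harvey_series (K : ZG_rings) : W -> subgroup_family :=
  series wfW (harvey_step K).

End FourSeries.

Definition finite_cyclic_ring (R : pzRingType) :=
  exists d : nat, [/\ (0 < d)%N, forall r : R, exists k : int, r = k%:~R &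
    forall k : int, (k%:~R == 0 :> R) = (d%:Z %| k)%Z].

Definition subring_of_rat (R : pzRingType) :=
  exists f : {rmorphism R -> rat}, injective f.

(* Main.v *)
(** The first inclusion is functoriality.  For the second one, a map [P -> G] in
   [Omega0] induces a bijection on derivations with values in a module over
   which the matrices inverted by Cohn act bijectively: Fox calculus turns the
   extension problem into a linear system [Y = c + A Y] with [A] in the
   augmentation ideal.  Hence the semidirect product of a local group with such
   a module is local, the universal derivation of [pi] into an [L]-module
   extends to [E pi], and there it factors through the [R]-abelianization.

   For the third one, induction on [n] yields a local group [B], on which the
   n-th Vogel-Cohn term is trivial, and a map [pi -> B] whose kernel is the n-th
   Harvey term.  At a successor, [B] is enlarged by modules [V] that contain
   [K (pi / pi_H^(m))], so that derivations [pi -> K] become homomorphisms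
   [pi -> V >< B].  The Ore condition being known for [pi / pi_H^(m)] only, and
   not for [B], the module [V] is a reduced product of modules of fractions of
   groups approximating [B] on finite subsets; these groups are built from
   torsion-free abelian groups by extensions, so that they are amenable, have
   unique products and Strebel's property, and their rational group rings are
   Ore domains over which the matrices inverted by Cohn act bijectively. *)

From HB Require Import structures.
Require Import Defs.
From mathcomp Require Import all_boot all_order all_algebra.
From mathcomp Require Import finmap boolp zify ring lra.
From mathcomp Require classical_sets.
From mathcomp.multinomials Require Import monalg.

Set Implicit Arguments.
Unset Strict Implicit.
Unset Printing Implicit Defensive.

Import Order.TTheory GRing.Theory.
Local Open Scope ring_scope.

(** * Additive extension of maps to formal sums *)

(** A solution [Y] of the linear system must also respect the relators and agree with the given
    derivation on [P], and [H_2] with trivial coefficients controls this only modulo the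
    augmentation ideal. The errors span a module [J] on which the group acts trivially modulo the
    augmentation ideal times [J]; there the homology of [f] applies and puts every error into that
    submodule. Finite presentation bounds the number of errors, so a Nakayama argument gives
    [J = 0]. In the third inclusion, no map from [E pi] to [pi / pi_H^(m)] is at hand to compare the
    two localizations. The local group [B] replaces that quotient: [pi -> B] extends to [E pi], so a
    suitable module [V] over the group ring of [B] becomes an [L]-module, and derivations into [V]
    kill what the Vogel-Cohn step kills. Conversely [K] is a division ring, so that derivations into
    [K] detect [H_1]; seen in [V], they make the kernel of the new map exactly the next Harvey
    term. *)

Definition mlift (M N : zmodType) (K : choiceType) (f : K -> M -> N)
    (c : {malg M[K]}) : N :=
  \sum_(k <- msupp c) f k c@_k.

Section Mlift.
Variables (M N : zmodType) (K : choiceType) (f : K -> M -> N).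
Hypothesis fB : forall k, {morph f k : x y / x - y}.

Let f0 k : f k 0 = 0.
Proof. by rewrite -[in LHS](subrr 0) fB subrr. Qed.

Let fD k : {morph f k : x y / x + y}.
Proof.
move=> x y; have fN z : f k (- z) = - f k z by rewrite -sub0r fB f0 sub0r.
by rewrite -{1}[y]opprK fB fN opprK.
Qed.

Lemma mliftw (d : {fset K}) c : (msupp c `<=` d)%fset ->
  mlift f c = \sum_(k <- d) f k c@_k.
Proof.
move=> cd; rewrite /mlift (big_fset_incl _ cd) // => k _ /mcoeff_outdom ->.
exact: f0.
Qed.

Lemma mliftD : {morph mlift f : a b / a + b}.
Proof.
move=> a b; rewrite (mliftw (msuppD_le a b)).
rewrite (mliftw (fsubsetUl (msupp a) (msupp b))).
rewrite (mliftw (fsubsetUr (msupp a) (msupp b))) -big_split /=.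
by apply: eq_bigr => k _; rewrite mcoeffD fD.
Qed.

Lemma mlift0 : mlift f 0 = 0.
Proof. by rewrite /mlift msupp0 big_seq_fset0. Qed.

Lemma mliftN : {morph mlift f : a / - a}.
Proof. by move=> a; apply/eqP; rewrite -addr_eq0 -mliftD addNr mlift0. Qed.

Lemma mliftB : {morph mlift f : a b / a - b}.
Proof. by move=> a b; rewrite mliftD mliftN. Qed.

Lemma mliftU m k : mlift f << m *g k >> = f k m.
Proof. by rewrite (mliftw msuppU_le) big_seq_fset1 mcoeffUU. Qed.

End Mlift.

Lemma malg_ind (M : zmodType) (K : choiceType) (P : {malg M[K]} -> Prop) :
    P 0 -> (forall a b, P a -> P b -> P (a + b)) ->
    (forall r x, P << r *g x >>) ->
  forall a, P a.
Proof. by move=> P0 PD PU a; rewrite [a]monalgE; apply: big_ind. Qed.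

Lemma malg_ext (M N : zmodType) (K : choiceType) (f g : {malg M[K]} -> N) :
    {morph f : a b / a + b} -> {morph g : a b / a + b} ->
    (forall m k, f << m *g k >> = g << m *g k >>) -> f =1 g.
Proof.
move=> fD gD fg; have f0 : f 0 = 0 by apply: (addrI (f 0)); rewrite -fD !addr0.
have g0 : g 0 = 0 by apply: (addrI (g 0)); rewrite -gD !addr0.
by elim/malg_ind => [|a b IHa IHb|//]; rewrite ?f0 ?g0 // fD gD IHa IHb.
Qed.

Section DefsMlift.
Variables (G : groupType) (M : zmodType).

Lemma chain_mapE (K K' : choiceType) (f : K -> K') :
  chain_map f = mlift (fun k (m : M) => << m *g f k >>).
Proof. by []. Qed.

Lemma chain_mapU (K K' : choiceType) (f : K -> K') (m : M) k :
  chain_map f << m *g k >> = << m *g f k >>.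
Proof. by rewrite chain_mapE mliftU // => ? ? ?; rewrite monalgUB. Qed.

Lemma chain_mapD (K K' : choiceType) (f : K -> K') :
  {morph @chain_map M _ _ f : a b / a + b}.
Proof. by rewrite chain_mapE; apply: mliftD => ? ? ?; rewrite monalgUB. Qed.

Lemma chain_map0 (K K' : choiceType) (f : K -> K') :
  @chain_map M _ _ f 0 = 0.
Proof. by rewrite chain_mapE mlift0. Qed.

Lemma chain_mapB (K K' : choiceType) (f : K -> K') :
  {morph @chain_map M _ _ f : a b / a - b}.
Proof. by rewrite chain_mapE; apply: mliftB => ? ? ?; rewrite monalgUB. Qed.

Variable act : M -> G -> M.
Hypothesis actB : forall g, {morph act ^~ g : x y / x - y}.

Let bar2f (p : G * G) (m : M) : {malg M[G]} :=
  << act m p.1 *g p.2 >> - << m *g (p.1 * p.2)%g >> + << m *g p.1 >>.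

Let bar2E : bar2 act = mlift bar2f.
Proof. by apply: funext => c; apply: eq_bigr => -[g h]. Qed.

Let bar2fB p : {morph bar2f p : x y / x - y}.
Proof.
move=> x y; rewrite /bar2f actB !monalgUB !opprD !opprK.
by rewrite [X in X + _ = _]addrACA [LHS]addrACA.
Qed.

Lemma bar2U m g h :
  bar2 act << m *g (g, h) >> =
    << act m g *g h >> - << m *g (g * h)%g >> + << m *g g >>.
Proof. by rewrite bar2E mliftU. Qed.

Lemma bar2D : {morph bar2 act : a b / a + b}.
Proof. by rewrite bar2E; apply: mliftD. Qed.

Lemma bar2_0 : bar2 act 0 = 0.
Proof. by rewrite bar2E mlift0. Qed.

Lemma bar2B : {morph bar2 act : a b / a - b}.
Proof. by rewrite bar2E; apply: mliftB. Qed.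

Let bar3f (p : G * G * G) (m : M) : {malg M[(G * G)%type]} :=
  << act m p.1.1 *g (p.1.2, p.2) >> - << m *g ((p.1.1 * p.1.2)%g, p.2) >>
   + << m *g (p.1.1, (p.1.2 * p.2)%g) >> - << m *g (p.1.1, p.1.2) >>.

Let bar3E : bar3 act = mlift bar3f.
Proof. by apply: funext => c; apply: eq_bigr => -[[g h] k]. Qed.

Let bar3fB p : {morph bar3f p : x y / x - y}.
Proof.
move=> x y; rewrite /bar3f actB !monalgUB !opprD !opprK.
by rewrite [X in X + _ + _ = _]addrACA [X in X + _ = _]addrACA [LHS]addrACA.
Qed.

Lemma bar3U m g h k :
  bar3 act << m *g (g, h, k) >> =
    << act m g *g (h, k) >> - << m *g ((g * h)%g, k) >>
    + << m *g (g, (h * k)%g) >> - << m *g (g, h) >>.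
Proof. by rewrite bar3E mliftU. Qed.

Lemma bar3D : {morph bar3 act : a b / a + b}.
Proof. by rewrite bar3E; apply: mliftD. Qed.

Lemma bar3_0 : bar3 act 0 = 0.
Proof. by rewrite bar3E mlift0. Qed.

End DefsMlift.

Fact trivB (M : zmodType) (T : Type) (g : T) :
  {morph (fun (r : M) (_ : T) => r)^~ g : x y / x - y}.
Proof. by []. Qed.

Lemma bar1_triv (G : groupType) (M : zmodType) (c : {malg M[G]}) :
  bar1 (fun r _ => r) c = 0.
Proof. by rewrite /bar1 big1 // => k _; rewrite subrr. Qed.

(** * Group rings *)

Section MultTheory.
Variables (G H : groupType) (f : {multiplicative G -> H}).
Local Open Scope group_scope.

Lemma mult1 : f 1 = 1.
Proof. by apply: (mulgI (f 1)); rewrite -gmulfM !mulg1. Qed.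

Lemma multV x : f x^-1 = (f x)^-1.
Proof. by apply: (mulgI (f x)); rewrite -gmulfM !mulgV mult1. Qed.

End MultTheory.

Section GroupRingTheory.
Variables (R : pzRingType) (G : groupType).
Implicit Types a b : gring R G.

Lemma gringUU r s (x y : G) :
  (<< r *g x >> : gring R G) * << s *g y >> = << r * s *g (x * y)%g >>.
Proof. exact: gring_mulUU. Qed.

Lemma augmentationU r (x : G) : augmentation (<< r *g x >> : gring R G) = r.
Proof. exact: (mliftU (f := fun _ r => r)). Qed.

Lemma augmentationB : {morph @augmentation R G : a b / a - b}.
Proof. exact: (mliftB (f := fun _ r => r)). Qed.

Lemma augmentation_monoid : monoid_morphism (@augmentation R G).
Proof.
split; first exact: augmentationU.
have D : {morph @augmentation R G : a b / a + b}.
  exact: (mliftD (f := fun _ r => r)).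
have z : augmentation (0 : gring R G) = 0 by exact: (mlift0 (fun _ r => r)).
elim/gring_ind=> [|a a' IHa IHa'|r x] b; first by rewrite mul0r z mul0r.
  by rewrite mulrDl !D IHa IHa' -mulrDl.
elim/gring_ind: b => [|b b' IHb IHb'|s y].
- by rewrite mulr0 z mulr0.
- by rewrite mulrDr !D IHb IHb' -mulrDr.
by rewrite gringUU !augmentationU.
Qed.

HB.instance Definition _ :=
  GRing.isZmodMorphism.Build (gring R G) R (@augmentation R G) augmentationB.
HB.instance Definition _ :=
  GRing.isMonoidMorphism.Build (gring R G) R (@augmentation R G)
    augmentation_monoid.

Lemma gring_ofM (x y : G) : gring_of R (x * y)%g = gring_of R x * gring_of R y.
Proof. by rewrite /gring_of gringUU mulr1. Qed.

Lemma gring_of1 : gring_of R (1%g : G) = 1.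
Proof. by []. Qed.

Lemma aug_gring_of (x : G) : augmentation (gring_of R x) = 1.
Proof. exact: augmentationU. Qed.

End GroupRingTheory.

Section GroupRingLift.
Variables (R S : pzRingType) (G : groupType) (iota : {rmorphism R -> S}).
Variable rho : G -> S.
Hypothesis rho1 : rho 1%g = 1.
Hypothesis rhoM : forall x y, rho (x * y)%g = rho x * rho y.
Hypothesis rhoC : forall r x, iota r * rho x = rho x * iota r.

Definition gring_lift : gring R G -> S := mlift (fun x r => iota r * rho x).

Let fB x : {morph (fun r => iota r * rho x) : r s / r - s}.
Proof. by move=> r s; rewrite rmorphB mulrBl. Qed.

Lemma gring_liftU r x : gring_lift << r *g x >> = iota r * rho x.
Proof. exact: mliftU. Qed.

Lemma gring_lift_of x : gring_lift (gring_of R x) = rho x.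
Proof. by rewrite gring_liftU rmorph1 mul1r. Qed.

Lemma gring_liftB : {morph gring_lift : a b / a - b}.
Proof. exact: mliftB. Qed.

Lemma gring_lift_monoid : monoid_morphism gring_lift.
Proof.
split; first by rewrite gring_lift_of.
have D : {morph gring_lift : a b / a + b} by exact: mliftD fB.
have z : gring_lift 0 = 0 by exact: mlift0.
elim/gring_ind=> [|a a' IHa IHa'|r x] b; first by rewrite mul0r z mul0r.
  by rewrite mulrDl !D IHa IHa' -mulrDl.
elim/gring_ind: b => [|b b' IHb IHb'|s y].
- by rewrite mulr0 z mulr0.
- by rewrite mulrDr !D IHb IHb' -mulrDr.
by rewrite gringUU !gring_liftU rmorphM rhoM -!mulrA; congr (_ * _); rewrite !mulrA rhoC.
Qed.

Lemma gring_lift_ex : exists phi : {rmorphism gring R G -> S},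
  forall r x, phi << r *g x >> = iota r * rho x.
Proof.
pose m1 := GRing.isZmodMorphism.Build (gring R G) S gring_lift gring_liftB.
pose m2 := GRing.isMonoidMorphism.Build (gring R G) S gring_lift gring_lift_monoid.
pose phi := HB.pack_for {rmorphism gring R G -> S} gring_lift m1 m2.
by exists phi => r x; rewrite /= gring_liftU.
Qed.

End GroupRingLift.

Lemma gring_map_ex (R R' : pzRingType) (G G' : groupType)
    (iota : {rmorphism R -> R'}) (f : {multiplicative G -> G'}) :
  exists phi : {rmorphism gring R G -> gring R' G'},
    forall r x, phi << r *g x >> = << iota r *g f x >>.
Proof.
have c1 : zmod_morphism (fun r : R => (<< iota r *g 1%g >> : gring R' G')).
  by move=> r s; rewrite rmorphB monalgUB.
have c2 : monoid_morphism (fun r : R => (<< iota r *g 1%g >> : gring R' G')).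
  by split=> [|r s]; rewrite ?rmorph1 // gringUU mulg1 rmorphM.
pose m1 := GRing.isZmodMorphism.Build R (gring R' G') _ c1.
pose m2 := GRing.isMonoidMorphism.Build R (gring R' G') _ c2.
pose i := HB.pack_for {rmorphism R -> gring R' G'}
  (fun r : R => (<< iota r *g 1%g >> : gring R' G')) m1 m2.
have [|x y|r x|phi phiE] :=
  @gring_lift_ex R (gring R' G') G i (fun x => gring_of R' (f x)).
- by rewrite /= mult1.
- by rewrite /= gmulfM gring_ofM.
- by rewrite /= /gring_of !gringUU mulg1 mul1g mulr1 mul1r.
by exists phi => r x; rewrite phiE /= /gring_of gringUU mulr1 mul1g.
Qed.

(** * Transfinite series *)

Section SeriesCases.
Variables (d : Order.disp_t) (W : orderType d).

Lemma covers_or_limit (n : W) :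
  (exists m, covers m n) \/ (forall m, ~ covers m n).
Proof. by have [|/forallNP] := pselect (exists m, covers m n); [left | right]. Qed.

End SeriesCases.

(** * The derived series *)

Lemma ab_tensor_null_map (R : pzRingType) (G H : groupType)
    (f : {multiplicative G -> H}) (N : G -> Prop) (N' : H -> Prop) x :
    (forall y, N y -> N' (f y)) ->
  ab_tensor_null R N x -> ab_tensor_null R N' (f x).
Proof.
move=> NN' [Nx gx]; split; first exact: NN'.
pose F := @chain_map int _ _ (fun p : G * R => (f p.1, p.2)).
have FU m g r : F << m *g (g, r) >> = << m *g (f g, r) >> by exact: chain_mapU.
have FB : {morph F : a b / a - b} by exact: chain_mapB.
suff: forall v, subgroup_gen (biadditivity N) v ->
    subgroup_gen (biadditivity N') (F v) by move/(_ _ gx); rewrite FU.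
move=> v; elim=> [w [y z r Ny Nz|y r s Ny]||a b _ IHa _ IHb].
- by rewrite !FB !FU gmulfM; apply/sg_in/biadd_l; apply: NN'.
- by rewrite !FB !FU; apply/sg_in/biadd_r; apply: NN'.
- by rewrite [F 0]chain_map0; apply: sg_zero.
- by rewrite FB; apply: sg_sub.
Qed.

Section DerivedVogel.
Variables (d : Order.disp_t) (W : orderType d).
Variable wfW : well_founded (fun m n : W => (m < n)%O).
Variable R : pzRingType.

Lemma derived_series_map n (G H : groupType) (f : {multiplicative G -> H}) x :
  derived_series wfW R n x -> derived_series wfW R n (f x).
Proof.
elim/(well_founded_ind wfW): n G H f x => n IH G H f x.
have [[m mn]|lim] := covers_or_limit n.
  rewrite /derived_series !(series_succ _ _ _ mn) => -[Sx tx].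
  split; first exact: IH mn.1 G H f x Sx.
  by apply: ab_tensor_null_map tx => y; apply: IH mn.1 G H f y.
rewrite /derived_series !series_limit // => h m mn.
by apply: (IH m mn); apply: h.
Qed.

Lemma derived_vogel (E : vogel_localization R) n (G : groupType) (x : G) :
  derived_series wfW R n x -> vogel_series wfW E n x.
Proof.
elim/(well_founded_ind wfW): n G x => n IH G x.
have [[m mn]|lim] := covers_or_limit n.
  rewrite /derived_series /vogel_series !(series_succ _ _ _ mn) => -[Sx tx].
  split; first exact: IH mn.1 G x Sx.
  apply: ab_tensor_null_map tx => y Sy.
  by apply: (IH m mn.1); apply: derived_series_map.
rewrite /derived_series /vogel_series !series_limit // => h m mn.
by apply: (IH m mn) => //; apply: h.
Qed.

End DerivedVogel.

(** * Identities in abelian groups *)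

Inductive zexp := ZVar of nat | ZZero | ZAdd of zexp & zexp | ZOpp of zexp.

Fixpoint zeval (V : zmodType) (s : seq V) (e : zexp) : V :=
  match e with
  | ZVar i => s`_i
  | ZZero => 0
  | ZAdd e1 e2 => zeval s e1 + zeval s e2
  | ZOpp e1 => - zeval s e1
  end.

Fixpoint zcoef (e : zexp) (i : nat) : int :=
  match e with
  | ZVar j => (i == j)%:Z
  | ZZero => 0
  | ZAdd e1 e2 => zcoef e1 i + zcoef e2 i
  | ZOpp e1 => - zcoef e1 i
  end.

Lemma zevalE (V : zmodType) (s : seq V) e :
  zeval s e = \sum_(i < size s) s`_i *~ zcoef e i.
Proof.
elim: e => [j||e1 IH1 e2 IH2|e1 IH1] /=.
- have [js|sj] := ltnP j (size s).
    rewrite (bigD1 (Ordinal js)) //= eqxx mulr1z big1 ?addr0 // => i.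
    by rewrite -val_eqE /= => /negPf ->.
  (* A variable beyond the list evaluates to the default 0, and no index of the sum meets it. *)
  rewrite nth_default // big1 // => i _.
  by case: eqP => // ij; have := ltn_ord i; rewrite ij ltnNge sj.
- by rewrite big1.
- by rewrite IH1 IH2 -big_split /=; apply: eq_bigr => i _; rewrite mulrzDr.
- by rewrite IH1 -sumrN; apply: eq_bigr => i _; rewrite mulrNz.
Qed.

(** Comparing integer coefficients is a closed computation: [zmod] reifies both sides of a goal over
    a common list of atoms and settles it by [vm_compute]. *)
Lemma zeval_eq (V : zmodType) (s : seq V) e1 e2 :
  all (fun i => zcoef e1 i == zcoef e2 i) (iota 0 (size s)) ->
  zeval s e1 = zeval s e2.
Proof.
move=> /allP eq12; rewrite !zevalE; apply: eq_bigr => i _.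
by rewrite (eqP (eq12 i _)) // mem_iota add0n ltn_ord.
Qed.

(* The same atom often comes with different canonical structures, or types:
   only these are compared up to conversion. *)
Ltac zsame x y :=
  first [ constr_eq x y
        | let T := type of x in
          first [ is_ind T | is_const T
                | lazymatch T with
                  | Set => idtac | Type => idtac
                  | GRing.Lmodule.type _ => idtac
                  | GRing.LSemiModule.type _ => idtac
                  end ];
          unify x y
        | lazymatch x with
          | ?f ?a => lazymatch y with ?g ?b => zsame f g; zsame a b end
          | fun z => @?b z => unify x y
          end ].

Ltac zindex x s :=
  match s with
  | cons ?y _ => let _ := match goal with _ => zsame x y end in constr:(0%N)
  | cons _ ?s' => let n := zindex x s' in constr:(n.+1)
  end.

Ltac zinsert x s :=
  match s with
  | _ => let n := zindex x s in constr:(s)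
  | nil => constr:(cons x nil)
  | cons ?y ?s' => let s'' := zinsert x s' in constr:(cons y s'')
  end.

Ltac zvars t s :=
  lazymatch t with
  | (?a + ?b)%R => let s1 := zvars a s in zvars b s1
  | (- ?a)%R => zvars a s
  | 0%R => s
  | _ => zinsert t s
  end.

Ltac zquote t s :=
  lazymatch t with
  | (?a + ?b)%R =>
      let e1 := zquote a s in let e2 := zquote b s in constr:(ZAdd e1 e2)
  | (- ?a)%R => let e1 := zquote a s in constr:(ZOpp e1)
  | 0%R => constr:(ZZero)
  | _ => let n := zindex t s in constr:(ZVar n)
  end.

Ltac zmod :=
  cbv beta delta [reverse_coercion];
  lazymatch goal with
  | |- @eq ?V ?a ?b =>
      let s1 := zvars a (@nil V) in
      let s := zvars b s1 in
      let e1 := zquote a s in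
      let e2 := zquote b s in
      refine (@zeval_eq _ s e1 e2 _); vm_compute; reflexivity
  end.

(** * Extending derivations along the maps of Omega0 *)

Section Nakayama.
Variables (A S : pzRingType) (D : lmodType S) (lam : {rmorphism A -> S}).
Variables (k : nat) (M : 'M[A]_k).
Hypothesis Minv : invertible_mx (map_mx lam M).

Lemma invertible_inj (e : 'I_k -> D) :
  (forall i, \sum_j lam (M i j) *: e j = 0) -> forall i, e i = 0.
Proof.
have [B [_ BM]] := Minv; move=> Me i.
transitivity (\sum_j (B *m map_mx lam M) i j *: e j).
  rewrite BM (bigD1 i) //= mxE eqxx scale1r big1 ?addr0 // => j ji.
  by rewrite mxE eq_sym (negPf ji) scale0r.
under eq_bigr do rewrite mxE scaler_suml.
rewrite exchange_big big1 //= => j _.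
under eq_bigr do rewrite mxE -scalerA.
by rewrite -scaler_sumr Me scaler0.
Qed.

Lemma invertible_surj (s : 'I_k -> D) :
  exists e : 'I_k -> D, forall i, \sum_j lam (M i j) *: e j = s i.
Proof.
have [B [MB _]] := Minv; exists (fun i => \sum_j B i j *: s j) => i.
under eq_bigr do rewrite scaler_sumr.
rewrite exchange_big /=; transitivity (\sum_j (map_mx lam M *m B) i j *: s j).
  apply: eq_bigr => j _; rewrite mxE scaler_suml; apply: eq_bigr => l _.
  by rewrite scalerA mxE.
rewrite MB (bigD1 i) //= mxE eqxx scale1r big1 ?addr0 // => j ji.
by rewrite mxE eq_sym (negPf ji) scale0r.
Qed.

End Nakayama.

Section CohnNakayama.
Variables (R : pzRingType) (Q : groupType) (S : pzRingType).
Variables (lam : {rmorphism gring R Q -> S}) (D : lmodType S).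
Hypothesis lam_inv : cohn_inverting lam.
Variables (k : nat) (A : 'I_k -> 'I_k -> gring R Q).
Hypothesis A0 : forall i j, augmentation (A i j) = 0.

Let M : 'M[gring R Q]_k := 1%:M - \matrix_(i, j) A i j.

(** [M = 1 - A] augments to the identity matrix, hence is one of the matrices that [lam] inverts. *)
Let Minv : invertible_mx (map_mx lam M).
Proof.
apply: lam_inv; suff -> : map_mx (@augmentation R Q) M = 1%:M.
  by exists 1%:M; rewrite mulmx1.
apply/matrixP => i j; rewrite !mxE /= rmorphB /= A0 subr0.
by case: eqP => _; rewrite ?mulr1n ?mulr0n ?rmorph1 ?rmorph0.
Qed.

Let ME (e : 'I_k -> D) i :
  \sum_j lam (M i j) *: e j = e i - \sum_j lam (A i j) *: e j.
Proof.
under eq_bigr do rewrite !mxE rmorphB scalerBl.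
rewrite sumrB; congr (_ - _); rewrite (bigD1 i) //= eqxx rmorph1 scale1r.
by rewrite big1 ?addr0 // => j ji; rewrite eq_sym (negPf ji) rmorph0 scale0r.
Qed.

Lemma nakayama (e : 'I_k -> D) :
  (forall i, e i = \sum_j lam (A i j) *: e j) -> forall i, e i = 0.
Proof.
by move=> eA; apply: (invertible_inj Minv) => i; rewrite ME -eA subrr.
Qed.

Lemma nakayama_solve (s : 'I_k -> D) :
  exists e : 'I_k -> D, forall i, e i = s i + \sum_j lam (A i j) *: e j.
Proof.
have [e es] := invertible_surj Minv s; exists e => i.
by rewrite -es ME; zmod.
Qed.

End CohnNakayama.

(** * Fox calculus on words and on bar chains *)

Section Words.
Variables (G : groupType) (k : nat) (y : 'I_k -> G).
Local Open Scope group_scope.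

Definition letter (l : 'I_k * bool) : G := if l.2 then y l.1 else (y l.1)^-1.

Lemma word_eval_cons l w : word_eval y (l :: w) = letter l * word_eval y w.
Proof. by rewrite /word_eval big_cons. Qed.

Lemma word_eval_cat u v : word_eval y (u ++ v) = word_eval y u * word_eval y v.
Proof. by rewrite /word_eval big_cat. Qed.

Lemma word_eval_nil : word_eval y [::] = 1.
Proof. by rewrite /word_eval big_nil. Qed.

Lemma word_eval_cancel i b : word_eval y [:: (i, b); (i, ~~ b)] = 1.
Proof.
by rewrite !word_eval_cons word_eval_nil mulg1; case: b; rewrite ?mulgV ?mulVg.
Qed.

End Words.

Section Derivations.
Variables (R : pzRingType) (Q : groupType) (S : pzRingType).
Variables (lam : {rmorphism gring R Q -> S}) (D : lmodType S).

Definition gact (q : Q) : S := lam (gring_of R q).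
Definition cst (r : R) : S := lam << r *g 1%g >>.

Lemma gactM p q : gact (p * q)%g = gact p * gact q.
Proof. by rewrite /gact gring_ofM rmorphM. Qed.

Lemma gact1 : gact 1%g = 1.
Proof. exact: rmorph1. Qed.

Lemma cstB : {morph cst : r s / r - s}.
Proof. by move=> r s; rewrite /cst monalgUB rmorphB. Qed.

Lemma cst1 : cst 1 = 1.
Proof. exact: rmorph1. Qed.

Lemma cst_gact r q : cst r * gact q = lam << r *g q >>.
Proof. by rewrite /cst /gact -rmorphM /gring_of gringUU mulr1 mul1g. Qed.

(** Stability is asked under the image of the group ring only, not under [S]: the submodules of
    interest are built with the augmentation ideal, and [S] carries no augmentation. *)
Definition submod (K : D -> Prop) :=
  [/\ K 0, forall u v, K u -> K v -> K (u - v) &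
      forall a v, K v -> K (lam a *: v)].

Section Submod.
Variables (K : D -> Prop) (subK : submod K).

Lemma submod0 : K 0. Proof. by case: subK. Qed.
Lemma submodB u v : K u -> K v -> K (u - v). Proof. by case: subK => _ + _; apply. Qed.
Lemma submodZ a v : K v -> K (lam a *: v). Proof. by case: subK => _ _; apply. Qed.
Lemma submodN v : K v -> K (- v).
Proof. by move=> Kv; rewrite -sub0r; apply: submodB => //; apply: submod0. Qed.
Lemma submodD u v : K u -> K v -> K (u + v).
Proof. by move=> Ku Kv; rewrite -[v]opprK; apply: submodB => //; apply: submodN. Qed.
Lemma submod_sum I (r : seq I) (P : pred I) (F : I -> D) :
  (forall i, K (F i)) -> K (\sum_(i <- r | P i) F i).
Proof. by move=> KF; apply: big_ind => //; [apply: submod0 | apply: submodD]. Qed.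

End Submod.

Lemma submod_zero : submod (fun v => v = 0).
Proof. by split=> [|u v -> ->|a v ->]; rewrite ?subr0 ?scaler0. Qed.

(* [K] contains the defect of [delta] being a derivation *)
Definition derivation_mod (G : groupType) (t : G -> Q) (K : D -> Prop)
    (delta : G -> D) :=
  forall g h, K (delta (g * h)%g - (delta g + gact (t g) *: delta h)).

Definition pairing (G : choiceType) (delta : G -> D) (c : {malg R[G]}) : D :=
  mlift (fun g r => cst r *: delta g) c.

Section Pairing.
Variables (G : choiceType) (delta : G -> D).

Let pB g : {morph (fun r => cst r *: delta g) : r s / r - s}.
Proof. by move=> r s; rewrite cstB scalerBl. Qed.

Lemma pairingU r g : pairing delta << r *g g >> = cst r *: delta g.
Proof. exact: mliftU. Qed.
Lemma pairing0 : pairing delta 0 = 0. Proof. exact: mlift0. Qed.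
Lemma pairingD : {morph pairing delta : a b / a + b}. Proof. exact: mliftD. Qed.
Lemma pairingN : {morph pairing delta : a / - a}. Proof. exact: mliftN. Qed.
Lemma pairingB : {morph pairing delta : a b / a - b}. Proof. exact: mliftB. Qed.

Lemma pairing_submod K c : submod K -> (forall g, K (delta g)) ->
  K (pairing delta c).
Proof. by move=> sK Kd; apply: submod_sum => // g; apply: submodZ. Qed.

End Pairing.

Lemma pairing_chain_map (G H : choiceType) (f : G -> H) (delta : H -> D) c :
  pairing delta (chain_map f c) = pairing (fun x => delta (f x)) c.
Proof.
elim/malg_ind: c => [|a b IHa IHb|r x].
- by rewrite chain_map0 !pairing0.
- by rewrite chain_mapD !pairingD IHa IHb.
- by rewrite chain_mapU !pairingU.
Qed.

Lemma pairing_sub (G : choiceType) (delta eta : G -> D) c :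
  pairing (fun g => delta g - eta g) c = pairing delta c - pairing eta c.
Proof.
elim/malg_ind: c => [|a b IHa IHb|r x].
- by rewrite !pairing0 subr0.
- by rewrite !pairingD IHa IHb; zmod.
- by rewrite !pairingU scalerBr.
Qed.

Section DerivationMod.
Variables (G : groupType) (t : {multiplicative G -> Q}).
Variables (k : nat) (y : 'I_k -> G).

(* Fox calculus: the value on a word of the derivation of the free group that
   takes the values [Y] on the generators *)
Definition letter_deriv (Y : 'I_k -> D) (l : 'I_k * bool) : D :=
  if l.2 then Y l.1 else - (gact (t (y l.1)^-1%g) *: Y l.1).

Fixpoint word_deriv (Y : 'I_k -> D) (w : word k) : D :=
  if w is l :: w' then
    letter_deriv Y l + gact (t (letter y l)) *: word_deriv Y w'
  else 0.

Lemma word_deriv_cat Y u v :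
  word_deriv Y (u ++ v) =
    word_deriv Y u + gact (t (word_eval y u)) *: word_deriv Y v.
Proof.
elim: u => [|l u IH] /=; first by rewrite word_eval_nil mult1 gact1 scale1r add0r.
by rewrite IH word_eval_cons gmulfM gactM scalerDr scalerA addrA.
Qed.

Lemma word_deriv_cancel Y i b : word_deriv Y [:: (i, b); (i, ~~ b)] = 0.
Proof.
rewrite /= scaler0 addr0; case: b; rewrite /letter_deriv /letter /=.
  by rewrite scalerN scalerA -gactM -gmulfM mulgV mult1 gact1 scale1r subrr.
by rewrite addNr.
Qed.

(** The coefficients are the Fox derivatives of [w], pushed to the group ring of [Q]. *)
Lemma word_deriv_linear w : exists a : 'I_k -> gring R Q, forall Y,
  word_deriv Y w = \sum_j lam (a j) *: Y j.
Proof.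
elim: w => [|l w [a aE]].
  by exists (fun _ => 0) => Y; rewrite big1 // => j _; rewrite rmorph0 scale0r.
pose c : gring R Q := if l.2 then 1 else - gring_of R (t (y l.1)^-1%g).
exists (fun j => (if j == l.1 then c else 0) + gring_of R (t (letter y l)) * a j).
move=> Y /=; under eq_bigr do rewrite rmorphD scalerDl.
rewrite big_split /=; congr (_ + _); last first.
  by rewrite aE scaler_sumr; apply: eq_bigr => j _; rewrite rmorphM scalerA.
rewrite (bigD1 l.1) //= eqxx big1 ?addr0 => [|j /negPf ->]; last first.
  by rewrite rmorph0 scale0r.
rewrite /letter_deriv /c; case: l.2; first by rewrite rmorph1 scale1r.
by rewrite rmorphN scaleNr.
Qed.

Variables (K : D -> Prop) (subK : submod K).
Variables (delta : G -> D) (dK : derivation_mod t K delta).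

Lemma derivation_mod1 : K (delta 1%g).
Proof.
have := dK 1%g 1%g; rewrite mulg1 mult1 gact1 scale1r => /(submodN subK).
by congr K; zmod.
Qed.

Lemma derivation_mod_word w :
  K (delta (word_eval y w) - word_deriv (delta \o y) w).
Proof.
elim: w => [|l w IH] /=; first by rewrite word_eval_nil subr0; apply: derivation_mod1.
have Kl : K (delta (letter y l) - letter_deriv (delta \o y) l).
  rewrite /letter_deriv /letter; case: l.2; first by rewrite subrr; apply: submod0.
  have := submodB subK derivation_mod1 (dK (y l.1)^-1%g (y l.1)).
  have -> : delta ((y l.1)^-1 * y l.1)%g = delta 1%g by rewrite mulVg.
  by congr K; rewrite /=; zmod.
have := submodD subK (submodD subK (dK (letter y l) (word_eval y w)) Kl)
  (submodZ subK (gring_of R (t (letter y l))) IH).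
by rewrite word_eval_cons -[lam _]/(gact _) scalerBr; congr K; zmod.
Qed.

(* [bar2] lifts to [ZG]-coefficients only up to the augmentation ideal *)
Lemma pairing_bar2 (b : {malg R[(G * G)%type]}) :
  K (pairing delta (bar2 (fun r _ => r) b)
     - mlift (fun p r => lam (<< r *g 1%g >> - << r *g t p.1 >>) *: delta p.2) b).
Proof.
have mB (p : G * G) :
    {morph (fun r => lam (<< r *g 1%g >> - << r *g t p.1 >>) *: delta p.2)
       : r s / r - s}.
  move=> r s; rewrite -scalerBl -rmorphB !monalgUB; congr (lam _ *: _); zmod.
elim/malg_ind: b => [|a b IHa IHb|r [g h]].
- by rewrite bar2_0 pairing0 mlift0 subr0; apply: submod0.
- rewrite bar2D // pairingD mliftD //.
  by have := submodD subK IHa IHb; congr K; zmod.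
rewrite bar2U // pairingD pairingB !pairingU mliftU //=.
have Kd : K (cst r *: (delta (g * h)%g - (delta g + gact (t g) *: delta h))).
  exact: submodZ.
rewrite rmorphB -(cst_gact r (t g)) -[lam _]/(cst r) scalerBl -scalerA.
move: Kd => /(submodN subK); rewrite !scalerBr scalerDr.
by congr K; zmod.
Qed.

End DerivationMod.

(* The coefficients [A] do not depend on [delta]. *)
Lemma bar2_augmentation_coeffs (G : groupType) (t : {multiplicative G -> Q})
    (k : nat) (y : 'I_k -> G) (b : {malg R[(G * G)%type]}) :
    (forall g, exists w, word_eval y w = g) ->
  exists A : 'I_k -> gring R Q, (forall j, augmentation (A j) = 0) /\
    forall K delta, submod K -> derivation_mod t K delta ->
      K (pairing delta (bar2 (fun r _ => r) b) - \sum_j lam (A j) *: delta (y j)).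
Proof.
move=> gen; suff [A [A0 AE]] : exists A : 'I_k -> gring R Q,
    (forall j, augmentation (A j) = 0) /\
    forall K delta, submod K -> derivation_mod t K delta ->
    K (mlift (fun p r => lam (<< r *g 1%g >> - << r *g t p.1 >>) *: delta p.2) b
       - \sum_j lam (A j) *: delta (y j)).
  exists A; split=> // K delta sK dK.
  have := submodD sK (pairing_bar2 sK dK b) (AE K delta sK dK).
  by congr K; zmod.
have mB (delta : G -> D) (p : G * G) :
    {morph (fun r => lam (<< r *g 1%g >> - << r *g t p.1 >>) *: delta p.2)
       : r s / r - s}.
  move=> r s; rewrite -scalerBl -rmorphB !monalgUB; congr (lam _ *: _); zmod.
elim/malg_ind: b => [|b1 b2 [A [A0 AE]] [B [B0 BE]]|r [g h]].
- exists (fun _ => 0); split=> [j|K delta sK _]; first exact: rmorph0.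
  rewrite mlift0 big1 ?subr0; first exact: submod0.
  by move=> j _; rewrite rmorph0 scale0r.
- exists (fun j => A j + B j); split=> [j|K delta sK dK].
    by rewrite rmorphD /= A0 B0 addr0.
  have -> : \sum_j lam (A j + B j) *: delta (y j) =
      \sum_j lam (A j) *: delta (y j) + \sum_j lam (B j) *: delta (y j).
    by rewrite -big_split; apply: eq_bigr => j _; rewrite rmorphD scalerDl.
  rewrite mliftD //; have := submodD sK (AE K delta sK dK) (BE K delta sK dK).
  by congr K; zmod.
have [w wh] := gen h; have [a aE] := word_deriv_linear t y w.
(* This factor comes from the action of [g] on the boundary of [[g | h]]. Its augmentation is zero,
   and so is that of its products with the Fox derivatives of [h]. *)
pose c : gring R Q := << r *g 1%g >> - << r *g t g >>.
exists (fun j => c * a j); split=> [j|K delta sK dK].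
  by rewrite rmorphM rmorphB /= !augmentationU subrr mul0r.
rewrite mliftU //=; have := submodZ sK c (derivation_mod_word y sK dK w).
rewrite wh aE scalerBr; congr (K (_ - _)).
by rewrite scaler_sumr; apply: eq_bigr => j _; rewrite scalerA rmorphM.
Qed.

End Derivations.

Lemma chain_map_bar2 (R : zmodType) (P G : groupType)
    (f : {multiplicative P -> G}) (b : {malg R[(P * P)%type]}) :
  chain_map f (bar2 (fun r _ => r) b) =
    bar2 (fun r _ => r) (chain_map (fun p => (f p.1, f p.2)) b).
Proof.
elim/malg_ind: b => [|a b IHa IHb|r [p q]].
- by rewrite bar2_0 !chain_map0 bar2_0.
- by rewrite (bar2D (@trivB _ _)) chain_mapD IHa IHb [in RHS]chain_mapD
    [RHS](bar2D (@trivB _ _)).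
- by rewrite (bar2U (@trivB _ _)) chain_mapD chain_mapB !chain_mapU
    (bar2U (@trivB _ _)) /= gmulfM.
Qed.

(** * Relative cohomology of the maps of [Omega0] *)

Section RelativeCohomology.
Variables (R : pzRingType) (Q : groupType) (S : pzRingType).
Variables (lam : {rmorphism gring R Q -> S}) (D : lmodType S).
Variables (K : D -> Prop) (subK : submod lam K).
Variables (P G : groupType) (f : {multiplicative P -> G}).
Hypothesis Of : Omega0 R f.
Variables (c : G -> G -> D) (b : P -> D).
Hypothesis cocycle_c :
  forall g h k, K (c h k - c (g * h)%g k + c g (h * k)%g - c g h).
Hypothesis cobound_b :
  forall p q, K (b q - b (p * q)%g + b p - c (f p) (f q)).

Local Notation triv := (fun r _ => r).
Local Notation pair_c := (pairing lam (fun p : G * G => c p.1 p.2)).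
Local Notation pair_b := (pairing lam b).
Local Notation f1 := (chain_map f).
Local Notation f2 := (chain_map (fun p : P * P => (f p.1, f p.2))).

Lemma pairing_cocycle z : K (pair_c (bar3 triv z)).
Proof.
elim/malg_ind: z => [|x y IHx IHy|r [[g h] k]].
- by rewrite bar3_0 pairing0; apply: submod0 subK.
- by rewrite (bar3D (@trivB _ _)) pairingD; apply: (submodD subK).
rewrite (bar3U (@trivB _ _)) !(pairingD, pairingN) !pairingU /=.
by rewrite -!(scalerBr, scalerDr); apply: (submodZ subK).
Qed.

Lemma pairing_cobound z : K (pair_b (bar2 triv z) - pair_c (f2 z)).
Proof.
elim/malg_ind: z => [|x y IHx IHy|r [p q]].
- by rewrite bar2_0 chain_map0 !pairing0 subr0; apply: submod0 subK.
- rewrite (bar2D (@trivB _ _)) chain_mapD !pairingD.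
  by have := submodD subK IHx IHy; congr K; zmod.
rewrite (bar2U (@trivB _ _)) chain_mapU !(pairingD, pairingN) !pairingU /=.
by rewrite -!(scalerBr, scalerDr); apply: (submodZ subK).
Qed.

(** The relative [H_2] of [f] vanishes: [z] bounds some [a] by injectivity on [H_1], and
    surjectivity on [H_2] corrects [f2 a] to [y] by the image of a cycle [w] and a boundary. So a
    relative cocycle pairs to zero with the relative cycle [(z, y)]. *)
Lemma pairing_relative z y : f1 z = bar2 triv y -> K (pair_b z - pair_c y).
Proof.
have [_ _ [injf _] surjf] := Of; move=> zy.
have [a za] : exists a, z = bar2 triv a.
  by apply: injf; [rewrite bar1_triv | exists y].
have [|w [v [w0 yv]]] := surjf (y - f2 a).
  by rewrite (bar2B (@trivB _ _)) -zy za chain_map_bar2 subrr.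
have Kaw := pairing_cobound (a + w); have Kv := pairing_cocycle v.
have := submodB subK Kaw Kv; rewrite (bar2D (@trivB _ _)) w0 addr0 -za.
have -> : y = f2 (a + w) + bar3 triv v.
  by rewrite chain_mapD -addrA -yv; zmod.
by rewrite pairingD; congr K; zmod.
Qed.

(** Surjectivity on [H_1] writes [[g]] as [f1 z] plus a boundary, and [e g] is the value of [(b, c)]
    on these chains; vanishing of the relative [H_2] makes the choice harmless modulo [K]. The last
    clause is meant for a submodule larger than [K] that contains the values of [b] and [c]. *)
Lemma relative_H2 : exists e : G -> D,
  [/\ forall g h, K (e h - e (g * h)%g + e g - c g h),
      forall p, K (e (f p) - b p) &
      forall J : D -> Prop, submod lam J -> (forall g h, J (c g h)) ->
        (forall p, J (b p)) -> forall g, J (e g)].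
Proof.
have [_ _ [_ surjf] _] := Of.
have /choice[zw zwE] (g : G) :
    exists zw, (<< 1 *g g >> : {malg R[G]}) = f1 zw.1 + bar2 triv zw.2.
  by have [|z [w [_ gzw]]] := surjf << 1 *g g >>; rewrite ?bar1_triv //; exists (z, w).
exists (fun g => pair_b (zw g).1 + pair_c (zw g).2); split.
- move=> g h.
  set z := (zw h).1 - (zw (g * h)%g).1 + (zw g).1.
  set w := (zw h).2 - (zw (g * h)%g).2 + (zw g).2.
  have: f1 z = bar2 triv (<< 1 *g (g, h) >> - w).
    rewrite (bar2B (@trivB _ _)) (bar2U (@trivB _ _)) !zwE /z /w chain_mapD
      chain_mapB (bar2D (@trivB _ _)) (bar2B (@trivB _ _)).
    by zmod.
  move=> /pairing_relative; rewrite /z /w !(pairingD, pairingN) pairingU cst1 scale1r.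
  by congr K; rewrite /=; zmod.
- move=> p; have: f1 (<< 1 *g p >> - (zw (f p)).1) = bar2 triv (zw (f p)).2.
    by rewrite chain_mapB chain_mapU zwE; zmod.
  move=> /pairing_relative /(submodN subK).
  by rewrite pairingB pairingU cst1 scale1r; congr K; zmod.
- by move=> J sJ Jc Jb g; apply: (submodD sJ); apply: pairing_submod.
Qed.

End RelativeCohomology.

(** * Uniqueness and existence of the extended derivation *)

Section Extension.
Variables (R : pzRingType) (Q : groupType) (S : pzRingType).
Variables (lam : {rmorphism gring R Q -> S}) (D : lmodType S).
Hypothesis lam_inv : cohn_inverting lam.
Variables (P G : groupType) (f : {multiplicative P -> G}).
Hypothesis Of : Omega0 R f.
Variable t : {multiplicative G -> Q}.

Definition derivation (H : groupType) (s : H -> Q) (delta : H -> D) :=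
  forall g h, delta (g * h)%g = delta g + gact lam (s g) *: delta h.

Lemma derivation_mod_zero (H : groupType) (s : H -> Q) delta :
  derivation s delta -> derivation_mod lam s (fun v => v = 0) delta.
Proof. by move=> dd g h; rewrite dd subrr. Qed.

(* Vanishing of the relative [H_1] expresses the values at generators of an
   extension of [d] through these values themselves, with coefficients [A] in
   the augmentation ideal. *)
Lemma extension_equations (k : nat) (y : 'I_k -> G) :
    (forall g, exists w, word_eval y w = g) ->
  exists (z : 'I_k -> {malg R[P]}) (A : 'I_k -> 'I_k -> gring R Q),
    (forall i j, augmentation (A i j) = 0) /\
    forall (K : D -> Prop) (d : P -> D) (delta : G -> D),
      submod lam K -> derivation_mod lam t K delta ->
      (forall p, K (delta (f p) - d p)) ->
      forall i, K (delta (y i) -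
        (pairing lam d (z i) + \sum_j lam (A i j) *: delta (y j))).
Proof.
move=> gen; have [_ _ [_ surjf] _] := Of.
have /choice[zA zAE] (i : 'I_k) :
    exists zA : {malg R[P]} * ('I_k -> gring R Q),
    (forall j, augmentation (zA.2 j) = 0) /\
    forall (K : D -> Prop) (d : P -> D) (delta : G -> D),
      submod lam K -> derivation_mod lam t K delta ->
      (forall p, K (delta (f p) - d p)) ->
      K (delta (y i) -
        (pairing lam d zA.1 + \sum_j lam (zA.2 j) *: delta (y j))).
  have [|z [b [_ yzb]]] := surjf << 1 *g y i >>; first by rewrite bar1_triv.
  have [A [A0 AE]] := bar2_augmentation_coeffs lam D t b gen.
  exists (z, A); split=> //= K d delta sK dK fK.
  have := AE K delta sK dK; have := pairing_submod z sK fK.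
  rewrite pairing_sub => Kz Kb; have := submodD sK Kz Kb.
  have <- : pairing lam delta << 1 *g y i >> = delta (y i).
    by rewrite pairingU cst1 scale1r.
  by rewrite yzb pairingD pairing_chain_map; congr K; zmod.
exists (fun i => (zA i).1), (fun i => (zA i).2).
by split=> [i|K d delta sK dK fK i]; have [A0 AE] := zAE i => //; exact: (AE K d).
Qed.

(** The difference of two extensions satisfies the homogeneous system, hence vanishes on the
    generators by [nakayama], and then on all words. *)
Lemma derivation_extension_unique (delta delta' : G -> D) :
    derivation t delta -> derivation t delta' ->
    (forall p, delta (f p) = delta' (f p)) ->
  forall g, delta g = delta' g.
Proof.
move=> dd dd' df; have [_ [k [y [rels [gen _]]]] _ _] := Of.
have [z [A [A0 AE]]] := extension_equations gen.
pose eta g := delta g - delta' g.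
have de : derivation t eta.
  by move=> g h; rewrite /eta dd dd' scalerBr; zmod.
have e0 : forall i, eta (y i) = 0.
  apply: (nakayama lam_inv A0) => i.
  have := AE _ (fun _ => 0) eta (submod_zero lam D) (derivation_mod_zero de).
  move/(_ _ i)/subr0_eq -> => [|p]; last by rewrite /eta df !subrr.
  rewrite [pairing _ _ _]big1 ?add0r // => p _; exact: scaler0.
move=> g; apply/subr0_eq; rewrite -/(eta g).
have [w <-] := gen g.
have := derivation_mod_word y (submod_zero lam D) (derivation_mod_zero de) w.
have [a ->] := word_deriv_linear lam D t y w.
by rewrite big1 ?subr0 // => j _; rewrite /= e0 scaler0.
Qed.

Variable d : P -> D.
Hypothesis dd : derivation (t \o f) d.

Section Existence.
Variables (k : nat) (y : 'I_k -> G) (rels : seq (word k)).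
Hypothesis gen : forall g, exists w, word_eval y w = g.
Hypothesis pres :
  forall w w', word_eval y w = word_eval y w' <-> word_eq rels w w'.
Variables (l : nat) (x : 'I_l -> P).
Hypothesis genP : forall p, exists w, word_eval x w = p.
Variables (z : 'I_k -> {malg R[P]}) (A : 'I_k -> 'I_k -> gring R Q).
Hypothesis A0 : forall i j, augmentation (A i j) = 0.
Hypothesis AE : forall (K : D -> Prop) (delta : G -> D),
  submod lam K -> derivation_mod lam t K delta ->
  (forall p, K (delta (f p) - d p)) ->
  forall i, K (delta (y i) -
    (pairing lam d (z i) + \sum_j lam (A i j) *: delta (y j))).
Variable Y : 'I_k -> D.
Hypothesis YE : forall i,
  Y i = pairing lam d (z i) + \sum_j lam (A i j) *: Y j.
Variables (w : G -> word k) (v : 'I_l -> word k).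
Hypothesis wE : forall g, word_eval y (w g) = g.
Hypothesis vE : forall i, word_eval y (v i) = f (x i).

Local Notation wd := (word_deriv lam t y).
Local Notation sg g := (gact lam (t g)).

(* The obstructions to [Y] being the values of a derivation extending [d] *)
Let errs : seq D :=
  [seq wd Y r | r <- rels] ++ [seq wd Y (v i) - d (x i) | i <- enum 'I_l].

Let N := size errs.

(** [J] is spanned by the errors, and [I] is the augmentation ideal times [J]. The group acts
    trivially on [J / I], so that homology with constant coefficients applies there. *)
Let J (u : D) := exists a : 'I_N -> gring R Q, u = \sum_j lam (a j) *: errs`_j.
Let I (u : D) := exists2 a : 'I_N -> gring R Q,
  (forall j, augmentation (a j) = 0) & u = \sum_j lam (a j) *: errs`_j.

Let sumB (a b : 'I_N -> gring R Q) :
  \sum_j lam (a j) *: errs`_j - \sum_j lam (b j) *: errs`_j =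
  \sum_j lam (a j - b j) *: errs`_j.
Proof. by rewrite -sumrB; apply: eq_bigr => j _; rewrite rmorphB scalerBl. Qed.

Let sumZ c (a : 'I_N -> gring R Q) :
  lam c *: (\sum_j lam (a j) *: errs`_j) = \sum_j lam (c * a j) *: errs`_j.
Proof. by rewrite scaler_sumr; apply: eq_bigr => j _; rewrite rmorphM scalerA. Qed.

Let sum0 : \sum_(j < N) lam 0 *: errs`_j = 0.
Proof. by rewrite big1 // => j _; rewrite rmorph0 scale0r. Qed.

Let subJ : submod lam J.
Proof.
split=> [|u1 u2 [a ->] [b ->]|c u1 [a ->]]; first by exists (fun _ => 0).
- by rewrite sumB; exists (fun j => a j - b j).
- by rewrite sumZ; exists (fun j => c * a j).
Qed.

Let subI : submod lam I.
Proof.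
split=> [|u1 u2 [a a0 ->] [b b0 ->]|c u1 [a a0 ->]].
- by exists (fun _ => 0) => // j; apply: rmorph0.
- rewrite sumB; exists (fun j => a j - b j) => // j.
  by rewrite rmorphB /= a0 b0 subr0.
- by rewrite sumZ; exists (fun j => c * a j) => // j; rewrite rmorphM /= a0 mulr0.
Qed.

Let JI c u : J u -> augmentation c = 0 -> I (lam c *: u).
Proof.
by move=> [a ->] c0; rewrite sumZ; exists (fun j => c * a j) => // j;
  rewrite rmorphM /= c0 mul0r.
Qed.

Let JI_act g u : J u -> I (sg g *: u - u).
Proof.
move=> Ju; have := @JI (gring_of R (t g) - 1) u Ju.
rewrite rmorphB /= aug_gring_of rmorph1 subrr => /(_ erefl).
by rewrite rmorphB rmorph1 scalerBl scale1r.
Qed.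

Let Jerr u : u \in errs -> J u.
Proof.
move=> /(nthP 0)[i iN <-]; exists (fun j => if j == Ordinal iN then 1 else 0).
rewrite (bigD1 (Ordinal iN)) //= eqxx rmorph1 scale1r big1 ?addr0 // => j.
by move/negPf ->; rewrite rmorph0 scale0r.
Qed.

Let Jrel r : r \in rels -> J (wd Y r).
Proof. by move=> rr; apply: Jerr; rewrite mem_cat map_f. Qed.

Let Jgen i : J (wd Y (v i) - d (x i)).
Proof.
apply: Jerr; rewrite mem_cat; apply/orP; right.
by apply/mapP; exists i; rewrite ?mem_enum.
Qed.

Let rel1 r : r \in rels -> word_eval y r = 1%g.
Proof.
move=> rr; rewrite -(word_eval_nil y); apply/pres.
by have := we_rel [::] [::] rr; rewrite /= cats0.
Qed.

(** Words with equal values are congruent modulo the relators, and applying a relator changes the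
    Fox derivative by a translate of its error. *)
Let J_word w1 w2 : word_eval y w1 = word_eval y w2 -> J (wd Y w1 - wd Y w2).
Proof.
move/pres; elim=> [u1|u1 u2 _ IH|u1 u2 u3 _ IH1 _ IH2|u1 u2 i b|u1 u2 r rr].
- by rewrite subrr; apply: (submod0 subJ).
- by have := submodN subJ IH; congr J; zmod.
- by have := submodD subJ IH1 IH2; congr J; zmod.
- rewrite word_deriv_cat (word_deriv_cat lam t y Y [:: (i, b); (i, ~~ b)]) word_deriv_cancel.
  rewrite word_eval_cancel mult1 gact1 scale1r add0r -word_deriv_cat subrr.
  exact: (submod0 subJ).
- rewrite !word_deriv_cat (rel1 rr) mult1 gact1 scale1r.
  have := submodZ subJ (gring_of R (t (word_eval y u1))) (Jrel rr).
  by rewrite -[lam _]/(sg _); congr J; rewrite scalerDr; zmod.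
Qed.

(** [u] spreads [Y] to [G] through chosen words; [c] and [b] measure how far it is from a derivation
    and from extending [d]. Their values lie in [J], and they form a relative cocycle modulo [I]. *)
Let u g := wd Y (w g).
Let c g h := sg g *: u h - u (g * h)%g + u g.
Let b p := u (f p) - d p.

Let Jc g h : J (c g h).
Proof.
have := @J_word (w g ++ w h) (w (g * h)%g).
rewrite word_eval_cat !wE word_deriv_cat wE => /(_ erefl).
by congr J; rewrite /c /u; zmod.
Qed.

Let Jb p : J (b p).
Proof.
have du : derivation_mod lam (t \o f) J (u \o f).
  move=> p1 p2; have := submodN subJ (Jc (f p1) (f p2)).
  by rewrite /c -gmulfM; congr J; rewrite /=; zmod.
have dJ : derivation_mod lam (t \o f) J d.
  by move=> p1 p2; rewrite dd subrr; apply: (submod0 subJ).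
have [wp <-] := genP p.
have Ku := derivation_mod_word x subJ du wp.
have Kd := derivation_mod_word x subJ dJ wp.
have [a aE] := word_deriv_linear lam D (t \o f) x wp.
suff Kw : J (word_deriv lam (t \o f) x ((u \o f) \o x) wp -
             word_deriv lam (t \o f) x (d \o x) wp).
  have := submodB subJ (submodD subJ Ku Kw) Kd.
  by congr J; rewrite /b /=; zmod.
rewrite !aE -sumrB; apply: (submod_sum subJ) => i.
rewrite -scalerBr; apply: (submodZ subJ) => /=.
have := submodD subJ (@J_word (w (f (x i))) (v i) _) (Jgen i).
by rewrite wE vE => /(_ erefl); congr J; rewrite /u; zmod.
Qed.

Let cocycle_c g h m : I (c h m - c (g * h)%g m + c g (h * m)%g - c g h).
Proof.
have := submodN subI (JI_act g (Jc h m)); congr I.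
rewrite /c !(scalerDr, scalerBr) !scalerN scalerA -gactM -gmulfM mulgA; zmod.
Qed.

Let cobound_b p q : I (b q - b (p * q)%g + b p - c (f p) (f q)).
Proof.
have := submodN subI (JI_act (f p) (Jb q)); congr I.
rewrite /c /b dd gmulfM /= scalerBr; zmod.
Qed.

(** Correcting [u] by a cochain [e] with values in [J] gives a derivation modulo [I] that extends
    [d] modulo [I]. Its values at the generators then agree with [Y] modulo [I], so that all errors
    lie in [I] and Nakayama applies to them. *)
Lemma derivation_extension_aux : exists2 delta : G -> D,
  derivation t delta & forall p, delta (f p) = d p.
Proof.
have [e [ec eb Je]] := relative_H2 subI Of cocycle_c cobound_b.
have {}Je g : J (e g) by apply: Je.
pose delta g := u g - e g.
have dI : derivation_mod lam t I delta.
  move=> g h; have := submodD subI (ec g h) (JI_act g (Je h)); congr I.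
  by rewrite /delta /c scalerBr; zmod.
have fI p : I (delta (f p) - d p).
  by have := submodN subI (eb p); congr I; rewrite /delta /b; zmod.
have etaJ i : J (delta (y i) - Y i).
  have := submodB subJ (@J_word (w (y i)) [:: (i, true)] _) (Je (y i)).
  rewrite wE word_eval_cons word_eval_nil mulg1 => /(_ erefl); congr J.
  by rewrite /delta /u /= /letter_deriv /= scaler0; zmod.
(* [delta] satisfies modulo [I] the system solved by [Y]; the entries of [A] have augmentation zero
   and carry the differences from [J] into [I]. *)
have etaI i : I (delta (y i) - Y i).
  have Ki := AE subI dI fI i; rewrite (YE i).
  have KA : I (\sum_j lam (A i j) *: (delta (y j) - Y j)).
    by apply: (submod_sum subI) => j; apply: JI.
  have := submodD subI Ki KA; congr I.
  have -> : \sum_j lam (A i j) *: (delta (y j) - Y j) =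
      \sum_j lam (A i j) *: delta (y j) - \sum_j lam (A i j) *: Y j.
    by rewrite -sumrB; apply: eq_bigr => j _; rewrite scalerBr.
  by zmod.
have I_word m : I (delta (word_eval y m) - wd Y m).
  have := derivation_mod_word y subI dI m.
  have [a aE] := word_deriv_linear lam D t y m.
  have : I (wd (delta \o y) m - wd Y m).
    rewrite !aE -sumrB; apply: (submod_sum subI) => j.
    by rewrite -scalerBr; apply: (submodZ subI); apply: etaI.
  by move=> K1 K2; have := submodD subI K1 K2; congr I; zmod.
(* A relator evaluates to 1, where a derivation modulo [I] takes a value in [I]; for a generator of
   [P], the agreement with [d] modulo [I] is used. *)
have Ierr r : r \in errs -> I r.
  rewrite mem_cat => /orP[] /mapP[m mr ->].
    have := submodB subI (derivation_mod1 subI dI) (I_word m).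
    by rewrite rel1 //; congr I; zmod.
  have := submodB subI (fI (x m)) (I_word (v m)).
  by rewrite vE; congr I; zmod.
have /choice[B BE] (i : 'I_N) : exists a : 'I_N -> gring R Q,
    (forall j, augmentation (a j) = 0) /\ errs`_i = \sum_j lam (a j) *: errs`_j.
  by have [|a a0 aE] := Ierr errs`_i; [apply: mem_nth | exists a].
have err0 (i : 'I_N) : errs`_i = 0.
  have B0 (i' j : 'I_N) : augmentation (B i' j) = 0 by have [] := BE i'.
  apply: (nakayama lam_inv B0 (e := fun i => errs`_i)) => i'.
  by have [] := BE i'.
have J0 m : J m -> m = 0.
  by move=> [a ->]; rewrite big1 // => j _; rewrite err0 scaler0.
(* Once [J = 0], the uncorrected [u] is itself a derivation extending [d]. *)
exists u => [g h|p].
  by apply/esym/subr0_eq/J0; have := Jc g h; congr J; rewrite /c; zmod.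
by apply/subr0_eq/J0/Jb.
Qed.

End Existence.

Lemma derivation_extension : exists2 delta : G -> D,
  derivation t delta & forall p, delta (f p) = d p.
Proof.
have [[l [x [_ [genP _]]]] [k [y [rels [gen pres]]]] _ _] := Of.
have [z [A [A0 AE]]] := extension_equations gen.
have [Y YE] := nakayama_solve lam_inv A0 (fun i => pairing lam d (z i)).
have [w wE] := choice gen; have [v vE] := choice (fun i => gen (f (x i))).
apply: (derivation_extension_aux pres genP A0 _ YE wE vE) => K delta.
exact: AE.
Qed.

End Extension.

(** * Semidirect products with modules over Cohn-inverting rings *)

Lemma mult_ex (G H : groupType) (f : G -> H) :
  {morph f : x y / (x * y)%g} -> exists g : {multiplicative G -> H}, g =1 f.
Proof.
move=> fM; pose m := monoid.isMultiplicative.Build G H f fM.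
by exists (HB.pack_for {multiplicative G -> H} f m).
Qed.

Record monoid_act (B : groupType) (S : pzRingType) := MonoidAct {
  mact :> B -> S;
  mact1 : mact 1%g = 1;
  mactM : forall x y, mact (x * y)%g = mact x * mact y
}.

Definition sdprod (B : groupType) (S : pzRingType) (r : monoid_act B S)
  (D : lmodType S) : Type := (D * B)%type.

Section Sdprod.
Variables (B : groupType) (S : pzRingType) (r : monoid_act B S) (D : lmodType S).
Local Notation H := (sdprod r D).

HB.instance Definition _ := Choice.copy H (D * B)%type.

Definition sd_mul (u v : H) : H := (u.1 + r u.2 *: v.1, (u.2 * v.2)%g).
Definition sd_one : H := (0, 1%g).
Definition sd_inv (u : H) : H := (- (r u.2^-1%g *: u.1), u.2^-1%g).

Fact sd_mulA : associative sd_mul.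
Proof.
move=> u v w; congr pair; rewrite /= ?mulgA //.
by rewrite mactM scalerDr scalerA addrA.
Qed.
Fact sd_mul1 : left_id sd_one sd_mul.
Proof. by case=> a b; congr pair; rewrite /= ?mul1g // mact1 scale1r add0r. Qed.
Fact sd_1mul : right_id sd_one sd_mul.
Proof. by case=> a b; congr pair; rewrite /= ?mulg1 // scaler0 addr0. Qed.
Fact sd_mulV : left_inverse sd_one sd_inv sd_mul.
Proof. by case=> a b; congr pair; rewrite /= ?mulVg // addNr. Qed.
Fact sd_Vmul : right_inverse sd_one sd_inv sd_mul.
Proof.
case=> a b; congr pair; rewrite /= ?mulgV //.
by rewrite scalerN scalerA -mactM mulgV mact1 scale1r subrr.
Qed.

HB.instance Definition _ :=
  isGroup.Build H sd_mulA sd_mul1 sd_1mul sd_mulV sd_Vmul.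

Lemma sd_mulE (u v : H) : (u * v)%g = (u.1 + r u.2 *: v.1, (u.2 * v.2)%g).
Proof. by []. Qed.

End Sdprod.

(** A homomorphism to the semidirect product is a homomorphism to [B] together with a derivation
    along it into [D]. The former extends uniquely by locality of [B], the latter by the extension
    of derivations. *)
Lemma local_sdprod (R : pzRingType) (Q : groupType) (S : pzRingType)
    (lam : {rmorphism gring R Q -> S}) (D : lmodType S) (B : groupType)
    (t : {multiplicative B -> Q}) (r : monoid_act B S) :
    cohn_inverting lam -> (forall b, r b = gact lam (t b)) ->
  local_group R B -> local_group R (sdprod r D).
Proof.
move=> lam_inv rE Bloc P G f Of h.
have [h2 h2E] : exists h2 : {multiplicative P -> B}, h2 =1 (fun p => (h p).2).
  by apply: mult_ex => p q; rewrite gmulfM.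
have [k kf kU] := Bloc P G f Of h2.
pose tk : {multiplicative G -> Q} := (t \o k).
have dd : derivation lam (tk \o f) (fun p => (h p).1).
  move=> p q; rewrite gmulfM sd_mulE /= rE -h2E.
  by have /= -> := kf p.
have [delta ddelta df] := derivation_extension lam_inv Of dd.
have [kk kkE] : exists kk : {multiplicative G -> sdprod r D},
    kk =1 (fun g => (delta g, k g)).
  by apply: mult_ex => g1 g2; rewrite sd_mulE /= ddelta gmulfM rE.
exists kk => [p|k' k'f g].
  rewrite /= kkE df; have /= -> := kf p.
  by rewrite h2E -surjective_pairing.
have [k2 k2E] : exists k2 : {multiplicative G -> B}, k2 =1 (fun g => (k' g).2).
  by apply: mult_ex => g1 g2; rewrite gmulfM.
have {}k2E x : (k' x).2 = k x.
  rewrite -k2E; apply: kU => p /=; rewrite k2E h2E.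
  by have /= -> := k'f p.
rewrite kkE [LHS]surjective_pairing k2E; congr pair.
apply: (derivation_extension_unique lam_inv Of (t := tk)
  (delta := fun x => (k' x).1) _ ddelta) => [g1 g2|p].
  by rewrite gmulfM sd_mulE /= rE k2E.
by rewrite df; have /= -> := k'f p.
Qed.

(** * The universal derivation *)

Record lsubmod (S : pzRingType) (T : lmodType S) := LSubmod {
  in_lsub :> T -> Prop;
  lsub0 : in_lsub 0;
  lsubB : forall u v, in_lsub u -> in_lsub v -> in_lsub (u - v);
  lsubZ : forall c v, in_lsub v -> in_lsub (c *: v)
}.

Section LQuotient.
Local Open Scope quotient_scope.
Variables (S : pzRingType) (T : lmodType S) (P : lsubmod T).

Lemma lsubN v : P v -> P (- v).
Proof. by move=> Pv; rewrite -sub0r; apply: lsubB => //; apply: lsub0. Qed.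
Lemma lsubD u v : P u -> P v -> P (u + v).
Proof. by move=> Pu Pv; rewrite -[v]opprK; apply: lsubB => //; apply: lsubN. Qed.

Definition lquo_rel : rel T := fun u v => `[< P (u - v) >].

Fact lquo_rel_equiv : equiv_class_of lquo_rel.
Proof.
split=> [u|u v|v u w]; first by apply/asboolP; rewrite subrr; apply: lsub0.
  by apply/asboolP/asboolP => /lsubN; rewrite opprB.
move=> /asboolP uv /asboolP vw; apply/asboolP.
by have := lsubD uv vw; rewrite addrA subrK.
Qed.

Canonical lquo_equiv := EquivRelPack lquo_rel_equiv.

Definition lquo := {eq_quot lquo_equiv}.
HB.instance Definition _ := Choice.on lquo.
HB.instance Definition _ := Quotient.on lquo.

Definition lquo_mk (u : T) : lquo := \pi_lquo u.

Lemma lquo_mkP u v : lquo_mk u = lquo_mk v <-> P (u - v).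
Proof. by split=> [/eqmodP/asboolP //|uv]; apply/eqmodP/asboolP. Qed.

Lemma lquo_reprK u : lquo_mk (repr u) = u.
Proof. exact: reprK. Qed.

Lemma repr_lquo_mk u : P (repr (lquo_mk u) - u).
Proof. by apply/lquo_mkP; apply: lquo_reprK. Qed.

Definition lquo_add (u v : lquo) := lquo_mk (repr u + repr v).
Definition lquo_opp (u : lquo) := lquo_mk (- repr u).
Definition lquo_scale c (u : lquo) := lquo_mk (c *: repr u).

Lemma lquo_addE u v : lquo_add (lquo_mk u) (lquo_mk v) = lquo_mk (u + v).
Proof.
by apply/lquo_mkP; rewrite opprD addrACA; apply: lsubD; apply: repr_lquo_mk.
Qed.
Lemma lquo_oppE u : lquo_opp (lquo_mk u) = lquo_mk (- u).
Proof. by apply/lquo_mkP; rewrite -opprD; apply/lsubN/repr_lquo_mk. Qed.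
Lemma lquo_scaleE c u : lquo_scale c (lquo_mk u) = lquo_mk (c *: u).
Proof. by apply/lquo_mkP; rewrite -scalerBr; apply/lsubZ/repr_lquo_mk. Qed.

Lemma lquo_ind (F : lquo -> Prop) : (forall u, F (lquo_mk u)) -> forall u, F u.
Proof. by move=> Fmk u; rewrite -(lquo_reprK u). Qed.

Fact lquo_addA : associative lquo_add.
Proof.
by elim/lquo_ind=> u; elim/lquo_ind=> v; elim/lquo_ind=> w;
  rewrite !lquo_addE addrA.
Qed.
Fact lquo_addC : commutative lquo_add.
Proof. by elim/lquo_ind=> u; elim/lquo_ind=> v; rewrite !lquo_addE addrC. Qed.
Fact lquo_add0 : left_id (lquo_mk 0) lquo_add.
Proof. by elim/lquo_ind=> u; rewrite lquo_addE add0r. Qed.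
Fact lquo_addN : left_inverse (lquo_mk 0) lquo_opp lquo_add.
Proof. by elim/lquo_ind=> u; rewrite lquo_oppE lquo_addE addNr. Qed.

HB.instance Definition _ :=
  GRing.isZmodule.Build lquo lquo_addA lquo_addC lquo_add0 lquo_addN.

Lemma lquo_mkD u v : lquo_mk (u + v) = lquo_mk u + lquo_mk v.
Proof. by rewrite -lquo_addE. Qed.

Fact lquo_scaleA c e u : lquo_scale c (lquo_scale e u) = lquo_scale (c * e) u.
Proof. by elim/lquo_ind: u => u; rewrite !lquo_scaleE scalerA. Qed.
Fact lquo_scale1 : left_id 1 lquo_scale.
Proof. by elim/lquo_ind=> u; rewrite lquo_scaleE scale1r. Qed.
Fact lquo_scaleDr : right_distributive lquo_scale +%R.
Proof.
move=> c; elim/lquo_ind=> u; elim/lquo_ind=> v.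
by rewrite -lquo_mkD !lquo_scaleE -lquo_mkD scalerDr.
Qed.
Fact lquo_scaleDl u : {morph lquo_scale^~ u : c e / c + e}.
Proof.
move=> c e; elim/lquo_ind: u => u.
by rewrite !lquo_scaleE scalerDl lquo_mkD.
Qed.

HB.instance Definition _ := GRing.Zmodule_isLmodule.Build S lquo
  lquo_scaleA lquo_scale1 lquo_scaleDr lquo_scaleDl.

Lemma lquo_mkN u : lquo_mk (- u) = - lquo_mk u.
Proof. by rewrite -lquo_oppE. Qed.
Lemma lquo_mkZ c u : lquo_mk (c *: u) = c *: lquo_mk u.
Proof. by rewrite -lquo_scaleE. Qed.
Lemma lquo_mk0 u : lquo_mk u = 0 <-> P u.
Proof. by rewrite -[0]/(lquo_mk 0) lquo_mkP subr0. Qed.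

End LQuotient.

Definition fmod (S : pzRingType) (X : choiceType) : Type := {malg S[X]}.

Section FreeModule.
Variables (S : pzRingType) (X : choiceType).
HB.instance Definition _ := GRing.Zmodule.on (fmod S X).

Definition fmod_scale (c : S) (a : fmod S X) : fmod S X :=
  mlift (fun x s => << c * s *g x >>) a.

Let sB c (x : X) : {morph (fun s : S => << c * s *g x >>) : s t / s - t}.
Proof. by move=> s t; rewrite mulrBr monalgUB. Qed.

Lemma fmod_scaleU c s x : fmod_scale c << s *g x >> = << c * s *g x >>.
Proof. exact: (mliftU (sB c)). Qed.

Fact fmod_scaleDr : right_distributive fmod_scale +%R.
Proof. by move=> c; apply: (mliftD (sB c)). Qed.

Let scale0 c : fmod_scale c 0 = 0.
Proof. exact: mlift0. Qed.

Fact fmod_scaleA c e a : fmod_scale c (fmod_scale e a) = fmod_scale (c * e) a.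
Proof.
elim/malg_ind: a => [|a b IHa IHb|s x]; first by rewrite !scale0.
  by rewrite !fmod_scaleDr IHa IHb.
by rewrite !fmod_scaleU mulrA.
Qed.
Fact fmod_scale1 : left_id 1 fmod_scale.
Proof.
elim/malg_ind=> [|a b IHa IHb|s x]; first by rewrite !scale0.
  by rewrite !fmod_scaleDr IHa IHb.
by rewrite !fmod_scaleU mul1r.
Qed.
Fact fmod_scaleDl a : {morph fmod_scale^~ a : c e / c + e}.
Proof.
move=> c e; elim/malg_ind: a => [|a b IHa IHb|s x].
- by rewrite !scale0 addr0.
- by rewrite !fmod_scaleDr IHa IHb; zmod.
- by rewrite !fmod_scaleU mulrDl monalgUD.
Qed.

HB.instance Definition _ := GRing.Zmodule_isLmodule.Build S (fmod S X)
  fmod_scaleA fmod_scale1 fmod_scaleDr fmod_scaleDl.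

Lemma fmodZU c s x : c *: (<< s *g x >> : fmod S X) = << c * s *g x >>.
Proof. exact: fmod_scaleU. Qed.

End FreeModule.

Section UniversalDerivation.
Variables (G : groupType) (S : pzRingType) (r : monoid_act G S).

Local Notation dr := (bar2 (fun s g => s * r g)).

Fact ractB g : {morph (fun s g => s * r g)^~ g : x y / x - y}.
Proof. by move=> x y; rewrite mulrBl. Qed.

(** The coefficients form a bimodule: [bar2] multiplies by [r g] on the right, and so respects
    scalars on the left. *)
Lemma bar2Z c (b : fmod S (G * G)%type) :
  dr (c *: b) = c *: (dr b : fmod S G).
Proof.
elim/malg_ind: b => [|a b IHa IHb|s [g h]].
- by rewrite scaler0 bar2_0 scaler0.
- by rewrite scalerDr !(bar2D ractB) IHa IHb scalerDr.
rewrite fmodZU !(bar2U ractB) scalerDr scalerBr.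
by rewrite !fmodZU mulrA.
Qed.

(** A derivation extends linearly to 1-chains, and the derivation rule says that this extension
    vanishes on boundaries. *)
Lemma H1_null_derivation (D : lmodType S) (delta : G -> D) x :
    (forall g h, delta (g * h)%g = delta g + r g *: delta h) ->
  H1_null r x -> delta x = 0.
Proof.
move=> dd [b xb].
have fB g : {morph (fun s : S => s *: delta g) : s t / s - t}.
  by move=> s t; rewrite scalerBl.
have -> : delta x = mlift (fun g s => s *: delta g) << 1 *g x >>.
  by rewrite mliftU // scale1r.
rewrite xb; elim/malg_ind: {xb} b => [|a b IHa IHb|s [g h]].
- by rewrite bar2_0 ?mlift0.
- by rewrite (bar2D ractB) mliftD // IHa IHb addr0.
rewrite (bar2U ractB) mliftD // mliftB // !mliftU // dd scalerDr scalerA; zmod.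
Qed.

(** [D] is the module of 1-chains modulo boundaries, and [delta g] is the class of [[g]]. *)
Lemma universal_derivation : exists (D : lmodType S) (delta : G -> D),
  (forall g h, delta (g * h)%g = delta g + r g *: delta h) /\
  forall x, delta x = 0 -> H1_null r x.
Proof.
pose P (a : fmod S G) := exists b, a = dr b.
have P0 : P 0 by exists 0; rewrite bar2_0.
have PB u v : P u -> P v -> P (u - v).
  by move=> [a ->] [b ->]; exists (a - b); rewrite (bar2B ractB).
have PZ c v : P v -> P (c *: v).
  by move=> [a ->]; exists (c *: (a : fmod S (G * G)%type)); rewrite bar2Z.
pose D := lquo (LSubmod P0 PB PZ).
exists D, (fun g => lquo_mk (LSubmod P0 PB PZ) << 1 *g g >>); split.
  move=> g h; rewrite -lquo_mkZ -lquo_mkD; apply/lquo_mkP.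
  exists (0 - << 1 *g (g, h) >>); rewrite (bar2B ractB) bar2_0.
  by rewrite (bar2U ractB) fmodZU mul1r mulr1; zmod.
by move=> x /lquo_mk0.
Qed.

End UniversalDerivation.

(** * The Vogel-Cohn series contains the Vogel series *)

Lemma quo_mk1 (G : groupType) (N : G -> Prop) x : N x -> quo_mk N x = 1%g.
Proof.
move=> Nx; rewrite -(mult1 (quo_mk N)); apply/esym/quo_mkP.
by rewrite invg1 mul1g; apply: nc_in.
Qed.

Definition gact_act (R : pzRingType) (Q B : groupType) (S : pzRingType)
    (lam : {rmorphism gring R Q -> S}) (t : {multiplicative B -> Q}) :
  monoid_act B S.
Proof.
exists (fun b => gact lam (t b)); first by rewrite mult1 gact1.
by move=> x y; rewrite gmulfM gactM.
Defined.

(* The class of [x] in a module on which [N] acts trivially only depends on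
   the image of [x] in [N/[N,N] (x) R]. *)
Lemma ab_tensor_null_derivation (R : pzRingType) (G : groupType)
    (N : G -> Prop) (S : pzRingType) (lam : {rmorphism gring R (quo N) -> S})
    (D : lmodType S) (delta : G -> D) x :
    derivation lam (quo_mk N) delta -> ab_tensor_null R N x -> delta x = 0.
Proof.
move=> dd [Nx gx].
pose F := mlift (fun (p : G * R) (m : int) => (cst lam p.2 *: delta p.1) *~ m).
have fB (p : G * R) :
    {morph (fun m : int => (cst lam p.2 *: delta p.1) *~ m) : a b / a - b}.
  by move=> a b; rewrite mulrzBr.
have FU p : F << 1 *g p >> = cst lam p.2 *: delta p.1 by rewrite /F mliftU.
suff: forall v, subgroup_gen (biadditivity N) v -> F v = 0.
  by move/(_ _ gx); rewrite FU cst1 scale1r.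
have FB : {morph F : a b / a - b} by apply: mliftB.
move=> v; elim=> [w [y z r Ny Nz|y r s Ny]||a b _ Fa _ Fb].
- by rewrite !FB !FU /= dd (quo_mk1 Ny) gact1 scale1r scalerDr; zmod.
- rewrite !FB !FU /= -!scalerBl -{1}[s]opprK.
  have -> : cst lam (r - - s) = cst lam r + cst lam s.
    by rewrite opprK /cst monalgUD rmorphD.
  by rewrite -addrA -opprD subrr scale0r.
- exact: mlift0.
- by rewrite FB Fa Fb subrr.
Qed.

Section VogelCohn.
Variables (d : Order.disp_t) (W : orderType d).
Variable wfW : well_founded (fun m n : W => (m < n)%O).
Variables (R : pzRingType) (E : vogel_localization R) (L : cohn_localization R).

(* A derivation of [G] into an [L]-module is a map from [G] to a semidirect
   product that is local, hence it extends to [E G]. *)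
Lemma derivation_vogel (G Q : groupType) (S : pzRingType)
    (lam : {rmorphism gring R Q -> S}) (t : {multiplicative vogel E G -> Q})
    (D : lmodType S) (delta : G -> D) :
    cohn_inverting lam ->
    (forall g h, delta (g * h)%g =
       delta g + gact lam (t (vogel_map E G g)) *: delta h) ->
  exists2 delta' : E G -> D, derivation lam t delta' &
    forall g, delta' (vogel_map E G g) = delta g.
Proof.
move=> lam_inv dd.
have Aloc : local_group R (sdprod (gact_act lam t) D).
  by apply: local_sdprod lam_inv _ (@vogel_local R E G).
have [h hE] : exists h : {multiplicative G -> sdprod (gact_act lam t) D},
    h =1 (fun g => (delta g, vogel_map E G g)).
  by apply: mult_ex => x y; rewrite sd_mulE /= dd gmulfM.
have [k kh _] := vogel_initial E h Aloc.
have [i iE iU] := vogel_initial E (vogel_map E G) (@vogel_local R E G).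
have [k2 k2E] : exists k2 : {multiplicative E G -> E G}, k2 =1 (fun g => (k g).2).
  by apply: mult_ex => x y; rewrite gmulfM.
have [j jE] : exists j : {multiplicative E G -> E G}, j =1 id by apply: mult_ex.
(* The second component of [k] and the identity both extend [vogel_map] to [E G]; initiality
   identifies them. *)
have {}k2E g : (k g).2 = g.
  rewrite -k2E -[RHS]jE; transitivity (i g); last apply/esym; apply: iU => y /=.
    by rewrite k2E; have /= -> := kh y; rewrite hE.
  by rewrite jE.
exists (fun g => (k g).1) => [x y|x]; last by have /= -> := kh x; rewrite hE.
by rewrite gmulfM sd_mulE /= k2E.
Qed.

Lemma vogel_vogel_cohn n (G : groupType) (x : G) :
  vogel_series wfW E n x -> vogel_cohn_series wfW E L n x.
Proof.
elim/(well_founded_ind wfW): n G x => n IH G x.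
have [[m mn]|lim] := covers_or_limit n; last first.
  rewrite /vogel_series /vogel_cohn_series !series_limit // => h m mn.
  by apply: (IH m mn); apply: h.
rewrite /vogel_series /vogel_cohn_series !(series_succ _ _ _ mn) => -[Sx tx].
split; first exact: IH mn.1 G x Sx.
set N := series wfW (vogel_cohn_step E L) m (G := E G).
(* By induction the Vogel term of [E G] lies in its Vogel-Cohn term [N], so the vanishing can be
   read in this larger subgroup. *)
have {}tx : ab_tensor_null R N (vogel_map E G x).
  apply: (@ab_tensor_null_map R _ _ idfun _ N _ _ tx) => y.
  exact: IH mn.1 (E G) y.
pose lam := cohn_map L (quo N).
have [r rE] : exists r : monoid_act G (L (quo N)),
    r =1 (fun g => gact lam (quo_mk N (vogel_map E G g))).
  pose t := quo_mk N \o vogel_map E G : {multiplicative G -> quo N}.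
  by exists (gact_act lam t).
have [D [delta [dd null]]] := universal_derivation r.
have [|delta' dd' dE] :=
  @derivation_vogel G (quo N) _ lam (quo_mk N) D delta (@cohn_map_inverting R L _).
  by move=> g h; rewrite dd rE.
move: (null x); rewrite (funext rE); apply.
by rewrite -dE; apply: ab_tensor_null_derivation tx.
Qed.

End VogelCohn.

(** * Endomorphism rings *)

Record endo (V : zmodType) := Endo {
  efun :> V -> V;
  endoB : {morph efun : x y / x - y}
}.

Section EndoRing.
Variable V : zmodType.
Implicit Types f g h : endo V.

HB.instance Definition _ := gen_eqMixin (endo V).
HB.instance Definition _ := gen_choiceMixin (endo V).

Lemma endo_eq f g : f =1 g -> f = g.
Proof.
case: f g => [f fB] [g gB] /= /funext fg; rewrite {}fg in fB *.
by congr Endo; apply: Prop_irrelevance.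
Qed.

Lemma endo0 f : f 0 = 0.
Proof. by rewrite -[in LHS](subrr 0) endoB subrr. Qed.
Lemma endoN f : {morph f : x / - x}.
Proof. by move=> x; rewrite -sub0r endoB endo0 sub0r. Qed.
Lemma endoD f : {morph f : x y / x + y}.
Proof. by move=> x y; rewrite -{1}[y]opprK endoB endoN opprK. Qed.

Fact zeroB : {morph (fun _ : V => 0 : V) : x y / x - y}.
Proof. by move=> x y; rewrite subrr. Qed.
Fact addB f g : {morph (fun x => f x + g x) : x y / x - y}.
Proof. by move=> x y; rewrite !endoB; zmod. Qed.
Fact oppB f : {morph (fun x => - f x) : x y / x - y}.
Proof. by move=> x y; rewrite endoB; zmod. Qed.
Fact compB f g : {morph (fun x => f (g x)) : x y / x - y}.
Proof. by move=> x y; rewrite !endoB. Qed.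

Definition endo_zero := Endo zeroB.
Definition endo_add f g := Endo (addB f g).
Definition endo_opp f := Endo (oppB f).
Definition endo_one : endo V := @Endo V id (fun _ _ => erefl).
Definition endo_mul f g := Endo (compB f g).

Fact endo_addA : associative endo_add.
Proof. by move=> f g h; apply: endo_eq => x /=; rewrite addrA. Qed.
Fact endo_addC : commutative endo_add.
Proof. by move=> f g; apply: endo_eq => x /=; rewrite addrC. Qed.
Fact endo_add0 : left_id endo_zero endo_add.
Proof. by move=> f; apply: endo_eq => x /=; rewrite add0r. Qed.
Fact endo_addN : left_inverse endo_zero endo_opp endo_add.
Proof. by move=> f; apply: endo_eq => x /=; rewrite addNr. Qed.

HB.instance Definition _ :=
  GRing.isZmodule.Build (endo V) endo_addA endo_addC endo_add0 endo_addN.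

Fact endo_mulA : associative endo_mul.
Proof. by move=> f g h; apply: endo_eq. Qed.
Fact endo_mul1 : left_id endo_one endo_mul.
Proof. by move=> f; apply: endo_eq. Qed.
Fact endo_1mul : right_id endo_one endo_mul.
Proof. by move=> f; apply: endo_eq. Qed.
Fact endo_mulDl : left_distributive endo_mul +%R.
Proof. by move=> f g h; apply: endo_eq. Qed.
Fact endo_mulDr : right_distributive endo_mul +%R.
Proof. by move=> f g h; apply: endo_eq => x /=; rewrite endoD. Qed.

HB.instance Definition _ := GRing.Zmodule_isPzRing.Build (endo V)
  endo_mulA endo_mul1 endo_1mul endo_mulDl endo_mulDr.

(** [V] as a module over all its endomorphisms. An action of a ring on [V] is then a ring morphism
    to [endo V], and invertibility of a matrix there amounts to bijectivity on tuples of elements of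
    [V]. *)
Definition emod : Type := V.
HB.instance Definition _ := GRing.Zmodule.on emod.

Definition emod_scale (f : endo V) (v : emod) : emod := f v.

Fact emod_scaleA f g v : emod_scale f (emod_scale g v) = emod_scale (f * g) v.
Proof. by []. Qed.
Fact emod_scale1 : left_id 1 emod_scale.
Proof. by []. Qed.
Fact emod_scaleDr : right_distributive emod_scale +%R.
Proof. by move=> f u v; apply: endoD. Qed.
Fact emod_scaleDl v : {morph emod_scale^~ v : f g / f + g}.
Proof. by []. Qed.

HB.instance Definition _ := GRing.Zmodule_isLmodule.Build (endo V) emod
  emod_scaleA emod_scale1 emod_scaleDr emod_scaleDl.

Lemma endo_sum I (r : seq I) (P : pred I) (F : I -> endo V) v :
  (\sum_(i <- r | P i) F i) v = \sum_(i <- r | P i) F i v.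
Proof. by apply: (big_morph (fun f : endo V => f v)). Qed.

(** The columns of the inverse solve the system for right-hand sides concentrated at one index;
    uniqueness of solutions makes them additive. *)
Lemma invertible_endo k (A : 'M[endo V]_k) :
    (forall v : 'I_k -> V, exists w : 'I_k -> V,
       forall i, \sum_j A i j (w j) = v i) ->
    (forall w : 'I_k -> V,
       (forall i, \sum_j A i j (w j) = 0) -> forall j, w j = 0) ->
  invertible_mx A.
Proof.
move=> surjA injA.
have /choice[s sE] (v : V * 'I_k) : exists w : 'I_k -> V,
    forall i, \sum_j A i j (w j) = if i == v.2 then v.1 else 0.
  exact: surjA.
have unique v w1 w2 : (forall i, \sum_j A i j (w1 j) = v i) ->
    (forall i, \sum_j A i j (w2 j) = v i) -> forall j, w1 j = w2 j.
  move=> E1 E2 j; apply/subr0_eq; apply: (injA (fun j => w1 j - w2 j)) => i.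
  by under eq_bigr do rewrite endoB; rewrite sumrB E1 E2 subrr.
have sB j l : {morph (fun v => s (v, l) j) : x y / x - y}.
  move=> x y; move: j; apply: (unique (fun i => if i == l then x - y else 0)).
    by move=> i; rewrite sE.
  move=> i; under eq_bigr do rewrite endoB.
  by rewrite sumrB !sE; case: eqP; rewrite ?subrr.
pose B : 'M[endo V]_k := \matrix_(j, l) Endo (sB j l).
have AB : A *m B = 1%:M.
  apply/matrixP => i l; apply: endo_eq => v; rewrite !mxE endo_sum.
  under eq_bigr do rewrite mxE; rewrite [LHS](sE (v, l)) /=.
  by case: eqP.
(* [A (B A e) = A e] by [AB], and injectivity of [A] gives [B A e = e]. *)
exists B; split=> //; apply/matrixP => j l; apply: endo_eq => v.
pose e (i : 'I_k) : V := if i == l then v else 0.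
transitivity (\sum_m B j m (\sum_i A m i (e i))).
  rewrite !mxE endo_sum; apply: eq_bigr => m _; congr (B j m _).
  by rewrite (bigD1 l) //= /e eqxx big1 ?addr0 // => i /negPf ->; rewrite endo0.
transitivity (e j); last by rewrite /e !mxE; case: eqP.
move: j; apply: (unique (fun i => \sum_m A i m (e m))) => // i.
transitivity (\sum_m (A *m B) i m (\sum_l A m l (e l))).
  under [in RHS]eq_bigr do rewrite mxE endo_sum.
  rewrite exchange_big; apply: eq_bigr => m _ /=.
  by rewrite (big_morph (A i m) (@endoD _) (@endo0 _)).
rewrite AB [LHS](bigD1 i) //= [X in _ + X]big1 ?addr0 => [|m mi]; first by rewrite mxE eqxx.
by rewrite mxE eq_sym (negPf mi).
Qed.

End EndoRing.

(** * Products of groups *)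

Definition gprod (J : Type) (B : J -> groupType) : Type := forall j, B j.

Section GroupProduct.
Variables (J : Type) (B : J -> groupType).
Local Notation H := (gprod B).
Local Open Scope group_scope.

HB.instance Definition _ := gen_eqMixin H.
HB.instance Definition _ := gen_choiceMixin H.

Definition gprod_mul (u v : H) : H := fun j => u j * v j.
Definition gprod_one : H := fun j => 1.
Definition gprod_inv (u : H) : H := fun j => (u j)^-1.

Fact gprod_mulA : associative gprod_mul.
Proof. by move=> u v w; apply: functional_extensionality_dep => j; apply: mulgA. Qed.
Fact gprod_mul1 : left_id gprod_one gprod_mul.
Proof. by move=> u; apply: functional_extensionality_dep => j; apply: mul1g. Qed.
Fact gprod_1mul : right_id gprod_one gprod_mul.
Proof. by move=> u; apply: functional_extensionality_dep => j; apply: mulg1. Qed.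
Fact gprod_mulV : left_inverse gprod_one gprod_inv gprod_mul.
Proof. by move=> u; apply: functional_extensionality_dep => j; apply: mulVg. Qed.
Fact gprod_Vmul : right_inverse gprod_one gprod_inv gprod_mul.
Proof. by move=> u; apply: functional_extensionality_dep => j; apply: mulgV. Qed.

HB.instance Definition _ :=
  isGroup.Build H gprod_mulA gprod_mul1 gprod_1mul gprod_mulV gprod_Vmul.

Lemma gprod_mulE (u v : H) j : (u * v) j = u j * v j.
Proof. by []. Qed.

Lemma gprod_coord_ex (G : groupType) (h : {multiplicative G -> H}) j :
  exists hj : {multiplicative G -> B j}, hj =1 h^~ j.
Proof. by apply: mult_ex => x y; rewrite gmulfM. Qed.

Lemma local_gprod (R : pzRingType) :
  (forall j, local_group R (B j)) -> local_group R H.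
Proof.
move=> Bloc P G f Of h.
have ext j : exists k : {multiplicative G -> B j}, (forall p, k (f p) = h p j) /\
    forall k' : {multiplicative G -> H}, k' \o f =1 h -> k'^~ j =1 k.
  have [hj hjE] := gprod_coord_ex h j; have [k kf kU] := Bloc j P G f Of hj.
  exists k; split=> [p|k' k'f g]; first by rewrite -hjE -kf.
  have [k'j k'jE] := gprod_coord_ex k' j; rewrite -k'jE.
  by apply: kU => p; rewrite /= k'jE hjE; have /= -> := k'f p.
pose k j := projT1 (cid (ext j)); have kE j := projT2 (cid (ext j)).
have [kk kkE] : exists kk : {multiplicative G -> H}, kk =1 (fun g j => k j g).
  apply: mult_ex => x y; apply: functional_extensionality_dep => j.
  by rewrite gmulfM.
exists kk => [p|k' k'f g]; apply: functional_extensionality_dep => j.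
  by rewrite /= kkE; have [-> _] := kE j.
by rewrite kkE; have [_ kU] := kE j; apply: kU.
Qed.

End GroupProduct.

(** * Homomorphisms that kill the Vogel-Cohn series *)

Lemma quo_lift_ex (G H : groupType) (N : G -> Prop) (k : {multiplicative G -> H}) :
    (forall x, N x -> k x = 1%g) ->
  exists kq : {multiplicative quo N -> H}, forall x, kq (quo_mk N x) = k x.
Proof.
move=> kN.
have kN' x : normal_closure N x -> k x = 1%g.
  elim=> [y /kN //||y z _ IHy _ IHz|y _ IH|y z _ IH].
  - exact: mult1.
  - by rewrite gmulfM IHy IHz mulg1.
  - by rewrite multV IH invg1.
  - by rewrite conjgE !gmulfM multV IH mul1g mulVg.
have k_repr x : k (repr (quo_mk N x)) = k x.
  have /quo_mkP/kN' := quo_reprK (quo_mk N x).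
  by rewrite gmulfM multV => /mulg1_eq; rewrite invgK.
have [|kq kqE] := @mult_ex (quo N) H (fun u => k (repr u)).
  by move=> u v; rewrite -gmulfM -[RHS]k_repr -quo_mk_mul !quo_reprK.
by exists kq => x; rewrite kqE k_repr.
Qed.

Lemma H1_null_map (G : groupType) (S S' : pzRingType) (psi : {rmorphism S -> S'})
    (r : monoid_act G S) (r' : monoid_act G S') x :
  (forall g, r' g = psi (r g)) -> H1_null r x -> H1_null r' x.
Proof.
move=> r'E [b xb].
pose F (X : choiceType) := mlift (fun (y : X) s => << psi s *g y >>).
have FB (X : choiceType) (y : X) :
    {morph (fun s => << psi s *g y >>) : s t / s - t}.
  by move=> s t; rewrite rmorphB monalgUB.
have FD X : {morph F X : a c / a + c} := mliftD (@FB X).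
have FBB X : {morph F X : a c / a - c} := mliftB (@FB X).
have FU X y s : F X << s *g y >> = << psi s *g y >> := mliftU (@FB X) s y.
have F0 X : F X 0 = 0 by apply: mlift0.
exists (F _ b); rewrite -[1 in LHS](rmorph1 psi) -FU xb.
elim/malg_ind: {xb} b => [|b1 b2 IH1 IH2|s [g h]].
- by rewrite F0 !bar2_0 F0.
- rewrite (bar2D (@ractB _ _ r)) FD [in RHS]FD (bar2D (@ractB _ _ r')).
  by rewrite IH1 IH2.
rewrite [in RHS]FU (bar2U (@ractB _ _ r)) (bar2U (@ractB _ _ r')).
by rewrite FD FBB !FU rmorphM r'E.
Qed.

Lemma cohn_inverting_comp (R : pzRingType) (Q B : groupType) (S : pzRingType)
    (lam : {rmorphism gring R B -> S}) (t : {rmorphism gring R Q -> gring R B}) :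
    (forall a, augmentation (t a) = augmentation a) ->
  cohn_inverting lam -> cohn_inverting (lam \o t).
Proof.
move=> augt lam_inv k A invA; rewrite map_mx_comp; apply: lam_inv.
by rewrite -map_mx_comp (_ : _ \o _ = @augmentation R Q) //; apply: funext.
Qed.

Section Kills.
Variables (d : Order.disp_t) (W : orderType d).
Variable wfW : well_founded (fun m n : W => (m < n)%O).
Variables (R : pzRingType) (E : vogel_localization R) (L : cohn_localization R).

(** All groups [G] are allowed, because the successor step applies this to [E G] and not to the
    group it starts from. *)
Definition kills (n : W) (B : groupType) :=
  forall (G : groupType) (h : {multiplicative G -> B}) x,
    vogel_cohn_series wfW E L n x -> h x = 1%g.

Lemma kills_gprod n (J : Type) (B : J -> groupType) :
  (forall j, kills n (B j)) -> kills n (gprod B).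
Proof.
move=> kB G h x nx; apply: functional_extensionality_dep => j.
by have [hj hjE] := gprod_coord_ex h j; rewrite -hjE; apply: kB nx.
Qed.

Lemma kills_limit n m B : (forall k, ~ covers k n) -> (m < n)%O ->
  kills m B -> kills n B.
Proof.
by move=> lim mn kB G h x; rewrite /vogel_cohn_series series_limit // => /(_ m mn)/kB.
Qed.

(** Locality of [B] extends [G -> B] to [E G], where it kills the [m]-th term [N]. So [E G / N] maps
    to [B], [D] becomes a module over the Cohn localization, and the [D]-coordinate of [h], a
    derivation, vanishes on null classes. *)
Lemma kills_sdprod m n (B : groupType) (S : pzRingType)
    (lam : {rmorphism gring R B -> S}) (D : lmodType S) (r : monoid_act B S) :
    covers m n -> cohn_inverting lam -> (forall b, r b = gact lam b) ->
    local_group R B -> kills m B ->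
  kills n (sdprod r D).
Proof.
move=> mn lam_inv rE Bloc kB G h x.
rewrite /vogel_cohn_series (series_succ _ _ _ mn) => -[Sx nullx].
have [b bE] : exists b : {multiplicative G -> B}, b =1 (fun g => (h g).2).
  by apply: mult_ex => u v; rewrite gmulfM.
have b1 : (h x).2 = 1%g by rewrite -bE; apply: kB Sx.
rewrite [h x]surjective_pairing b1; congr pair.
have [k kb _] := vogel_initial E b Bloc.
set N := series wfW (vogel_cohn_step E L) m (G := E G) in nullx.
have [|kq kqE] := @quo_lift_ex _ _ N k; first exact: kB.
have [t tE] := gring_map_ex (idfun : {rmorphism R -> R}) kq.
have t_aug a : augmentation (t a) = augmentation a.
  have D1 : {morph (fun a => augmentation (t a)) : a b / a + b}.
    by move=> u v; rewrite !rmorphD.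
  apply: (malg_ext D1 (@rmorphD _ _ (@augmentation R (quo N)))) => r0 y.
  by rewrite tE /= !augmentationU.
have [psi psiE _] := cohn_initial L (cohn_inverting_comp t_aug lam_inv).
pose e := quo_mk N \o vogel_map E G : {multiplicative G -> quo N}.
have r'1 : (r \o b) 1%g = 1 by rewrite /= mult1 mact1.
have r'M u v : (r \o b) (u * v)%g = (r \o b) u * (r \o b) v.
  by rewrite /= gmulfM mactM.
pose r' := MonoidAct r'1 r'M.
have nullr' : H1_null r' x.
  apply: (@H1_null_map _ _ _ psi (gact_act (cohn_map L (quo N)) e)) => [g|].
    rewrite /= /gact; have /= -> := psiE (gring_of R (quo_mk N (vogel_map E G g))).
    rewrite tE /= kqE rE /gact; congr (lam (gring_of R _)).
    by have /= <- := kb g.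
  exact: nullx.
apply: (H1_null_derivation (delta := fun g => (h g).1) _ nullr') => u v.
by rewrite gmulfM sd_mulE /= bE.
Qed.

End Kills.

(** * Amenable groups with unique products and Strebel's property *)

Definition unique_products (G : groupType) :=
  forall A B : seq G, A != [::] -> B != [::] ->
  exists a b, [/\ a \in A, b \in B & forall a' b', a' \in A -> b' \in B ->
    (a' * b' = a * b)%g -> a' = a /\ b' = b].

(** The Folner condition for left translations, with tolerance [1/n]. *)
Definition folner (G : groupType) :=
  forall (X : seq G) (n : nat), exists F : seq G,
  [/\ uniq F, (0 < size F)%N & forall x, x \in X ->
    (n * count (fun f => (x * f)%g \notin F) F <= size F)%N].

(** A matrix over the rational group ring that is injective after augmentation is injective. The set
    of rows is arbitrary, because an extension of groups creates one row for every element of the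
    quotient. *)
Definition strebel (G : groupType) :=
  forall (I : Type) (J : finType) (T : I -> J -> gring rat G),
    (forall u : J -> rat,
       (forall i, \sum_j augmentation (T i j) * u j = 0) -> forall j, u j = 0) ->
  forall w : J -> gring rat G,
    (forall i, \sum_j T i j * w j = 0) -> forall j, w j = 0.

Record good (G : groupType) : Prop := Good {
  good_up : unique_products G;
  good_folner : folner G;
  good_strebel : strebel G
}.

(* [ext_s] is a set-theoretic section of [ext_p], and [ext_r] the resulting
   coordinate in [N]. *)
Record extension (N H G : groupType) := Extension {
  ext_p : {multiplicative H -> G};
  ext_i : {multiplicative N -> H};
  ext_s : G -> H;
  ext_r : H -> N;
  ext_i_inj : injective ext_i;
  ext_pi : forall n, ext_p (ext_i n) = 1%g;
  ext_ps : forall g, ext_p (ext_s g) = g;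
  ext_dec : forall h, h = (ext_s (ext_p h) * ext_i (ext_r h))%g
}.

Lemma count_allpairs (S T U : Type) (f : S -> T -> U) (a : pred U) s t :
  count a [seq f x y | x <- s, y <- t] = \sum_(x <- s) count (fun y => a (f x y)) t.
Proof.
elim: s => [|x s IH]; first by rewrite big_nil.
by rewrite big_cons allpairs_cons count_cat IH count_map.
Qed.

Lemma malg_ext_supp (M N : zmodType) (K : choiceType)
    (f g : {malg M[K]} -> N) c :
    {morph f : a b / a + b} -> {morph g : a b / a + b} ->
    (forall k, k \in msupp c -> f << c@_k *g k >> = g << c@_k *g k >>) ->
  f c = g c.
Proof.
move=> fD gD fg; have f0 : f 0 = 0 by apply: (addrI (f 0)); rewrite -fD !addr0.
have g0 : g 0 = 0 by apply: (addrI (g 0)); rewrite -gD !addr0.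
rewrite [c in f c]monalgE [c in g c]monalgE.
by rewrite (big_morph f fD f0) (big_morph g gD g0); apply: eq_big_seq.
Qed.

(** * Extensions of good groups *)

Section GoodExtension.
Variables (N H G : groupType) (e : extension N H G).
Local Notation p := (ext_p e).
Local Notation i := (ext_i e).
Local Notation s := (ext_s e).
Local Notation r := (ext_r e).

Lemma ext_inj x y : p x = p y -> r x = r y -> x = y.
Proof. by move=> pxy rxy; rewrite (ext_dec e x) (ext_dec e y) pxy rxy. Qed.

Lemma ext_rM x n : r (x * i n)%g = (r x * n)%g.
Proof.
apply: (@ext_i_inj _ _ _ e); apply: (mulgI (s (p (x * i n)%g))).
by rewrite -ext_dec gmulfM ext_pi mulg1 gmulfM mulgA -ext_dec.
Qed.

(** Left multiplication by [x] maps the fibre above [p y] to another fibre, and acts on coordinates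
    as the left translation by [r (x * s (p y))]. *)
Lemma ext_r_mul x y : r (x * y)%g = (r (x * s (p y)) * r y)%g.
Proof. by rewrite {1}(ext_dec e y) mulgA ext_rM. Qed.

(** Take a uniquely represented product of the images in [G]. In the fibres above it the coordinate
    of [a * b] is [r (a * s (p b1)) * r b], and a uniquely represented product of these coordinates
    in [N] settles the pair. *)
Lemma unique_products_extension :
  unique_products N -> unique_products G -> unique_products H.
Proof.
move=> upN upG A B A0 B0.
have nz (T U : eqType) (f : T -> U) (C : seq T) : C != [::] -> map f C != [::].
  by case: C.
have [_ [_ [/mapP[a1 a1A ->] /mapP[b1 b1B ->] uab]]] := upG _ _ (nz _ _ p _ A0) (nz _ _ p _ B0).
pose A' := [seq r (a * s (p b1))%g | a <- A & p a == p a1].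
pose B' := [seq r b | b <- B & p b == p b1].
have memA a : a \in A -> p a = p a1 -> r (a * s (p b1))%g \in A'.
  by move=> aA pa; apply/mapP; exists a; rewrite // mem_filter pa eqxx.
have memB b : b \in B -> p b = p b1 -> r b \in B'.
  by move=> bB pb; apply/mapP; exists b; rewrite // mem_filter pb eqxx.
have A'0 : A' != [::] by apply/eqP => A'0; have := memA a1 a1A erefl; rewrite A'0.
have B'0 : B' != [::] by apply/eqP => B'0; have := memB b1 b1B erefl; rewrite B'0.
have [_ [_ [/mapP[a + ->] /mapP[b + ->] uab']]] := upN _ _ A'0 B'0.
rewrite !mem_filter => /andP[/eqP pa aA] /andP[/eqP pb bB].
exists a, b; split=> // a' b' a'A b'B ab.
have [|pa' pb'] := uab (p a') (p b') (map_f _ a'A) (map_f _ b'B).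
  by rewrite -gmulfM ab gmulfM pa pb.
have [|ra rb] := uab' _ _ (memA a' a'A pa') (memB b' b'B pb').
  have := congr1 r ab.
  by rewrite (ext_r_mul a' b') (ext_r_mul a b) pb' pb.
have {}rb : b' = b by apply: ext_inj; rewrite ?pb'.
by split=> //; rewrite rb in ab; apply: mulIg ab.
Qed.

(** The set is made of the [s g * i m]. As [x] acts on the fibre above [g] through [r (x * s g)],
    [FN] is chosen after [FG], for these finitely many translations. Leaving [FG] and leaving [FN]
    each get half of the tolerance, whence [n.*2]. *)
Lemma folner_extension : folner N -> folner G -> folner H.
Proof.
move=> fN fG X n.
have [FG [uG FG0 XG]] := fG (map p X) n.*2.
have [FN [uN FN0 YN]] := fN [seq r (x * s g)%g | x <- X, g <- FG] n.*2.
pose F := [seq (s g * i m)%g | g <- FG, m <- FN].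
have pF g m : p (s g * i m)%g = g by rewrite gmulfM ext_pi ext_ps mulg1.
exists F; split.
- apply: allpairs_uniq => // -[g m] [g' m'] _ _ /= gm.
  have gg : g = g' by rewrite -(pF g m) gm pF.
  by rewrite {}gg in gm *; congr pair; apply: (@ext_i_inj _ _ _ e); apply: mulgI gm.
- by rewrite size_allpairs muln_gt0 FG0.
move=> x xX; rewrite -leq_double doubleMl count_allpairs size_allpairs.
have bound g : g \in FG -> (count (fun m => (x * (s g * i m))%g \notin F) FN <=
    ((p x * g)%g \notin FG) * size FN +
    count (fun m => (r (x * s g)%g * m)%g \notin FN) FN)%N.
  move=> gF; have [xg|xg] := boolP (_ \in FG); last first.
    by rewrite mul1n (leq_trans (count_size _ _)) // leq_addr.
  rewrite mul0n add0n; apply: sub_count => m; apply: contra => /= rm.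
  have -> : (x * (s g * i m) = s (p x * g) * i (r (x * s g) * m))%g.
    by rewrite [LHS](ext_dec e) mulgA ext_rM !gmulfM ext_pi ext_ps mulg1.
  exact: allpairs_f.
have: (n.*2 * \sum_(g <- FG) (((p x * g)%g \notin FG) * size FN +
    count (fun m => (r (x * s g)%g * m)%g \notin FN) FN) <= (size FG * size FN).*2)%N.
  rewrite big_split /= mulnDr -[leqRHS]addnn; apply: leq_add.
    rewrite -big_distrl /= mulnA leq_mul2r; apply/orP; right.
    rewrite -big_mkcond /= sum1_count; exact: XG (p x) (map_f _ xX).
  rewrite big_distrr /= -[size FG]sum1_size big_distrl /= !big_seq.
  apply: leq_sum => g gF; rewrite mul1n; apply: YN; exact: allpairs_f.
apply: leq_trans; rewrite leq_mul2l !big_seq leq_sum ?orbT //.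
Qed.

(** The coordinates of [a] when the group ring of [H] is viewed as a free right module over that of
    [N], with the [s k] as basis. *)
Let R (k : G) (a : gring rat H) : gring rat N :=
  mlift (fun h q => if p h == k then << q *g r h >> else 0) a.

Let RB k h : {morph (fun q : rat => if p h == k then << q *g r h >> else 0)
    : q1 q2 / q1 - q2}.
Proof. by move=> q1 q2; case: ifP; rewrite ?monalgUB ?subr0. Qed.

Let RU k q h : R k << q *g h >> = if p h == k then << q *g r h >> else 0.
Proof. exact: (mliftU (@RB k)). Qed.
Let RD k : {morph R k : a b / a + b}. Proof. exact: (mliftD (@RB k)). Qed.
Let R0 k : R k 0 = 0. Proof. exact: mlift0. Qed.

(** The matrix of left multiplication by [a] in the basis of the [s c]; [C] lists the finitely many
    cosets that matter for [b]. *)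
Let R_mul k (C : seq G) (a b : gring rat H) :
    uniq C -> (forall h, h \in msupp b -> p h \in C) ->
  R k (a * b) = \sum_(c <- C) R k (a * (<< 1 *g s c >> : gring rat H)) * R c b.
Proof.
move=> uC bC.
apply: (malg_ext_supp (f := fun b : gring rat H => R k (a * b))
  (g := fun b : gring rat H =>
          \sum_(c <- C) R k (a * (<< 1 *g s c >> : gring rat H)) * R c b)).
- by move=> u v; rewrite mulrDr RD.
- by move=> u v; rewrite -big_split; apply: eq_bigr => c _; rewrite RD mulrDr.
move=> h /bC hC; rewrite (bigD1_seq (p h)) //= RU eqxx big1_seq ?addr0; last first.
  by move=> c /andP[/negPf ch _]; rewrite RU eq_sym ch mulr0.
move: (b@_h) => q; elim/gring_ind: a => [|a1 a2 IH1 IH2|q' x].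
- by rewrite !mul0r R0 mul0r.
- have D u : (a1 + a2) * u = a1 * u + a2 * u by exact: mulrDl.
  rewrite [in LHS]D [in RHS]D 2!RD IH1 IH2; exact/esym/mulrDl.
rewrite !gringUU !RU !gmulfM ext_ps; case: ifP => _; last by rewrite mul0r.
by rewrite gringUU mulr1 ext_r_mul.
Qed.

Lemma coef_mulU (K : groupType) (a : gring rat K) q x k :
  (a * (<< q *g x >> : gring rat K))@_k = (a * (<< 1 *g x >> : gring rat K))@_k * q.
Proof.
elim/gring_ind: a => [|a b IHa IHb|q' y]; first by rewrite !mul0r mcoeff0 mul0r.
  have D u : (a + b) * u = a * u + b * u by exact: mulrDl.
  rewrite [in LHS]D [in RHS]D [LHS]mcoeffD IHa IHb -mulrDl; congr (_ * _).
  exact/esym/mcoeffD.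
by rewrite !gringUU !mcoeffU mulr1 mulrnAl.
Qed.

(** In coordinates [T] becomes a matrix [T'] over the group ring of [N], with rows indexed by
    [I * G]. Its augmentation lists the coefficients of the image of [T] over the group ring of [G],
    so the property for [G] gives the hypothesis of the property for [N]. *)
Lemma strebel_extension : strebel N -> strebel G -> strebel H.
Proof.
move=> sN sG I J T Tinj w Tw.
have [P PE] := gring_map_ex (idfun : {rmorphism rat -> rat}) p.
have [Q QE] := gring_map_ex (idfun : {rmorphism rat -> rat}) i.
pose C := undup (flatten [seq [seq p h | h <- msupp (w j)] | j <- enum J]).
have uC : uniq C by apply: undup_uniq.
have wC j h : h \in msupp (w j) -> p h \in C.
  move=> hw; rewrite mem_undup; apply/flattenP.
  exists [seq p h | h <- msupp (w j)]; last exact: map_f.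
  by apply/mapP; exists j; rewrite ?mem_enum.
have augR k a : augmentation (R k a) = (P a)@_k.
  have D1 : {morph (fun a => augmentation (R k a)) : u v / u + v}.
    by move=> u v; rewrite RD rmorphD.
  have D2 : {morph (fun a => (P a)@_k) : u v / u + v}.
    by move=> u v; rewrite rmorphD mcoeffD.
  apply: (malg_ext D1 D2) => q h; rewrite RU PE mcoeffU /=.
  by case: eqP => _; rewrite ?augmentationU ?rmorph0.
have augP a : augmentation (P a) = augmentation a.
  have D1 : {morph (fun a => augmentation (P a)) : u v / u + v}.
    by move=> u v; rewrite !rmorphD.
  apply: (malg_ext D1 (@rmorphD _ _ (@augmentation rat H))) => q h.
  by rewrite PE /= !augmentationU.
pose J' := (J * 'I_(size C))%type.
pose T' (ik : I * G) (jc : J') : gring rat N :=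
  R ik.2 (T ik.1 jc.1 * (<< 1 *g s (C`_jc.2)%g >> : gring rat H)).
pose w' (jc : J') := R (C`_jc.2)%g (w jc.1).
have sumC (V : zmodType) (F : G -> V) :
    \sum_(c < size C) F (C`_c)%g = \sum_(c <- C) F c.
  by rewrite (big_nth 1%g) big_mkord.
have pairE (V : zmodType) (F : J' -> V) :
    \sum_jc F jc = \sum_j \sum_c F (j, c).
  by rewrite pair_bigA; apply: eq_bigr => -[].
have w'0 : forall jc, w' jc = 0.
  apply: (sN _ _ T') => [u Tu [j c]|[i0 k]].
    pose U (j : J) : gring rat G := \sum_(c < size C) << u (j, c) *g (C`_c)%g >>.
    suff : U j = 0.
      move/(congr1 (mcoeff (C`_c)%g)); rewrite mcoeff0 raddf_sum (bigD1 c) //=.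
      rewrite mcoeffUU big1 ?addr0 // => c' cc'.
      by rewrite mcoeffU nth_uniq // (inj_eq val_inj) (negPf cc').
    move: j {c}; apply: (sG I J (fun i0 j => P (T i0 j))) => [v Tv|i0].
      by apply: Tinj => i0; rewrite -[RHS](Tv i0); apply: eq_bigr => j _; rewrite augP.
    apply/malgP => k; rewrite mcoeff0 -[RHS](Tu (i0, k)).
    rewrite (raddf_sum (mcoeff k)) pairE.
    apply: eq_bigr => j _; rewrite mulr_sumr raddf_sum; apply: eq_bigr => c _ /=.
    by rewrite coef_mulU augR rmorphM PE /= ext_ps.
  rewrite pairE -[RHS](R0 k) -(Tw i0) (big_morph _ (RD k) (R0 k)).
  apply: eq_bigr => j _; rewrite (R_mul _ _ uC (wC j)).
  exact: (sumC _ (fun c => R k (T i0 j * (<< 1 *g s c >> : gring rat H)) * R c (w j))).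
move=> j; have -> : w j = \sum_(c <- C) (<< 1 *g s c >> : gring rat H) * Q (R c (w j)).
  apply: (malg_ext_supp (f := id)
    (g := fun b => \sum_(c <- C) (<< 1 *g s c >> : gring rat H) * Q (R c b))) => //.
    by move=> u v; rewrite -big_split; apply: eq_bigr => c _; rewrite RD rmorphD mulrDr.
  move=> h hw; rewrite (bigD1_seq (p h)) ?(wC j) //= RU eqxx big1_seq ?addr0.
    by rewrite QE gringUU mul1r -ext_dec.
  by move=> c /andP[/negPf ch _]; rewrite RU eq_sym ch rmorph0 mulr0.
rewrite big1_seq // => c /andP[_ cC].
have cs : (index c C < size C)%N by rewrite index_mem.
have := w'0 (j, Ordinal cs); rewrite /w' /= nth_index // => ->.
by rewrite rmorph0 mulr0.
Qed.

Lemma good_extension : good N -> good G -> good H.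
Proof.
case=> uN fN sN [uG fG sG]; split.
- exact: unique_products_extension.
- exact: folner_extension.
- exact: strebel_extension.
Qed.

End GoodExtension.

Lemma exp_gt_poly (n r : nat) :
  exists k, (n ^ k * k.+1 ^ r < n.+1 ^ k)%N.
Proof.
case: n => [|n].
  exists 1%N; rewrite exp0n ?mul0n ?expn1 ?expn_gt0 //.
(* The first two terms of the binomial expansion. For [k = n.+1] they give the ratio 2 that is
   iterated in [two]. *)
have bern k : (n.+1 ^ k + k * n.+1 ^ k.-1 <= n.+2 ^ k)%N.
  elim: k => [|k IH]; first by rewrite !expn0.
  case: k IH => [|k] /= IH; first by rewrite !expn1 expn0; lia.
  have := leq_mul (leqnn n.+2) IH; rewrite !expnS.
  by move: (n.+1 ^ k)%N (n.+2 ^ k)%N => A B; nia.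
have two j : (2 ^ j * n.+1 ^ (n.+1 * j) <= n.+2 ^ (n.+1 * j))%N.
  rewrite !expnM -expnMn; case: j => [|j]; first by rewrite !expn0.
  by rewrite leq_exp2r //; have := bern n.+1; rewrite /= -expnS addnn -mul2n.
have sq a : (a.+1 ^ 2 <= 2 ^ a.*2)%N.
  by rewrite -muln2 expnM leq_exp2r // ltn_expl.
(* Then [r * (n + 2 + 2 a) < (a + 1)^2 <= 2^(2 a) = j], whereas for the exponent [k = (n + 1) j] one
   has [k + 1 <= 2^(n + 2 + 2 a)]; hence [2^j] exceeds [(k + 1)^r]. *)
pose a := (2 * r + n)%N; pose j := (2 ^ a.*2)%N.
exists (n.+1 * j)%N; apply: leq_trans (two j).
rewrite mulnC ltn_pmul2r ?expn_gt0 //.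
apply: (@leq_ltn_trans ((2 ^ (n.+2 + a.*2)) ^ r)%N).
  have [->//|r0] := posnP r; rewrite leq_exp2r //.
  rewrite expnD; apply: (@leq_trans (n.+2 * j)%N).
    by rewrite [(n.+2 * _)%N]mulSn -add1n leq_add2r expn_gt0.
  by rewrite leq_mul2r ltnW ?orbT // ltn_expl.
rewrite -expnM ltn_exp2l //; apply: leq_trans (sq a).
rewrite /a; nia.
Qed.

(** * Abelian groups separated by rational forms *)

Section GoodCommutative.
Variable M : groupType.
Hypothesis MC : forall x y : M, commute x y.

Fixpoint monomials (X : seq M) (k : nat) : seq M :=
  if X is x :: X' then
    [seq (x ^+ i * f)%g | i <- index_iota 0 k.+1, f <- monomials X' k]
  else [:: 1%g].

Lemma size_monomials X k : size (monomials X k) = (k.+1 ^ size X)%N.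
Proof.
elim: X => // x X IH.
by rewrite [LHS](size_allpairs _ (index_iota 0 k.+1)) size_iota subn0 IH expnS.
Qed.

Lemma monomials_consP x X k f : f \in monomials (x :: X) k <->
  exists i g, [/\ (i <= k)%N, g \in monomials X k & f = (x ^+ i * g)%g].
Proof.
split=> [/allpairsP[[i g] /= []]|[i [g [ik gX ->]]]].
  by rewrite mem_index_iota => ik gX ->; exists i, g.
by apply/allpairsP; exists (i, g); rewrite mem_index_iota.
Qed.

Lemma monomials1 X k : 1%g \in monomials X k.
Proof.
elim: X => [|x X IH]; first by rewrite inE.
by apply/monomials_consP; exists 0%N, 1%g; rewrite mulg1.
Qed.

Lemma monomialsS X k f : f \in monomials X k -> f \in monomials X k.+1.
Proof.
elim: X f => // x X IH f /monomials_consP[i [g [ik gX ->]]].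
by apply/monomials_consP; exists i, g; rewrite IH // leqW.
Qed.

Lemma mul_monomials X k x f : x \in X -> f \in monomials X k ->
  (x * f)%g \in monomials X k.+1.
Proof.
elim: X f => // y X IH f; rewrite inE => xX /monomials_consP[i [g [ik gX ->]]].
apply/monomials_consP; case/predU1P: xX => [->|xX].
  by exists i.+1, g; rewrite mulgA -expgS monomialsS.
by exists i, (x * g)%g; rewrite IH // leqW // !mulgA (MC x).
Qed.

(** If no set of monomials were a Folner set, each increase of [k] would multiply their number by at
    least [(n + 1) / n], against its polynomial bound [(k + 1)^(size X)]. *)
Lemma folner_commutative : folner M.
Proof.
move=> X n; apply: contrapT => noF.
pose E k := undup (monomials X k).
have grow k : ((n.+1) * size (E k) <= n * size (E k.+1))%N.
  have [x [xX nx]] : exists x, x \in X /\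
      (size (E k) < n * count (fun f => (x * f)%g \notin E k) (E k))%N.
    apply: contrapT => nox; apply: noF; exists (E k); split.
    - exact: undup_uniq.
    - by case E0 : (E k) (monomials1 X k) => //; rewrite -mem_undup -/(E k) E0.
    - by move=> x xX; rewrite leqNgt; apply/negP => lt; apply: nox; exists x.
  set c := count _ _ in nx.
  suff : (size (E k) + c <= size (E k.+1))%N by nia.
  pose C := E k ++ [seq (x * f)%g | f <- E k & (x * f)%g \notin E k].
  have <- : size C = (size (E k) + c)%N by rewrite size_cat size_map size_filter.
  apply: uniq_leq_size.
    rewrite cat_uniq undup_uniq map_inj_uniq ?filter_uniq ?undup_uniq ?andbT //.
      apply/hasPn => _ /mapP[f + ->]; by rewrite mem_filter => /andP[].
    exact: mulgI.
  move=> f; rewrite mem_cat /E !mem_undup => /orP[/monomialsS //|/mapP[g + ->]].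
  by rewrite mem_filter => /andP[_]; rewrite mem_undup; apply: mul_monomials.
have lower k : (n.+1 ^ k <= n ^ k * size (E k))%N.
  elim: k => [|k IH].
    rewrite !expn0 mul1n; have := monomials1 X 0; rewrite -mem_undup -/(E 0).
    by case: (E 0).
  rewrite !expnS; have := grow k.
  by move: (size (E k)) (size (E k.+1)) (n ^ k)%N (n.+1 ^ k)%N IH => u v A B; nia.
have [k] := exp_gt_poly n (size X); rewrite ltnNge => /negP; apply.
apply: leq_trans (lower k) _; rewrite leq_mul2l; apply/orP; right.
by rewrite -size_monomials size_undup.
Qed.

Definition additive_form (l : M -> rat) := forall x y, l (x * y)%g = l x + l y.

Hypothesis separated :
  forall x : M, x <> 1%g -> exists l, additive_form l /\ l x <> 0.

Lemma form1 l : additive_form l -> l 1%g = 0.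
Proof. by move=> lD; apply: (addrI (l 1%g)); rewrite -lD mulg1 addr0. Qed.

Lemma formV l x : additive_form l -> l x^-1%g = - l x.
Proof. by move=> lD; apply/eqP; rewrite -addr_eq0 -lD mulVg form1. Qed.

Lemma separated_pair (x y : M) : x != y -> exists l, additive_form l /\ l x <> l y.
Proof.
move=> /eqP xy; have [|l [lD lxy]] := @separated (x * y^-1)%g.
  by move=> xy1; apply: xy; apply: divg1_eq.
exists l; split=> // lx; apply: lxy.
by rewrite lD formV // lx subrr.
Qed.

Lemma seq_max (l : M -> rat) (A : seq M) : A != [::] ->
  exists2 a, a \in A & forall a', a' \in A -> l a' <= l a.
Proof.
elim: A => [//|a [|b A] IH] _.
  by exists a; rewrite ?inE // => a'; rewrite inE => /eqP ->.
have [//|c cA cm] := IH; have [le|lt] := leP (l a) (l c).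
  exists c; first by rewrite inE cA orbT.
  by move=> a'; rewrite inE => /predU1P[->//|]; apply: cm.
exists a; first exact: mem_head.
move=> a'; rewrite inE => /predU1P[->//|/cm le].
exact: le_trans le (ltW lt).
Qed.

(** A form that is not constant on both lists cuts them down to the elements where it is maximal,
    and a product of maximal value comes only from these. If all forms are constant on both lists,
    separation leaves a single element in each. *)
Lemma unique_products_commutative : unique_products M.
Proof.
move=> A B; have [N] := ubnP (size A + size B)%N.
elim: N A B => [//|N IH] A B AN A0 B0.
have [[l [lD lAB]]|same] := pselect (exists l, additive_form l /\
    ((exists a a', [/\ a \in A, a' \in A & l a <> l a']) \/
     (exists b b', [/\ b \in B, b' \in B & l b <> l b']))).
  have [a aA am] := seq_max l A0; have [b bB bm] := seq_max l B0.
  pose A' := [seq x <- A | l x == l a]; pose B' := [seq x <- B | l x == l b].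
  have aA' : a \in A' by rewrite mem_filter eqxx.
  have bB' : b \in B' by rewrite mem_filter eqxx.
  have sA : (size A' <= size A)%N by rewrite size_filter count_size.
  have sB : (size B' <= size B)%N by rewrite size_filter count_size.
  have strict (C : seq M) (c x y : M) : x \in C -> y \in C -> l x <> l y ->
      (size [seq z <- C | l z == l c] < size C)%N.
    move=> xC yC lxy; rewrite size_filter ltn_neqAle count_size andbT.
    rewrite -all_count; apply/allP => Cc.
    by apply: lxy; rewrite (eqP (Cc x xC)) (eqP (Cc y yC)).
  have sAB : (size A' + size B' < size A + size B)%N.
    case: lAB => -[x [y [xC yC lxy]]]; have := strict _ _ x y xC yC lxy.
      by move=> /(_ a) lt; rewrite -addSn leq_add.
    by move=> /(_ b) lt; rewrite -addnS leq_add.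
  have [|||a0 [b0 [a0A b0B u]]] := IH A' B'.
  - by apply: leq_trans sAB _; rewrite -ltnS.
  - by apply/eqP => A'0; rewrite A'0 in aA'.
  - by apply/eqP => B'0; rewrite B'0 in bB'.
  move: (a0A) (b0B); rewrite !mem_filter => /andP[/eqP la0 a0A'] /andP[/eqP lb0 b0B'].
  exists a0, b0; split=> // a' b' a'A b'B ab; apply: u => //.
    rewrite mem_filter a'A andbT; apply/eqP.
    have := congr1 l ab; rewrite !lD la0 lb0; have := am _ a'A; have := bm _ b'B; lra.
  rewrite mem_filter b'B andbT; apply/eqP.
  have := congr1 l ab; rewrite !lD la0 lb0; have := am _ a'A; have := bm _ b'B; lra.
have [a aA] : exists a, a \in A by case: A A0 {AN same} => // a A _; exists a; apply: mem_head.
have [b bB] : exists b, b \in B by case: B B0 {AN same} => // b B _; exists b; apply: mem_head.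
exists a, b; split=> // a' b' a'A b'B _; split; apply: contrapT => /eqP ne;
  have [l [lD lne]] := separated_pair ne; apply: same; exists l; split=> //.
  by left; exists a', a.
by right; exists b', b.
Qed.

Definition affine_form (f : M -> rat) :=
  exists l c, additive_form l /\ f =1 (fun x => l x + c).

(** The pairing of [w] with a polynomial function on [M], given as a product of forms. *)
Definition moment (fs : seq (M -> rat)) (w : gring rat M) : rat :=
  mlift (fun x q => q * \prod_(f <- fs) f x) w.

Let momB (fs : seq (M -> rat)) (x : M) : {morph (fun q : rat => q * \prod_(f <- fs) f x) : p q / p - q}.
Proof. by move=> p q; rewrite mulrBl. Qed.
Let momU fs q x : moment fs << q *g x >> = q * \prod_(f <- fs) f x.
Proof. exact: (mliftU (@momB fs)). Qed.
Let momD fs : {morph moment fs : a b / a + b}.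
Proof. exact: (mliftD (@momB fs)). Qed.
Let mom0 fs : moment fs 0 = 0.
Proof. exact: mlift0. Qed.

Definition all_affine (fs : seq (M -> rat)) :=
  forall i, (i < size fs)%N -> affine_form (nth (fun _ => 0) fs i).

Lemma all_affine_cons f fs :
  all_affine (f :: fs) <-> affine_form f /\ all_affine fs.
Proof.
split=> [af|[af afs] [|i] //=]; last exact: afs.
by split=> [|i ifs]; [apply: (af 0%N) | apply: (af i.+1)].
Qed.

Let shift (x : M) (f : M -> rat) : M -> rat := fun y => f (x * y)%g.

Let affine_shift x f : affine_form f -> affine_form (shift x f).
Proof.
move=> [l [c [lD fE]]]; exists l, (l x + c); split=> // y.
by rewrite /shift fE lD; ring.
Qed.

(* Translating the forms changes a moment only by moments of lower degree. *)
Lemma moment_shift (w : gring rat M) x fs1 fs2 :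
    (forall fs, (size fs < size fs1 + size fs2)%N -> all_affine fs ->
       moment fs w = 0) ->
    all_affine fs1 -> all_affine fs2 ->
  moment (map (shift x) fs1 ++ fs2) w = moment (fs1 ++ fs2) w.
Proof.
elim: fs1 fs2 => [//|f fs1 IH] fs2 lower /all_affine_cons[af afs1] afs2 /=.
have afs : all_affine (f :: fs2) by apply/all_affine_cons.
have lower' fs : (size fs < size fs1 + size (f :: fs2))%N -> all_affine fs ->
    moment fs w = 0 by rewrite /= addnS => ?; apply: lower.
transitivity (moment (map (shift x) fs1 ++ f :: fs2) w); last first.
  rewrite IH //; congr mlift; apply: funext => y; apply: funext => q.
  by congr (q * _); apply: perm_big; rewrite perm_catC /= perm_cons perm_catC.
have [l [c [lD fE]]] := af.
have cat_affine g1 g2 : all_affine g1 -> all_affine g2 -> all_affine (g1 ++ g2).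
  elim: g1 => [//|g g1 IHg] /all_affine_cons[ag ag1] ag2.
  by apply/all_affine_cons; split=> //; apply: IHg.
have map_affine g1 : all_affine g1 -> all_affine (map (shift x) g1).
  elim: g1 => [//|g g1 IHg] /all_affine_cons[ag ag1].
  by apply/all_affine_cons; split; [apply: affine_shift | apply: IHg].
have low : moment (map (shift x) fs1 ++ fs2) w = 0.
  apply: lower; first by rewrite size_cat size_map.
  by apply: cat_affine => //; apply: map_affine.
rewrite -[RHS]addr0 -[0](mulr0 (l x)) -low.
elim/gring_ind: {lower lower' low IH} w => [|a b IHa IHb|q y].
- by rewrite !mom0 mulr0 addr0.
- by rewrite !momD IHa IHb; ring.
rewrite !momU big_cons !big_cat big_cons /= /shift !fE lD; ring.
Qed.

(** By induction on the degree, all moments of the [w j] vanish: moments are translation invariant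
    once those of lower degree vanish, and this turns [T w = 0] into the augmented system. Moments
    determine an element of finite support. *)
Lemma strebel_commutative : strebel M.
Proof.
move=> I J T Tinj w Tw.
have vanish : forall fs, all_affine fs -> forall j, moment fs (w j) = 0.
  move=> fs; have [N] := ubnP (size fs).
  elim: N fs => [//|N IH] fs; rewrite ltnS => fsN afs; apply: Tinj => i.
  rewrite -[RHS](mom0 fs) -(Tw i) (big_morph _ (momD fs) (mom0 fs)).
  apply: eq_bigr => j _; elim/gring_ind: (T i j) => [|a b IHa IHb|q x].
  - by rewrite mul0r mom0 rmorph0 mul0r.
  - have -> : (a + b) * w j = a * w j + b * w j by exact: mulrDl.
    by rewrite momD -IHa -IHb rmorphD mulrDl.
  rewrite augmentationU -[fs]cats0 -(@moment_shift _ x) //; last first.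
    by move=> fs'; rewrite addn0 => lt afs'; apply: IH afs' j; apply: leq_trans lt fsN.
  rewrite !cats0; elim/gring_ind: (w j) => [|a b IHa IHb|p y].
  - by rewrite !mom0 mulr0 mulr0 mom0.
  - pose u : gring rat M := << q *g x >>; rewrite -/u.
    have -> : u * (a + b) = u * a + u * b by exact: mulrDr.
    by rewrite !momD -IHa -IHb mulrDr.
  by rewrite gringUU !momU big_map mulrA.
move=> j; apply/malgP => x; rewrite mcoeff0.
have [xw|] := boolP (x \in msupp (w j)); last by move/mcoeff_outdom.
have /choice[l lE] (y : M) : exists l, additive_form l /\ (y != x -> l y <> l x).
  have [->|yx] := eqVneq y x; last first.
    by have [l [lD ly]] := separated_pair yx; exists l.
  by exists (fun _ => 0); split=> [? ?|]; rewrite ?addr0.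
(* The product of these forms vanishes at every point of the support except [x], so this moment
   isolates the coefficient at [x]. *)
pose fs := [seq (fun z => l y z - l y y) | y <- msupp (w j) & y != x].
have afs : all_affine fs.
  move=> i; rewrite size_map => ifs; rewrite (nth_map 1%g) //.
  by set y := nth _ _ i; exists (l y), (- l y y); have [] := lE y.
have := vanish fs afs j; rewrite /moment /mlift (bigD1_seq x) ?fset_uniq //=.
rewrite [X in _ + X]big1_seq ?addr0; last first.
  move=> y /andP[yx yw]; rewrite big_map (bigD1_seq y) ?mem_filter ?yx //=.
    by rewrite subrr mul0r mulr0.
  by rewrite filter_uniq ?fset_uniq.
move=> /eqP; rewrite mulf_eq0 => /orP[/eqP //|].
rewrite big_map prodf_seq_eq0 => /hasP[y].
rewrite mem_filter => /andP[yx _] /= /eqP/subr0_eq lxy.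
by have [_ /(_ yx)] := lE y; rewrite lxy.
Qed.

Lemma good_commutative : good M.
Proof.
split; [exact: unique_products_commutative | exact: folner_commutative |].
exact: strebel_commutative.
Qed.

End GoodCommutative.

(** * Group rings of good groups *)

Lemma linear_dependence (K E : finType) (c : K -> E -> rat) :
    (#|E| < #|K|)%N ->
  exists u : K -> rat, (exists k, u k != 0) /\
    forall e, \sum_k u k * c k e = 0.
Proof.
move=> EK; pose C : 'M[rat]_(#|K|, #|E|) :=
  \matrix_(i, j) c (enum_val i) (enum_val j).
have kC : kermx C != 0.
  rewrite kermx_eq0 /row_free neq_ltn (leq_ltn_trans (rank_leq_col _)) //.
move: (kermx C) kC (mulmx_ker C) => U U0 UC.
have [i [j ij]] : exists i j, U i j != 0.
  apply: contrapT => no; move/eqP: U0; apply; apply/matrixP => i j; rewrite [RHS]mxE.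
  by apply/eqP; apply: contrapT => /negP ij; apply: no; exists i, j.
exists (fun k => U i (enum_rank k)); split.
  by exists (enum_val j); rewrite enum_valK.
move=> e; have /matrixP/(_ i (enum_rank e)) := UC.
rewrite !mxE => UCe; rewrite -[RHS]UCe (reindex (@enum_val K predT)) /=.
  by apply: eq_bigr => l _; rewrite enum_valK !mxE enum_rankK.
by exists enum_rank => l _; rewrite ?enum_rankK ?enum_valK.
Qed.

Lemma coef_gring_mul (R : pzRingType) (G : groupType) (a b : gring R G) k :
  (a * b)@_k =
    \sum_(x <- msupp a) \sum_(y <- msupp b) (a@_x * b@_y) *+ (x * y == k)%g.
Proof.
rewrite -[a * b]/(gring_mul a b) /gring_mul raddf_sum.
apply: eq_bigr => x _; rewrite raddf_sum; apply: eq_bigr => y _.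
exact: mcoeffU.
Qed.

Section GoodOre.
Variables (G : groupType) (gG : good G).

(** At a uniquely represented product of the two supports, the coefficient of [a * b] is a product
    of two non-zero rationals. *)
Lemma good_domain (a b : gring rat G) : a * b = 0 -> a = 0 \/ b = 0.
Proof.
move=> ab; have [a0|a0] := eqVneq a 0; first by left.
have [b0|b0] := eqVneq b 0; first by right.
exfalso; have nz (c : gring rat G) : c != 0 -> enum_fset (msupp c) != [::].
  apply: contra => /eqP c0; apply/eqP/malgP => x; rewrite mcoeff0.
  by apply: mcoeff_outdom; rewrite -[_ \in _]/(x \in enum_fset _) c0.
have [x [y [xa yb xy]]] := good_up gG (nz _ a0) (nz _ b0).
have := coef_gring_mul a b (x * y)%g; rewrite ab mcoeff0.
rewrite (bigD1_seq x) ?fset_uniq //= (bigD1_seq y) ?fset_uniq //= eqxx mulr1n.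
rewrite [X in _ + X + _]big1_seq => [|y' /andP[/eqP yy' y'b]]; last first.
  by case: eqP => // /(xy _ _ xa y'b) [_ /yy'].
rewrite [X in _ + X]big1_seq ?addr0 => [|x' /andP[/eqP xx' x'a]]; last first.
  rewrite big1_seq // => y' /andP[_ y'b].
  by case: eqP => // /(xy _ _ x'a y'b) [/xx'].
move/esym/eqP; rewrite mulf_eq0 !mcoeff_eq0.
by rewrite -[x \in _]/(x \in enum_fset _) xa -[y \in _]/(y \in enum_fset _) yb.
Qed.

Lemma good_mulI (a b c : gring rat G) : a != 0 -> a * b = a * c -> b = c.
Proof.
move=> a0 abc; apply/subr0_eq.
have ab0 : a * (b - c) = 0 by rewrite mulrBr abc subrr.
by have [/eqP|//] := good_domain ab0; rewrite (negPf a0).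
Qed.

(* Counting dimensions over a Folner set *)
Lemma good_ore (k : nat) (T : 'I_k -> 'I_k -> gring rat G) (a : 'I_k -> gring rat G) :
    (forall w, (forall i, \sum_j T i j * w j = 0) -> forall j, w j = 0) ->
  exists (b : 'I_k -> gring rat G) (t : gring rat G),
    t != 0 /\ forall i, \sum_j T i j * b j = a i * t.
Proof.
move=> Tinj.
pose X : seq G := flatten
  [seq enum_fset (msupp (T p.1 p.2)) | p <- enum (('I_k * 'I_k)%type : finType)]
  ++ flatten [seq enum_fset (msupp (a i)) | i <- enum 'I_k].
have XT i j x : x \in msupp (T i j) -> x \in X.
  move=> xT; rewrite mem_cat; apply/orP; left; apply/flattenP.
  exists (enum_fset (msupp (T i j))) => //.
  by apply/mapP; exists (i, j); rewrite ?mem_enum.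
have Xa i x : x \in msupp (a i) -> x \in X.
  move=> xa; rewrite mem_cat; apply/orP; right; apply/flattenP.
  exists (enum_fset (msupp (a i))) => //.
  by apply/mapP; exists i; rewrite ?mem_enum.
have [F [uF F0 XF]] := good_folner gG X (k * size X).+1.
pose E := undup (F ++
  flatten [seq [seq (x * f)%g | f <- F & (x * f)%g \notin F] | x <- X]).
have memE x f : x \in X -> f \in F -> (x * f)%g \in E.
  move=> xX fF; rewrite mem_undup mem_cat; case: (boolP (_ \in F)) => //= xfF.
  apply/flattenP; exists [seq (x * f)%g | f <- F & (x * f)%g \notin F].
    exact: (map_f (fun x => [seq (x * f)%g | f <- F & (x * f)%g \notin F])).
  by rewrite map_f // mem_filter xfF.
(* The unknowns are the coefficients on [F] of the [b j] ([inl]) and of [t] ([inr]); the equations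
   are the coefficients on [E] of [T b - a t]. *)
pose K := (('I_k + 'I_1) * 'I_(size F))%type.
pose Eq := ('I_k * 'I_(size E))%type.
pose row (o : 'I_k + 'I_1) i := if o is inl j then T i j else - a i.
have rowX o i x : x \in msupp (row o i) -> x \in X.
  case: o => [j|_] /=; first exact: XT.
  by rewrite msuppN; apply: Xa.
have sizes : (#|{: Eq}| < #|{: K}|)%N.
  rewrite !card_prod card_sum !card_ord.
  have sE : (size E <= size F + \sum_(x <- X) count (fun f => (x * f)%g \notin F) F)%N.
    apply: leq_trans (size_undup _) _; rewrite size_cat leq_add2l.
    elim: (X) => [|x X' IH]; first by rewrite big_nil.
    by rewrite big_cons /= size_cat size_map size_filter leq_add2l.
  have sX : (((k * size X).+1) * \sum_(x <- X) count (fun f => (x * f)%g \notin F) F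
      <= size X * size F)%N.
    rewrite big_distrr /= -[size X in leqRHS]sum1_size big_distrl /= !big_seq.
    by apply: leq_sum => x xX; rewrite mul1n; apply: XF.
  move: (size F) (size E) (size X) (\sum_(x <- X) _)%N F0 sE sX => f e x s f0 sE sX.
  have : (k * e <= k * f + k * s)%N by rewrite -mulnDr leq_mul2l sE orbT.
  have : (k * s < f)%N.
    rewrite -(@ltn_pmul2l (k * x).+1) // mulnCA.
    apply: (@leq_ltn_trans (k * (x * f))%N); first by rewrite leq_mul2l sX orbT.
    by rewrite mulnA mulSn -[ltnLHS]add0n ltn_add2r.
  lia.
pose c (p : K) (q : Eq) : rat :=
  (row p.1 q.1 * (<< 1 *g F`_p.2 >>%g : gring rat G))@_(E`_q.2)%g.
have [u [[p up] uc]] := linear_dependence c sizes.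
pose v o : gring rat G := \sum_(f < size F) << u (o, f) *g F`_f >>%g.
have v_eq0 o : v o = 0 -> forall f, u (o, f) = 0.
  move=> vo f; have := congr1 (mcoeff (F`_f)%g) vo.
  rewrite mcoeff0 raddf_sum (bigD1 f) //= mcoeffUU big1 ?addr0 // => f' ff'.
  by rewrite mcoeffU nth_uniq // (inj_eq val_inj) (negPf ff').
have sys i : \sum_j T i j * v (inl j) - a i * v (inr ord0) = 0.
  have -> : \sum_j T i j * v (inl j) - a i * v (inr ord0) = \sum_o row o i * v o.
    by rewrite big_sumType big_ord1 /= mulNr.
  apply/malgP => x; rewrite mcoeff0.
  have coef o : (row o i * v o)@_x = \sum_(f < size F)
      (row o i * (<< 1 *g F`_f >>%g : gring rat G))@_x * u (o, f).
    by rewrite mulr_sumr raddf_sum; apply: eq_bigr => f _; exact: coef_mulU.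
  rewrite raddf_sum (eq_bigr _ (fun o _ => coef o)).
  rewrite pair_bigA /=.
  have [xE|xE] := boolP (x \in E); last first.
    rewrite big1 // => -[o f] _ /=; rewrite coef_gring_mul big1_seq ?mul0r //.
    move=> y /andP[_ yr]; rewrite big1_seq // => z /andP[_ zf].
    have {}zf : z = (F`_f)%g.
      by have := fsubsetP msuppU_le z zf; rewrite in_fset1 => /eqP.
    case: eqP => // yz; move/negP: xE; case; rewrite -yz zf.
    by apply: memE; [apply: rowX yr | rewrite mem_nth].
  have xs : (index x E < size E)%N by rewrite index_mem.
  rewrite -[RHS](uc (i, Ordinal xs)); apply: eq_bigr => -[o f] _.
  by rewrite /c /= nth_index // mulrC.
exists (fun j => v (inl j)), (v (inr ord0)); split; last first.
  by move=> i; apply/subr0_eq/sys.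
(* If [t = 0], injectivity of [T] makes the [b j] vanish too, and the solution found would be
   trivial. *)
apply/eqP => v0; have vS : forall j, v (inl j) = 0.
  by apply: Tinj => i; have := sys i; rewrite v0 mulr0 subr0.
move/eqP: up; apply; case: p => -[j|o] f; first exact: (v_eq0 _ (vS j)).
by rewrite (ord1 o); apply: v_eq0 v0 f.
Qed.

End GoodOre.

(** * Linear forms over division rings *)

Section LinearForm.
Variables (K : pzRingType) (V : lmodType K).
Hypothesis divK : forall c : K, c != 0 -> exists e, e * c = 1.

Lemma lsubmod_eq (P Q : lsubmod V) : P = Q :> (V -> Prop) -> P = Q.
Proof.
case: P Q => [P P0 PB PZ] [Q Q0 QB QZ] /= E.
by case: _ / E in Q0 QB QZ *; congr LSubmod; apply: Prop_irrelevance.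
Qed.

(* A subspace that is maximal among those containing [P] and avoiding [v] is a
   complement of the line through [v]. *)
Lemma linear_form (P : lsubmod V) v : ~ P v -> exists l : V -> K,
  [/\ forall x y, l (x + y) = l x + l y, forall c x, l (c *: x) = c * l x,
      forall x, P x -> l x = 0 & l v = 1].
Proof.
move=> Pv.
pose T := {Q : lsubmod V | (forall x, P x -> Q x) /\ ~ Q v}.
pose R (Q Q' : T) := `[< forall x, projT1 Q x -> projT1 Q' x >].
have [||||[M [PM Mv]] Mmax] := @classical_sets.Zorn T R.
- by move=> Q; apply/asboolP.
- by move=> Q1 Q2 Q3 /asboolP R12 /asboolP R23; apply/asboolP => x /R12/R23.
- move=> Q1 Q2 /asboolP R12 /asboolP R21.
  apply: eq_sig_hprop => [Q p q|]; first exact: Prop_irrelevance.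
  apply: lsubmod_eq; apply: funext => x; apply: propext.
  by split; [apply: R12 | apply: R21].
- move=> A Atot.
  have [[Q0 AQ0]|noA] := pselect (exists Q, A Q); last first.
    have PP : (forall x, P x -> P x) /\ ~ P v by split.
    by exists (exist _ P PP) => Q AQ; case: noA; exists Q.
  pose U x := exists2 Q : T, A Q & projT1 Q x.
  have U2 x y : U x -> U y -> exists2 Q : T, A Q & projT1 Q x /\ projT1 Q y.
    move=> [Q1 A1 Q1x] [Q2 A2 Q2y].
    by case: (Atot Q1 Q2 A1 A2) => /asboolP R12; [exists Q2 | exists Q1] => //;
      split=> //; apply: R12.
  have U0 : U 0 by exists Q0 => //; apply: lsub0.
  have UB x y : U x -> U y -> U (x - y).
    by move=> Ux Uy; have [Q AQ [Qx Qy]] := U2 x y Ux Uy; exists Q => //; apply: lsubB.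
  have UZ c x : U x -> U (c *: x).
    by move=> [Q AQ Qx]; exists Q => //; apply: lsubZ.
  have UP : (forall x, P x -> LSubmod U0 UB UZ x) /\ ~ LSubmod U0 UB UZ v.
    split=> [x Px|[Q _ Qv]]; first by exists Q0 => //; apply: (projT2 Q0).1.
    exact: (projT2 Q).2.
  by exists (exist _ (LSubmod U0 UB UZ) UP) => Q AQ; apply/asboolP => x Qx; exists Q.
have span x : exists c, M (x - c *: v).
  apply: contrapT => nox.
  (* The span of [M] and [x]. If it contains [v], the relation can be solved for [x]; otherwise
     maximality puts [x] in [M]. *)
  pose N y := exists c, M (y - c *: x).
  have N0 : N 0 by exists 0; rewrite scale0r subr0; apply: lsub0.
  have NB y z : N y -> N z -> N (y - z).
    move=> [c Mc] [e Me]; exists (c - e).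
    by have := lsubB Mc Me; congr (M _); rewrite scalerBl; zmod.
  have NZ c y : N y -> N (c *: y).
    move=> [e Me]; exists (c * e).
    by have := lsubZ c Me; rewrite scalerBr scalerA.
  have MN y : M y -> N y by exists 0; rewrite scale0r subr0.
  have Nx : N x by exists 1; rewrite scale1r subrr; apply: lsub0.
  have [Nv|Nv] := pselect (N v).
    have [c Mc] := Nv; have [c0|c0] := eqVneq c 0.
      by apply: (Mv); move: Mc; rewrite c0 scale0r subr0.
    have [e ec] := divK c0; apply: nox; exists e.
    by have := lsubN (lsubZ e Mc); rewrite scalerBr scalerA ec scale1r opprB.
  have PN : (forall y, P y -> LSubmod N0 NB NZ y) /\ ~ LSubmod N0 NB NZ v.
    by split=> [y /PM/MN|].
  have /(congr1 (fun Q : T => in_lsub (projT1 Q) x)) /= E :=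
    Mmax (exist _ (LSubmod N0 NB NZ) PN) (asboolT MN).
  by apply: nox; exists 0; rewrite scale0r subr0 -E.
have uniq_c x c e : M (x - c *: v) -> M (x - e *: v) -> c = e.
  move=> Mc Me; apply/eqP; apply: contrapT => /negP ce; apply: (Mv).
  have ec : e - c != 0 by rewrite subr_eq0 eq_sym.
  have [i ic] := divK ec.
  have := lsubZ i (lsubB Mc Me); congr (M _).
  rewrite -[RHS]scale1r -ic -scalerA scalerBl; congr (_ *: _); zmod.
have [l lE] := choice span; exists l; split.
- move=> x y; apply: (uniq_c (x + y)); first exact: lE.
  by have := lsubD (lE x) (lE y); congr (M _); rewrite scalerDl; zmod.
- move=> c x; apply: (uniq_c (c *: x)); first exact: lE.
  by have := lsubZ c (lE x); rewrite scalerBr scalerA.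
- move=> x Px; apply: (uniq_c x); first exact: lE.
  by rewrite scale0r subr0; apply: (PM).
- by apply: (uniq_c v); rewrite ?scale1r ?subrr; [apply: lE | apply: lsub0].
Qed.

End LinearForm.

Definition mulcopy (V : zmodType) : Type := V.

Section MulCopy.
Variable V : zmodType.
HB.instance Definition _ := Choice.copy (mulcopy V) V.
HB.instance Definition _ := isGroup.Build (mulcopy V)
  (@addrA V) (@add0r V) (@addr0 V) (@addNr V) (@addrN V).
End MulCopy.

Lemma good_sdprod (B : groupType) (S : pzRingType) (r : monoid_act B S)
    (D : lmodType S) :
    (forall v : D, v <> 0 -> exists l : D -> rat,
       (forall x y, l (x + y) = l x + l y) /\ l v <> 0) ->
  good B -> good (sdprod r D).
Proof.
move=> sepD gB.
have [p pE] : exists p : {multiplicative sdprod r D -> B}, p =1 snd.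
  by apply: mult_ex.
have [i iE] : exists i : {multiplicative mulcopy D -> sdprod r D},
    i =1 (fun v => (v, 1%g)).
  by apply: mult_ex => x y; rewrite sd_mulE /= mact1 scale1r mulg1.
pose s (b : B) : sdprod r D := (0, b).
(* The section stands on the left, so that [(v, b) = (0, b) (b^-1 v, 1)]. *)
pose ra (u : sdprod r D) : mulcopy D := r u.2^-1%g *: u.1.
have i_inj : injective i by move=> x y; rewrite !iE => -[].
have pi n : p (i n) = 1%g by rewrite pE iE.
have ps g : p (s g) = g by rewrite pE.
have dec h : h = (s (p h) * i (ra h))%g.
  rewrite sd_mulE pE iE /= add0r mulg1 scalerA -mactM mulgV mact1 scale1r.
  by case: h.
apply: (good_extension (Extension i_inj pi ps dec)) gB.
apply: good_commutative => [x y|v v1]; first exact: addrC.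
by have [l [lD lv]] := sepD v v1; exists l.
Qed.

Lemma good_pair (G H : groupType) : good G -> good H -> good (G * H)%type.
Proof.
move=> gG gH.
have [p pE] : exists p : {multiplicative (G * H)%type -> G}, p =1 fst.
  by apply: mult_ex.
have [i iE] : exists i : {multiplicative H -> (G * H)%type}, i =1 (fun h => (1%g, h)).
  by apply: mult_ex => x y; congr pair; rewrite mulg1.
have i_inj : injective i by move=> x y; rewrite !iE => -[].
have pi n : p (i n) = 1%g by rewrite pE iE.
have ps g : p (g, 1%g) = g by rewrite pE.
have dec h : h = ((p h, 1) * i h.2)%g.
  by rewrite pE iE; case: h => x y; congr pair; rewrite /= ?mulg1 ?mul1g.
exact: (good_extension (Extension i_inj pi ps dec)) gH gG.
Qed.

Lemma good_trivial (G : groupType) : (forall x : G, x = 1%g) -> good G.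
Proof.
move=> G1; apply: good_commutative => [x y|x /(_ (G1 x))//].
by rewrite (G1 x) (G1 y).
Qed.

(** * Modules of fractions *)

Section Fractions.
Local Open Scope quotient_scope.
Variables (G : groupType) (gG : good G).
Local Notation A := (gring rat G).
Implicit Types a b s t u w e : A.

Lemma gring_rat_neq0 : (1 : A) != 0.
Proof.
apply/eqP => /(congr1 (fun a : A => a@_1%g)).
by rewrite mcoeff0 -[1]/(<< 1 *g 1%g >> : A) mcoeffUU => /eqP; rewrite oner_eq0.
Qed.

Lemma gring_mul_neq0 s u : s != 0 -> u != 0 -> s * u != 0.
Proof.
move=> s0 u0; apply/eqP => /(good_domain gG) [] /eqP; exact/negP.
Qed.

Lemma gring_ore s t : s != 0 -> t != 0 ->
  exists u w, [/\ u != 0, w != 0 & s * u = t * w].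
Proof.
move=> s0 t0.
have [|b [w [w0 bw]]] := @good_ore G gG 1 (fun _ _ => s) (fun _ => t).
  move=> v sv j; have := sv ord0; rewrite big_ord1 => /(good_domain gG) [/eqP|].
    by rewrite (negPf s0).
  by rewrite (ord1 j).
exists (b ord0), w; have := bw ord0; rewrite big_ord1 => sb; split=> //.
apply/eqP => b0; move: sb; rewrite b0 mulr0 => /esym/eqP.
by apply/negP; apply: gring_mul_neq0.
Qed.

Definition prefrac := {p : A * A | p.2 != 0}.

(** A pair [(a, s)] stands for [a s^-1], and two pairs are identified when they have a common
    expansion. The fractions are built as a left module over the group ring. *)
Definition frac_rel : rel prefrac := fun p q =>
  `[< exists u w, [/\ (val p).2 * u = (val q).2 * w, u != 0, w != 0 &
                      (val p).1 * u = (val q).1 * w] >].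

Fact frac_rel_equiv : equiv_class_of frac_rel.
Proof.
split=> [p|p q|q p r].
- by apply/asboolP; exists 1, 1; rewrite gring_rat_neq0.
- by apply/asboolP/asboolP => -[u [w [e1 u0 w0 e2]]]; exists w, u.
move=> /asboolP[u [w [e1 u0 w0 e2]]] /asboolP[u' [w' [e1' u0' w0' e2']]].
have [x [y [x0 y0 xy]]] := gring_ore w0 u0'.
apply/asboolP; exists (u * x), (w' * y).
split; [|exact: gring_mul_neq0|exact: gring_mul_neq0|].
  by rewrite mulrA e1 -mulrA xy !mulrA e1'.
by rewrite mulrA e2 -mulrA xy !mulrA e2'.
Qed.

Canonical frac_equiv := EquivRelPack frac_rel_equiv.

Definition gfrac := {eq_quot frac_equiv}.
HB.instance Definition _ := Choice.on gfrac.
HB.instance Definition _ := Quotient.on gfrac.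

Definition frac_mk a s (s0 : s != 0) : gfrac := \pi_gfrac (exist _ (a, s) s0).

Lemma frac_mkP a s (s0 : s != 0) b t (t0 : t != 0) :
  frac_mk a s0 = frac_mk b t0 <->
  exists u w, [/\ s * u = t * w, u != 0, w != 0 & a * u = b * w].
Proof. by split=> [/eqmodP/asboolP|ab]; [|apply/eqmodP/asboolP]. Qed.

Lemma frac_mk_irr a s (s0 s0' : s != 0) : frac_mk a s0 = frac_mk a s0'.
Proof. by rewrite (bool_irrelevance s0 s0'). Qed.

Lemma frac_mkE (x : gfrac) : exists a s (s0 : s != 0), x = frac_mk a s0.
Proof.
by case E : (repr x) => [[a s] /= s0]; exists a, s, s0; rewrite -[LHS]reprK E.
Qed.

Lemma frac_mk_expand a s u (s0 : s != 0) (su0 : s * u != 0) :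
  frac_mk (a * u) su0 = frac_mk a s0.
Proof.
have u0 : u != 0 by apply/eqP => u0; move: su0; rewrite u0 mulr0 eqxx.
by apply/frac_mkP; exists 1, u; rewrite !mulr1 gring_rat_neq0.
Qed.

Lemma frac_mk_inj a b s (s0 : s != 0) : frac_mk a s0 = frac_mk b s0 -> a = b.
Proof.
move=> /frac_mkP[u [w [/(good_mulI gG s0) <- u0 _ au]]].
have [|/subr0_eq //|/eqP] := @good_domain G gG (a - b) u.
  by rewrite mulrBl au subrr.
by rewrite (negPf u0).
Qed.

Lemma frac_common k (x : 'I_k -> gfrac) :
  exists (a : 'I_k -> A) s (s0 : s != 0), forall i, x i = frac_mk (a i) s0.
Proof.
elim: k x => [|k IH] x; first by exists (fun _ => 0), 1, gring_rat_neq0; case.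
have [a [s [s0 E]]] := IH (fun i => x (lift ord0 i)).
have [b [t [t0 E0]]] := frac_mkE (x ord0).
have [u [w [u0 w0 su]]] := gring_ore s0 t0.
have su0 := gring_mul_neq0 s0 u0; have tw0 := gring_mul_neq0 t0 w0.
exists (fun i => if unlift ord0 i is Some j then a j * u else b * w), (s * u), su0.
move=> i; case: unliftP => [j ->|->]; first by rewrite E frac_mk_expand.
rewrite E0 -(frac_mk_expand _ t0 tw0).
by move: (su0); rewrite su => ?; apply: frac_mk_irr.
Qed.

Lemma frac_common2 (x y : gfrac) :
  exists a b s (s0 : s != 0), x = frac_mk a s0 /\ y = frac_mk b s0.
Proof.
have [a [s [s0 E]]] := frac_common (fun i : 'I_2 => if i == ord0 then x else y).
exists (a ord0), (a (lift ord0 ord0)), s, s0.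
by split; [have := E ord0 | have := E (lift ord0 ord0)].
Qed.

Lemma frac_common3 (x y z : gfrac) : exists a b c s (s0 : s != 0),
  [/\ x = frac_mk a s0, y = frac_mk b s0 & z = frac_mk c s0].
Proof.
have [a [s [s0 E]]] := frac_common (fun i : 'I_3 => nth x [:: x; y; z] i).
exists (a 0), (a 1), (a 2%:R), s, s0.
by split; [have := E 0 | have := E 1 | have := E 2%:R].
Qed.

Fact frac_add_ex (x y : gfrac) : exists z, exists a b s (s0 : s != 0),
  [/\ x = frac_mk a s0, y = frac_mk b s0 & z = frac_mk (a + b) s0].
Proof.
by have [a [b [s [s0 [-> ->]]]]] := frac_common2 x y;
  exists (frac_mk (a + b) s0), a, b, s, s0.
Qed.

Definition frac_add x y := projT1 (cid (frac_add_ex x y)).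

Lemma frac_addE a b s (s0 : s != 0) :
  frac_add (frac_mk a s0) (frac_mk b s0) = frac_mk (a + b) s0.
Proof.
rewrite /frac_add; case: cid => z /= [a' [b' [t [t0 [E1 E2 ->]]]]].
have [u [w [u0 w0 su]]] := gring_ore s0 t0.
have su0 := gring_mul_neq0 s0 u0; have tw0 := gring_mul_neq0 t0 w0.
move: E1 E2; rewrite -(frac_mk_expand a s0 su0) -(frac_mk_expand b s0 su0).
rewrite -(frac_mk_expand a' t0 tw0) -(frac_mk_expand b' t0 tw0).
rewrite -(frac_mk_expand _ s0 su0) -(frac_mk_expand _ t0 tw0).
move: (su0) (tw0); rewrite su => q0 q1; rewrite (bool_irrelevance q1 q0).
by move=> /frac_mk_inj E1 /frac_mk_inj E2; rewrite !mulrDl E1 E2.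
Qed.

Fact frac_mul_ex e (x : gfrac) : exists y, exists a s (s0 : s != 0),
  x = frac_mk a s0 /\ y = frac_mk (e * a) s0.
Proof.
by have [a [s [s0 ->]]] := frac_mkE x; exists (frac_mk (e * a) s0), a, s, s0.
Qed.

Definition frac_mul e x := projT1 (cid (frac_mul_ex e x)).

Lemma frac_mulE e a s (s0 : s != 0) :
  frac_mul e (frac_mk a s0) = frac_mk (e * a) s0.
Proof.
rewrite /frac_mul; case: cid => z /= [a' [t [t0 [/frac_mkP[u [w [su u0 w0 au]]] ->]]]].
by apply/esym/frac_mkP; exists u, w; rewrite -!mulrA au.
Qed.

Definition frac_zero := frac_mk 0 gring_rat_neq0.

Lemma frac_zeroE s (s0 : s != 0) : frac_mk 0 s0 = frac_zero.
Proof. by apply/frac_mkP; exists 1, s; rewrite !mul0r mul1r mulr1 gring_rat_neq0. Qed.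

Fact frac_addA : associative frac_add.
Proof.
move=> x y z; have [a [b [c [s [s0 [-> -> ->]]]]]] := frac_common3 x y z.
by rewrite !frac_addE addrA.
Qed.
Fact frac_addC : commutative frac_add.
Proof.
move=> x y; have [a [b [s [s0 [-> ->]]]]] := frac_common2 x y.
by rewrite !frac_addE addrC.
Qed.
Fact frac_add0 : left_id frac_zero frac_add.
Proof.
move=> x; have [a [s [s0 ->]]] := frac_mkE x.
by rewrite -(frac_zeroE s0) frac_addE add0r.
Qed.
Fact frac_addN : left_inverse frac_zero (frac_mul (-1)) frac_add.
Proof.
move=> x; have [a [s [s0 ->]]] := frac_mkE x.
by rewrite frac_mulE frac_addE mulN1r addNr frac_zeroE.
Qed.

HB.instance Definition _ :=
  GRing.isZmodule.Build gfrac frac_addA frac_addC frac_add0 frac_addN.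

Lemma frac_mkD a b s (s0 : s != 0) :
  frac_mk (a + b) s0 = frac_mk a s0 + frac_mk b s0.
Proof. by rewrite -frac_addE. Qed.

Lemma frac_mk0 a s (s0 : s != 0) : frac_mk a s0 = 0 <-> a = 0.
Proof. by rewrite -[0]/frac_zero -(frac_zeroE s0); split=> [/frac_mk_inj|->]. Qed.

Lemma frac_mulDr e : {morph frac_mul e : x y / x + y}.
Proof.
move=> x y; have [a [b [s [s0 [-> ->]]]]] := frac_common2 x y.
by rewrite -frac_mkD !frac_mulE mulrDr frac_mkD.
Qed.
Lemma frac_mulDl x : {morph frac_mul^~ x : e f / e + f}.
Proof.
by move=> e f; have [a [s [s0 ->]]] := frac_mkE x; rewrite !frac_mulE mulrDl frac_mkD.
Qed.
Lemma frac_mulM e f x : frac_mul e (frac_mul f x) = frac_mul (e * f) x.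
Proof. by have [a [s [s0 ->]]] := frac_mkE x; rewrite !frac_mulE mulrA. Qed.
Lemma frac_mul1 x : frac_mul 1 x = x.
Proof. by have [a [s [s0 ->]]] := frac_mkE x; rewrite frac_mulE mul1r. Qed.

Definition frac_scale (q : rat) := frac_mul << q *g 1%g >>.

Fact frac_scaleA p q x : frac_scale p (frac_scale q x) = frac_scale (p * q) x.
Proof. by rewrite /frac_scale frac_mulM gringUU mulg1. Qed.
Fact frac_scaleDl x : {morph frac_scale^~ x : p q / p + q}.
Proof. by move=> p q; rewrite /frac_scale -frac_mulDl -monalgUD. Qed.

HB.instance Definition _ := GRing.Zmodule_isLmodule.Build rat gfrac
  frac_scaleA frac_mul1 (fun q => frac_mulDr _) frac_scaleDl.

Lemma frac_neq0 : frac_mk 1 gring_rat_neq0 != 0.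
Proof. by apply/eqP => /frac_mk0 /eqP; rewrite (negPf gring_rat_neq0). Qed.

Section FracMatrix.
Variables (k : nat) (T : 'I_k -> 'I_k -> A).
Hypothesis Tinj : forall w : 'I_k -> A,
  (forall i, \sum_j T i j * w j = 0) -> forall j, w j = 0.

Let frac_mk_sum (a : 'I_k -> A) s (s0 : s != 0) :
  \sum_j frac_mk (a j) s0 = frac_mk (\sum_j a j) s0.
Proof.
by rewrite (big_morph (fun a => frac_mk a s0) (fun a b => frac_mkD a b s0)
  (frac_zeroE s0)).
Qed.

Lemma frac_matrix_inj (x : 'I_k -> gfrac) :
  (forall i, \sum_j frac_mul (T i j) (x j) = 0) -> forall j, x j = 0.
Proof.
have [a [s [s0 E]]] := frac_common x; move=> Tx j; rewrite E; apply/frac_mk0.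
move: j; apply: Tinj => i; apply/(frac_mk0 _ s0); rewrite -(Tx i) -frac_mk_sum.
by apply: eq_bigr => j _; rewrite E frac_mulE.
Qed.

(** With [y = a s^-1] and [T b = a t], the solution is [b (s t)^-1]. *)
Lemma frac_matrix_surj (y : 'I_k -> gfrac) :
  exists x : 'I_k -> gfrac, forall i, \sum_j frac_mul (T i j) (x j) = y i.
Proof.
have [a [s [s0 E]]] := frac_common y; have [b [t [t0 Tb]]] := good_ore gG a Tinj.
have st0 := gring_mul_neq0 s0 t0.
exists (fun j => frac_mk (b j) st0) => i.
under eq_bigr do rewrite frac_mulE.
by rewrite frac_mk_sum Tb frac_mk_expand E.
Qed.

End FracMatrix.

Lemma frac_mul_inj e x : e != 0 -> frac_mul e x = 0 -> x = 0.
Proof.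
move=> e0 ex; apply: (@frac_matrix_inj 1 (fun _ _ => e) _ (fun _ => x) _ ord0).
  move=> w ew j; have := ew ord0; rewrite big_ord1 => /(good_domain gG) [/eqP|].
    by rewrite (negPf e0).
  by rewrite (ord1 j).
by move=> i; rewrite big_ord1.
Qed.

Lemma frac_mul_surj e y : e != 0 -> exists x, frac_mul e x = y.
Proof.
move=> e0; have [|x xE] := @frac_matrix_surj 1 (fun _ _ => e) _ (fun _ => y).
  move=> w ew j; have := ew ord0; rewrite big_ord1 => /(good_domain gG) [/eqP|].
    by rewrite (negPf e0).
  by rewrite (ord1 j).
by exists (x ord0); rewrite -(xE ord0) big_ord1.
Qed.

Fact frac_mulB e : {morph frac_mul e : x y / x - y}.
Proof.
by move=> x y; apply: (addIr (frac_mul e y)); rewrite -frac_mulDr !subrK.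
Qed.

Definition frac_endo e : endo gfrac := Endo (frac_mulB e).

Definition frac_act : monoid_act G (endo gfrac).
Proof.
exists (fun g => frac_endo (gring_of rat g)).
  by apply: endo_eq => x; apply: frac_mul1.
by move=> g h; apply: endo_eq => x; rewrite /= frac_mulM gring_ofM.
Defined.

Lemma good_frac : good (sdprod frac_act (emod gfrac)).
Proof.
apply: good_sdprod gG => v v0.
have zZ (c : rat) (x : gfrac) : x = 0 -> c *: x = 0 by move=> ->; rewrite scaler0.
have zB (x y : gfrac) : x = 0 -> y = 0 -> x - y = 0 by move=> -> ->; rewrite subrr.
have divQ (c : rat) : c != 0 -> exists q : rat, q * c = 1.
  by move=> c0; exists c^-1; rewrite mulVf.
have [l [lD _ _ lv]] :=
  @linear_form rat gfrac divQ
    (LSubmod (in_lsub := fun x : gfrac => x = 0) erefl zB zZ) v v0.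
by exists l; split=> //; rewrite lv; apply/eqP; rewrite oner_eq0.
Qed.

End Fractions.

(** * Groups locally embeddable into good groups *)

(** [th] is a mere map, multiplicative on [X] only. Separating one pair at a time makes the notion
    pass to arbitrary products; finitely many pairs are then separated by a finite product of
    models. *)
Definition locally_good (B : groupType) :=
  forall (X : seq B) (x y : B), x <> y ->
  exists (G : groupType) (th : B -> G), [/\ good G, th x <> th y &
    forall a b, a \in X -> b \in X -> th (a * b)%g = (th a * th b)%g].

Lemma locally_good_pairs (B : groupType) (X : seq B) (P : seq (B * B)) :
    locally_good B -> (forall p, p \in P -> p.1 <> p.2) ->
  exists (G : groupType) (th : B -> G), [/\ good G,
    forall a b, a \in X -> b \in X -> th (a * b)%g = (th a * th b)%g &
    forall p, p \in P -> th p.1 <> th p.2].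
Proof.
move=> lB; elim: P => [|p P IH] dP.
  (* The empty product serves as the trivial group. *)
  exists (gprod (fun j : void => B)), (fun _ => 1%g); split=> // [|a b _ _].
    by apply: good_trivial => x; apply: functional_extensionality_dep; case.
  by rewrite mulg1.
have [|G [th [gG thM thP]]] := IH.
  by move=> q qP; apply: dP; rewrite inE qP orbT.
have [|G' [th' [gG' thp thM']]] := lB X p.1 p.2; first by apply: dP; rewrite mem_head.
exists (G' * G)%type, (fun b => (th' b, th b)); split; first exact: good_pair.
  by move=> a b aX bX; congr pair; [apply: thM' | apply: thM].
move=> q; rewrite inE => /predU1P[-> [/thp//]|/thP qP [_ /qP//]].
Qed.

Lemma locally_good_model (B : groupType) : locally_good B ->
  forall X : seq B, exists (G : groupType) (th : B -> G), [/\ good G,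
    forall a b, a \in X -> b \in X -> th (a * b)%g = (th a * th b)%g &
    forall a b, a \in X -> b \in X -> th a = th b -> a = b].
Proof.
move=> lB X; pose P := [seq p <- [seq (a, b) | a <- X, b <- X] | p.1 != p.2].
have [|G [th [gG thM thP]]] := locally_good_pairs X (P := P) lB.
  by move=> p; rewrite mem_filter => /andP[/eqP].
exists G, th; split=> // a b aX bX thab; apply: contrapT => /eqP ab.
by apply: (thP (a, b)) => //; rewrite mem_filter ab; apply: allpairs_f.
Qed.

Definition dmod (J : Type) (V : J -> lmodType rat) : Type := forall j, V j.

Section DependentModule.
Variables (J : Type) (V : J -> lmodType rat).
Local Notation M := (dmod V).
Local Notation ext := functional_extensionality_dep.

HB.instance Definition _ := gen_eqMixin M.
HB.instance Definition _ := gen_choiceMixin M.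

Definition dmod_zero : M := fun j => 0.
Definition dmod_add (u v : M) : M := fun j => u j + v j.
Definition dmod_opp (u : M) : M := fun j => - u j.
Definition dmod_scale (q : rat) (u : M) : M := fun j => q *: u j.

Fact dmod_addA : associative dmod_add.
Proof. by move=> u v w; apply: ext => j; apply: addrA. Qed.
Fact dmod_addC : commutative dmod_add.
Proof. by move=> u v; apply: ext => j; apply: addrC. Qed.
Fact dmod_add0 : left_id dmod_zero dmod_add.
Proof. by move=> u; apply: ext => j; apply: add0r. Qed.
Fact dmod_addN : left_inverse dmod_zero dmod_opp dmod_add.
Proof. by move=> u; apply: ext => j; apply: addNr. Qed.

HB.instance Definition _ :=
  GRing.isZmodule.Build M dmod_addA dmod_addC dmod_add0 dmod_addN.

Fact dmod_scaleA p q u : dmod_scale p (dmod_scale q u) = dmod_scale (p * q) u.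
Proof. by apply: ext => j; apply: scalerA. Qed.
Fact dmod_scale1 : left_id 1 dmod_scale.
Proof. by move=> u; apply: ext => j; apply: scale1r. Qed.
Fact dmod_scaleDr : right_distributive dmod_scale +%R.
Proof. by move=> q u v; apply: ext => j; apply: scalerDr. Qed.
Fact dmod_scaleDl u : {morph dmod_scale^~ u : p q / p + q}.
Proof. by move=> p q; apply: ext => j; apply: scalerDl. Qed.

HB.instance Definition _ := GRing.Zmodule_isLmodule.Build rat M
  dmod_scaleA dmod_scale1 dmod_scaleDr dmod_scaleDl.

End DependentModule.

(** * Reduced products of modules of fractions *)

Section Eventually.
Variable B : eqType.

(** Truth along the filter generated by the finite sets containing a given one. A filter suffices:
    what is asked of [germs] is that certain operators be bijective, and this is inherited from the
    coordinates at all large [X]. *)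
Definition eventually (P : seq B -> Prop) :=
  exists X0 : seq B, forall X, {subset X0 <= X} -> P X.

Lemma eventuallyT (P : seq B -> Prop) : (forall X, P X) -> eventually P.
Proof. by move=> PX; exists [::]. Qed.

Lemma eventually_mem x : eventually (fun X => x \in X).
Proof. by exists [:: x] => X; apply; rewrite mem_head. Qed.

Lemma eventually_and P Q :
  eventually P -> eventually Q -> eventually (fun X => P X /\ Q X).
Proof.
move=> [X PX] [Y QY]; exists (X ++ Y) => Z XYZ.
by split; [apply: PX | apply: QY] => x xX; apply: XYZ; rewrite mem_cat xX ?orbT.
Qed.

Lemma eventually_sub (P Q : seq B -> Prop) :
  (forall X, P X -> Q X) -> eventually P -> eventually Q.
Proof. by move=> PQ [X PX]; exists X => Y /PX/PQ. Qed.

Lemma eventually_all (T : eqType) (s : seq T) (P : T -> seq B -> Prop) :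
    (forall t, t \in s -> eventually (P t)) ->
  eventually (fun X => forall t, t \in s -> P t X).
Proof.
elim: s => [|t s IH] evP; first exact: eventuallyT.
have evs : eventually (fun X => forall t, t \in s -> P t X).
  by apply: IH => u us; apply: evP; rewrite inE us orbT.
apply: eventually_sub (eventually_and (evP t (mem_head _ _)) evs).
by move=> X [Pt Ps] u; rewrite inE => /predU1P[->//|]; apply: Ps.
Qed.

End Eventually.

(* The reduced product of the modules of fractions of good groups [Gm X]
   approximating [B] on its finite subsets [X] *)
Section Germs.
Variables (B : groupType) (Gm : seq B -> groupType).
Variables (gG : forall X, good (Gm X)) (th : forall X, B -> Gm X).
Arguments th : clear implicits.
Hypothesis thM : forall X a b, a \in X -> b \in X ->
  th X (a * b)%g = (th X a * th X b)%g.
Hypothesis thI : forall X a b, a \in X -> b \in X -> th X a = th X b -> a = b.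

Let fracs (X : seq B) : lmodType rat := gfrac (gG X).
Local Notation nets := (dmod fracs).

Definition null_nets : lsubmod nets.
Proof.
exists (fun v : nets => eventually (fun X => v X = 0)).
- exact: eventuallyT.
- move=> u v u0 v0; apply: eventually_sub (eventually_and u0 v0) => X [uX vX].
  by rewrite -[LHS]/(u X - v X) uX vX subrr.
- move=> q v; apply: eventually_sub => X vX.
  by rewrite -[LHS]/(q *: v X) vX scaler0.
Defined.

Definition germs : lmodType rat := lquo null_nets.
Definition germ (v : nets) : germs := lquo_mk null_nets v.

Lemma germP u v : germ u = germ v <-> eventually (fun X => u X = v X).
Proof.
rewrite lquo_mkP; split; apply: eventually_sub => X; first by move/subr0_eq.
by rewrite -[(u - v) X]/(u X - v X) => ->; rewrite subrr.
Qed.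

Lemma germE (x : germs) : exists v, x = germ v.
Proof. by exists (repr x); rewrite -[LHS](lquo_reprK x). Qed.

Lemma germB u v : germ u - germ v = germ (fun X => u X - v X).
Proof. by rewrite /germ -lquo_mkN -lquo_mkD. Qed.

Lemma germ_sum (I : Type) (r : seq I) (P : pred I) (F : I -> nets) :
  \sum_(i <- r | P i) germ (F i) =
  germ (fun X => \sum_(i <- r | P i) (F i X : gfrac (gG X))).
Proof.
elim: r => [|i r IH].
  rewrite big_nil; apply/esym/lquo_mk0/eventuallyT => X; exact: big_nil.
rewrite big_cons IH; case: ifP => Pi.
  rewrite -lquo_mkD; congr germ; apply: functional_extensionality_dep => X.
  by rewrite big_cons Pi.
by congr germ; apply: functional_extensionality_dep => X; rewrite big_cons Pi.
Qed.

Definition germ_fun (e : forall X, gring rat (Gm X)) (x : germs) : germs :=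
  germ (fun X => frac_mul (e X) ((repr x : nets) X)).

Lemma germ_funE e v : germ_fun e (germ v) = germ (fun X => frac_mul (e X) (v X)).
Proof.
apply/germP; have /germP := lquo_reprK (germ v).
by apply: eventually_sub => X ->.
Qed.

Fact germ_funB e : {morph germ_fun e : x y / x - y}.
Proof.
move=> x y; have [u ->] := germE x; have [v ->] := germE y.
rewrite germB !germ_funE germB; congr germ.
by apply: functional_extensionality_dep => X; apply: frac_mulB.
Qed.

Definition germ_endo e : endo germs := Endo (germ_funB e).

Lemma germ_endo_eq e e' : eventually (fun X => e X = e' X) ->
  germ_endo e = germ_endo e'.
Proof.
move=> ee; apply: endo_eq => x; have [v ->] := germE x.
by rewrite /= !germ_funE; apply/germP; apply: eventually_sub ee => X ->.
Qed.

Lemma germ_endoM e e' : germ_endo (fun X => e X * e' X) = germ_endo e * germ_endo e'.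
Proof.
apply: endo_eq => x; have [v ->] := germE x.
rewrite /= !germ_funE; congr germ; apply: functional_extensionality_dep => X.
by rewrite frac_mulM.
Qed.

Lemma germ_endo1 : germ_endo (fun X => 1) = 1.
Proof.
apply: endo_eq => x; have [v ->] := germE x.
rewrite /= !germ_funE; congr germ; apply: functional_extensionality_dep => X.
exact: frac_mul1.
Qed.

Lemma germ_endoD e e' : germ_endo (fun X => e X + e' X) = germ_endo e + germ_endo e'.
Proof.
apply: endo_eq => x; have [v ->] := germE x.
rewrite /= !germ_funE -lquo_mkD; congr germ; apply: functional_extensionality_dep => X.
by rewrite frac_mulDl.
Qed.

Lemma germ_endoN e : germ_endo (fun X => - e X) = - germ_endo e.
Proof.
apply/eqP; rewrite -addr_eq0 -germ_endoD; apply/eqP; apply: endo_eq => x.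
have [v ->] := germE x; rewrite /= germ_funE; apply/lquo_mk0/eventuallyT => X.
rewrite addNr; have [a [s [s0 ->]]] := frac_mkE (v X : gfrac (gG X)).
by rewrite frac_mulE mul0r frac_zeroE.
Qed.

Variables (R : pzRingType) (f : {rmorphism R -> rat}).

(** For a fixed [X] this may fail to be multiplicative, as [th X] is so only on [X]; two given
    elements are multiplied correctly from some [X] on, which is all that germs see. *)
Definition push (X : seq B) (a : gring R B) : gring rat (Gm X) :=
  mlift (fun b r => << f r *g th X b >>) a.

Let pushf X b : {morph (fun r => << f r *g th X b >>) : r s / r - s}.
Proof. by move=> r s; rewrite rmorphB monalgUB. Qed.

Lemma pushU X r b : push X << r *g b >> = << f r *g th X b >>.
Proof. exact: (mliftU (@pushf X)). Qed.
Lemma pushD X : {morph push X : a b / a + b}.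
Proof. exact: (mliftD (@pushf X)). Qed.
Lemma push0 X : push X 0 = 0.
Proof. exact: mlift0. Qed.

Lemma aug_push X a : augmentation (push X a) = f (augmentation a).
Proof.
elim/gring_ind: a => [|a b IHa IHb|r b]; first by rewrite push0 !rmorph0.
  have D (R' : pzRingType) (G : groupType) (u v : gring R' G) :
    augmentation (u + v) = augmentation u + augmentation v by exact: rmorphD.
  by rewrite pushD D IHa IHb D rmorphD.
by rewrite pushU !augmentationU.
Qed.

Lemma germ_action_ex : exists phi : {rmorphism gring R B -> endo germs},
  forall a, phi a = germ_endo (fun X => push X a).
Proof.
pose i0 (r : R) := germ_endo (fun X => << f r *g 1%g >>).
have i0B : zmod_morphism i0.
  move=> r s; rewrite /i0 -germ_endoN -germ_endoD; congr germ_endo.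
  by apply: functional_extensionality_dep => X; rewrite rmorphB monalgUB.
have i0M : monoid_morphism i0.
  split=> [|r s]; rewrite /i0 -?germ_endo1 -?germ_endoM; congr germ_endo;
    apply: functional_extensionality_dep => X.
    by rewrite rmorph1.
  by rewrite gringUU mulg1 rmorphM.
pose m1 := GRing.isZmodMorphism.Build R (endo germs) i0 i0B.
pose m2 := GRing.isMonoidMorphism.Build R (endo germs) i0 i0M.
pose i := HB.pack_for {rmorphism R -> endo germs} i0 m1 m2.
pose rho b := germ_endo (fun X => gring_of rat (th X b)).
have rhoM a b : rho (a * b)%g = rho a * rho b.
  rewrite /rho -germ_endoM; apply: germ_endo_eq.
  apply: eventually_sub (eventually_and (eventually_mem a) (eventually_mem b)).
  by move=> X [aX bX]; rewrite thM // gring_ofM.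
have rho1 : rho 1%g = 1.
  rewrite /rho -germ_endo1; apply: germ_endo_eq.
  apply: eventually_sub (eventually_mem 1%g) => X X1.
  have := thM X1 X1; rewrite mulg1 => th1.
  suff -> : th X 1%g = 1%g by [].
  by apply: (mulgI (th X 1%g)); rewrite -th1 mulg1.
have iC r b : i r * rho b = rho b * i r.
  rewrite /= /i0 /rho -!germ_endoM; congr germ_endo.
  apply: functional_extensionality_dep => X.
  by rewrite /gring_of !gringUU mulr1 mul1r mulg1 mul1g.
have [phi phiE] := gring_lift_ex rho1 rhoM iC; exists phi.
elim/gring_ind=> [|a b IHa IHb|r b].
- rewrite rmorph0 -[LHS](subrr (germ_endo (fun X => 0))) -germ_endoN -germ_endoD.
  congr germ_endo; apply: functional_extensionality_dep => X.
  by rewrite push0 subrr.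
- rewrite rmorphD IHa IHb -germ_endoD; congr germ_endo.
  by apply: functional_extensionality_dep => X; rewrite pushD.
- rewrite phiE /= /i0 /rho -germ_endoM; congr germ_endo.
  apply: functional_extensionality_dep => X.
  by rewrite pushU /gring_of gringUU mulr1 mul1g.
Qed.

End Germs.

Section GermAction.
Variables (B : groupType) (Gm : seq B -> groupType).
Variables (gG : forall X, good (Gm X)) (th : forall X, B -> Gm X).
Arguments th : clear implicits.
Hypothesis thM : forall X a b, a \in X -> b \in X ->
  th X (a * b)%g = (th X a * th X b)%g.
Hypothesis thI : forall X a b, a \in X -> b \in X -> th X a = th X b -> a = b.
Local Notation germs := (germs gG).
Local Notation germ := (@germ B Gm gG).
Local Notation germ_endo := (germ_endo gG).
Local Notation nets := (dmod (fun X => gfrac (gG X) : lmodType rat)).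

Lemma germD (u v : nets) : germ u + germ v = germ (fun X => u X + v X).
Proof. by rewrite /germ -lquo_mkD. Qed.

Lemma germ_endo_inj e x :
  eventually (fun X => e X != 0) -> germ_endo e x = 0 -> x = 0.
Proof.
move=> e0; have [v ->] := germE x; rewrite /= germ_funE => /lquo_mk0 ev0.
apply/lquo_mk0; apply: eventually_sub (eventually_and e0 ev0) => X [eX vX].
exact: frac_mul_inj eX vX.
Qed.

Lemma germ_endo_surj e y :
  eventually (fun X => e X != 0) -> exists x, germ_endo e x = y.
Proof.
move=> e0; have [v ->] := germE y.
(* Where [e X = 0], the coordinate does not affect the germ and defaults to 0. *)
have wE X : exists w, e X != 0 -> frac_mul (e X) w = v X.
  have [eX|eX] := eqVneq (e X) 0; first by exists 0.
  by have [w wE] := frac_mul_surj (v X : gfrac (gG X)) eX; exists w.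
exists (germ (fun X => projT1 (cid (wE X)))); rewrite /= germ_funE; apply/germP.
by apply: eventually_sub e0 => X eX; case: cid => w /=; apply.
Qed.

Definition germ_one : germs := germ (fun X => frac_mk (gG X) 1 (gring_rat_neq0 _)).

Lemma germ_one_neq0 : germ_one <> 0.
Proof.
by move=> /lquo_mk0[X /(_ X)]; move/(_ (fun x xX => xX))/eqP; apply/negP/frac_neq0.
Qed.

Variables (R : pzRingType) (f : {rmorphism R -> rat}).
Hypothesis f_inj : injective f.

(** When [X] contains the support of [a], [th X] is injective on it and no two terms merge. *)
Lemma push_neq0 (a : gring R B) : a != 0 ->
  eventually (fun X => push th f X a != 0).
Proof.
move=> a0; have [b ba] : exists b, b \in msupp a.
  apply: contrapT => nob; case/eqP: a0; rewrite [LHS]monalgE big1_seq // => b ba.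
  by case: nob; exists b.
exists (msupp a) => X aX; apply/eqP => /(congr1 (mcoeff (th X b))).
rewrite mcoeff0 /push /mlift raddf_sum /= (bigD1_seq b) //= mcoeffU eqxx mulr1n.
rewrite big1_seq ?addr0.
  rewrite -(rmorph0 f) => /f_inj ab.
  by have := ba; rewrite -mcoeff_neq0 ab eqxx.
move=> k /andP[kb ka]; rewrite mcoeffU; case: eqP => // E; case/eqP: kb.
by apply: (thI (X := X)); rewrite ?aX.
Qed.

Variable phi : {rmorphism gring R B -> endo germs}.
Hypothesis phiE : forall a, phi a = germ_endo (fun X => push th f X a).

(** For every [X], the pushed matrix has the same augmentation, invertible over the rationals.
    Strebel's property makes it injective over the group ring, and the Ore property then makes it
    bijective on fractions. *)
Lemma germ_action_inverting : cohn_inverting phi.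
Proof.
move=> k A [A' [AA' A'A]].
pose faug : {rmorphism gring R B -> rat} := f \o @augmentation R B.
have Tinj X (w : 'I_k -> gring rat (Gm X)) :
    (forall i, \sum_j push th f X (A i j) * w j = 0) -> forall j, w j = 0.
  apply: (good_strebel (gG X)) => u uA j.
  have Minv : invertible_mx (map_mx faug A).
    exists (map_mx f A'); rewrite map_mx_comp -!map_mxM AA' A'A.
    by split; rewrite map_mx1.
  apply: (@invertible_inj _ _ rat^o faug _ A Minv) => i.
  by rewrite -[RHS](uA i); apply: eq_bigr => l _; rewrite aug_push.
apply: invertible_endo => [v|w].
  have /choice[vv vvE] : forall i, exists u, v i = germ u by move=> i; apply: germE.
  have wE X : exists w : 'I_k -> gfrac (gG X),
      forall i, \sum_j frac_mul (push th f X (A i j)) (w j) = vv i X.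
    exact: (frac_matrix_surj (@Tinj X) (fun i => vv i X)).
  exists (fun j => germ (fun X => projT1 (cid (wE X)) j)) => i.
  under eq_bigr do rewrite mxE phiE /= germ_funE.
  rewrite germ_sum vvE; congr germ; apply: functional_extensionality_dep => X.
  by case: cid => w /= ->.
move=> Aw; have /choice[ww wwE] : forall i, exists u, w i = germ u.
  by move=> i; apply: germE.
have ev : eventually (fun X => forall i, i \in enum 'I_k ->
    \sum_j frac_mul (push th f X (A i j)) (ww j X : gfrac (gG X)) = 0).
  apply: eventually_all => i _.
  suff /lquo_mk0 : germ (fun X => \sum_j frac_mul (push th f X (A i j))
      (ww j X : gfrac (gG X))) = 0 by [].
  rewrite -[RHS](Aw i) -germ_sum; apply: eq_bigr => j _.
  by rewrite mxE phiE wwE /= germ_funE.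
move=> j; rewrite wwE; apply/lquo_mk0; apply: eventually_sub ev => X AwX.
apply: (@frac_matrix_inj _ (gG X) _ _ (@Tinj X) (fun j => ww j X)) => i.
by apply: AwX; rewrite mem_enum.
Qed.

(** An element [(v, b)] is sent to the [Z]-coordinate of a representative of [v], paired with
    [th Z b]. This is multiplicative on [X] for large [Z]; and if two elements had equal images for
    all large [Z], their germs would coincide. *)
Lemma locally_good_germs (r : monoid_act B (endo germs)) :
  (forall b, r b = gact phi b) -> locally_good (sdprod r (emod germs)).
Proof.
move=> rE X x y xy.
pose theta Z (u : sdprod r (emod germs)) :
    sdprod (frac_act (gG Z)) (emod (gfrac (gG Z))) :=
  ((repr (u.1 : germs) : nets) Z, th Z u.2).
have thetaM a b : eventually (fun Z => theta Z (a * b)%g = (theta Z a * theta Z b)%g).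
  have ev1 : eventually (fun Z => (repr ((a * b)%g.1 : germs) : nets) Z =
      (repr (a.1 : germs) : nets) Z + frac_mul (gring_of rat (th Z a.2))
         ((repr (b.1 : germs) : nets) Z : gfrac (gG Z))).
    pose v Z : gfrac (gG Z) :=
      frac_mul (gring_of rat (th Z a.2)) ((repr (b.1 : germs) : nets) Z).
    suff /germP : germ (repr ((a * b)%g.1 : germs)) =
        germ (fun Z => (repr (a.1 : germs) : nets) Z + v Z) by [].
    rewrite -germD [LHS]lquo_reprK [X in X + _]lquo_reprK sd_mulE rE /=; congr (_ + _).
    rewrite -[X in _ *: X]lquo_reprK [LHS]/(phi _ _) phiE /= germ_funE; congr germ.
    apply: functional_extensionality_dep => Z.
    by rewrite pushU rmorph1.
  apply: eventually_sub (eventually_and ev1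
    (eventually_and (eventually_mem a.2) (eventually_mem b.2))).
  move=> Z [abZ [aZ bZ]]; rewrite [RHS]sd_mulE; congr pair; last exact: thM.
  exact: abZ.
have [Z0 Z0P] : eventually (fun Z =>
    (forall a, a \in X -> forall b, b \in X ->
       theta Z (a * b)%g = (theta Z a * theta Z b)%g) /\ (x.2 \in Z /\ y.2 \in Z)).
  apply: eventually_and; last by apply: eventually_and; apply: eventually_mem.
  by apply: eventually_all => a _; apply: eventually_all => b _; apply: thetaM.
have [Z Z0Z xyZ] : exists2 Z, {subset Z0 <= Z} & theta Z x <> theta Z y.
  apply: contrapT => noZ; apply: xy.
  have thetaE Z : {subset Z0 <= Z} -> theta Z x = theta Z y.
    by move=> Z0Z; apply: contrapT => xyZ; apply: noZ; exists Z.
  have E2 : x.2 = y.2.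
    have [_ [xZ yZ]] := Z0P Z0 (fun x xZ => xZ).
    by have [_ /thI] := thetaE Z0 (fun x xZ => xZ); apply.
  rewrite [x]surjective_pairing [y]surjective_pairing E2; congr pair.
  rewrite -[x.1]lquo_reprK -[y.1]lquo_reprK; apply/germP; exists Z0 => Z /thetaE E.
  exact: (congr1 fst E).
exists (sdprod (frac_act (gG Z)) (emod (gfrac (gG Z)))), (theta Z); split=> //.
  exact: good_frac.
by move=> a b aX bX; apply: (Z0P Z Z0Z).1.
Qed.

End GermAction.

(** Two actions on [V] that agree on [B]: the one of [gring R B] inverts matrices as Cohn does, the
    one of [gring int B] lets non-zero elements act bijectively, as a module of Harvey type must. *)
Lemma locally_good_module (R : pzRingType) (f : {rmorphism R -> rat})
    (B : groupType) : injective f -> locally_good B ->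
  exists (V : zmodType) (phi : {rmorphism gring R B -> endo V})
    (psi : {rmorphism gring int B -> endo V}) (v0 : V), v0 <> 0 /\
  [/\ cohn_inverting phi,
      forall r : monoid_act B (endo V), (forall b, r b = gact phi b) ->
        locally_good (sdprod r (emod V)),
      forall b, psi (gring_of int b) = phi (gring_of R b) &
      forall a, a != 0 ->
        (forall v, psi a v = 0 -> v = 0) /\ forall w, exists v, psi a v = w].
Proof.
move=> f_inj lB; pose M X := cid (locally_good_model lB X).
pose Gm X := projT1 (M X).
pose th X : B -> Gm X := projT1 (cid (projT2 (M X))).
have thP X : [/\ good (Gm X),
    forall a b, a \in X -> b \in X -> th X (a * b)%g = (th X a * th X b)%g &
    forall a b, a \in X -> b \in X -> th X a = th X b -> a = b].
  exact: (projT2 (cid (projT2 (M X)))).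
have gG X : good (Gm X) by have [] := thP X.
have thM X a b : a \in X -> b \in X -> th X (a * b)%g = (th X a * th X b)%g.
  by have [_ tM _] := thP X; apply: tM.
have thI X a b : a \in X -> b \in X -> th X a = th X b -> a = b.
  by have [_ _ tI] := thP X; apply: tI.
have [phi phiE] := germ_action_ex gG thM f.
have [psi psiE] := germ_action_ex gG thM (intr : {rmorphism int -> rat}).
exists (germs gG), phi, psi, (germ_one gG); split; first exact: germ_one_neq0.
split.
- exact: germ_action_inverting phiE.
- by move=> r; apply: (locally_good_germs thM thI phiE).
- move=> b; rewrite phiE psiE; congr germ_endo.
  by apply: functional_extensionality_dep => X; rewrite !pushU !rmorph1.
- move=> a a0; have ev := push_neq0 thI (@intr_inj rat) a0.
  by split=> [v|w]; rewrite psiE; [apply: germ_endo_inj | apply: germ_endo_surj].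
Qed.

Lemma locally_good_gprod (J : Type) (B : J -> groupType) :
  (forall j, locally_good (B j)) -> locally_good (gprod B).
Proof.
move=> lB X x y xy.
have [j xyj] : exists j, x j <> y j.
  apply: contrapT => nj; apply: xy; apply: functional_extensionality_dep => j.
  by apply: contrapT => xyj; apply: nj; exists j.
have [G [th [gG thxy thM]]] := lB j [seq u j | u : gprod B <- X] _ _ xyj.
exists G, (fun u => th (u j)); split=> // a b aX bX.
by rewrite gprod_mulE thM //; apply: (map_f (fun u : gprod B => u j)).
Qed.

(** * Embedding an Ore localization into a module *)

Section OreModule.
Variables (A K : pzRingType) (kap : {rmorphism A -> K}).
Hypothesis ore : ore_localization kap.

Lemma ore_left_inverse (c : K) : c != 0 -> exists e, e * c = 1.
Proof.
have [_ _ inv fr] := ore => c0; have [a [s [s0 cs]]] := fr c.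
have [t [st ts]] := inv s s0.
have ct : c = kap a * t by rewrite -cs -mulrA st mulr1.
have a0 : a != 0 by apply: contraNneq c0 => a0; rewrite ct a0 rmorph0 mul0r.
have [u [au ua]] := inv a a0; exists (kap s * u).
by rewrite ct -mulrA (mulrA u) ua mul1r.
Qed.

Variables (V : zmodType) (psi : {rmorphism A -> endo V}) (v0 : V).
Hypothesis v00 : v0 <> 0.
Hypothesis psi_bij : forall a, a != 0 ->
  (forall v, psi a v = 0 -> v = 0) /\ forall w, exists v, psi a v = w.

(* [w] is the image of [v0] under the fraction [q = a s^-1] *)
Let value (q : K) (w : V) := exists a s u,
  [/\ s != 0, q * kap s = kap a, psi s u = v0 & w = psi a u].

Let value_ex q : exists w, value q w.
Proof.
have [_ _ _ fr] := ore; have [a [s [s0 qs]]] := fr q.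
by have [_ /(_ v0)[u su]] := psi_bij s0; exists (psi a u), a, s, u.
Qed.

(** Rewriting [s^-1 s'] in [K] as a right fraction [x y^-1] gives the common denominator
    [s x = s' y]. *)
Let value_common q w q' w' : value q w -> value q' w' -> exists a a' s u,
  [/\ s != 0, psi s u = v0, q * kap s = kap a /\ w = psi a u &
      q' * kap s = kap a' /\ w' = psi a' u].
Proof.
move=> [a [s [u [s0 qs su ->]]]] [a' [s' [u' [s0' qs' su' ->]]]].
have [_ kinj inv fr] := ore; have [t [st ts]] := inv s s0.
have [x [y [y0 txy]]] := fr (t * kap s').
have sx : s * x = s' * y.
  by apply: kinj; rewrite !rmorphM -txy !mulrA st mul1r.
have sx0 : s' * y != 0.
  have [t' [st' ts']] := inv s' s0'; apply: contraNneq y0 => sy.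
  apply/eqP/kinj; rewrite rmorph0 -[LHS]mul1r -ts' -mulrA -rmorphM sy.
  by rewrite rmorph0 mulr0.
have psiM (b c : A) v : psi (b * c) v = psi b (psi c v) by rewrite rmorphM.
have [_ /(_ v0)[z zE]] := psi_bij sx0.
have uE b c v : b != 0 -> psi b v = v0 -> psi (b * c) z = v0 -> v = psi c z.
  move=> b0 bv bcz; apply/subr0_eq; apply: (psi_bij b0).1.
  by rewrite endoB bv -psiM bcz subrr.
exists (a * x), (a' * y), (s' * y), z; split=> //; split.
- by rewrite -sx !rmorphM mulrA qs.
- by rewrite psiM; congr (psi a _); apply: uE su _ => //; rewrite sx.
- by rewrite !rmorphM mulrA qs'.
- by rewrite psiM; congr (psi a' _); apply: uE su' _.
Qed.

(** [j q] is [q v0]. It is well defined since denominators act bijectively, and injective since a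
    non-zero numerator acts injectively and [v0] is non-zero. *)
Lemma ore_module : exists j : K -> V,
  [/\ {morph j : p q / p - q}, forall q, j q = 0 -> q = 0 &
      forall a q, j (kap a * q) = psi a (j q)].
Proof.
have [j jP] := choice value_ex; have [_ kinj inv _] := ore.
have jE q w : value q w -> j q = w.
  move=> /(value_common (jP q)) [a [a' [s [u [_ _ [-> ->] [/kinj -> ->]]]]]] //.
exists j; split.
- move=> p q; apply: jE.
  have [a [a' [s [u [s0 su [pa ->] [qa ->]]]]]] := value_common (jP p) (jP q).
  exists (a - a'), s, u; split=> //; last by rewrite rmorphB.
  by rewrite mulrBl rmorphB pa qa.
- move=> q j0; have [a [s [u [s0 qs su]]]] := jP q; rewrite j0 => au.
  have a0 : a = 0.
    apply/eqP; apply: contrapT => /negP a0; apply: v00.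
    by rewrite -su ((psi_bij a0).1 _ (esym au)) endo0.
  have [t [st _]] := inv s s0.
  by rewrite -[LHS]mulr1 -st mulrA qs a0 rmorph0 mul0r.
- move=> b q; apply: jE; have [a [s [u [s0 qs su ->]]]] := jP q.
  exists (b * a), s, u; split=> //; last by rewrite rmorphM.
  by rewrite rmorphM -mulrA qs.
Qed.

End OreModule.

(** A non-zero value of the universal derivation would be detected by a linear form, whose composite
    with that derivation is a derivation into [S]. *)
Lemma H1_null_forms (G : groupType) (S : pzRingType) (r : monoid_act G S) x :
    (forall c : S, c != 0 -> exists e, e * c = 1) ->
    (forall delta : G -> S,
       (forall g h, delta (g * h)%g = delta g + r g * delta h) -> delta x = 0) ->
  H1_null r x.
Proof.
move=> divS dx; have [D [delta [dd null]]] := universal_derivation r.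
apply: null; apply: contrapT => x0.
have zB (u v : D) : u = 0 -> v = 0 -> u - v = 0 by move=> -> ->; rewrite subrr.
have zZ (c : S) (v : D) : v = 0 -> c *: v = 0 by move=> ->; rewrite scaler0.
have [l [lD lZ _ l1]] := linear_form divS
  (P := LSubmod (in_lsub := fun v : D => v = 0) erefl zB zZ) x0.
apply: x0; rewrite -[LHS]scale1r -l1 (dx (fun g => l (delta g))) ?scale0r //.
by move=> g h; rewrite dd lD lZ.
Qed.

(** * Detecting the Harvey series *)

Section HarveyTest.
Variables (d : Order.disp_t) (W : orderType d).
Variable wfW : well_founded (fun m n : W => (m < n)%O).
Variables (R : pzRingType) (f : {rmorphism R -> rat}).
Hypothesis f_inj : injective f.
Variables (E : vogel_localization R) (L : cohn_localization R).

(** [h] embeds [G / N] into a group where the Vogel-Cohn term dies, so that [N] contains that of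
    [G]. Locality and local goodness of [B] feed the next step of the induction. *)
Definition tester (n : W) (G : groupType) (N : G -> Prop) :=
  exists (B : groupType) (h : {multiplicative G -> B}),
  [/\ local_group R B, locally_good B, kills wfW E L n B &
      forall x, h x = 1%g <-> N x].

Lemma gring_map_coef (G H : groupType) (t : {rmorphism gring int G -> gring int H})
    (i : G -> H) (a : gring int G) x : injective i ->
  (forall c y, t << c *g y >> = << c *g i y >>) -> (t a)@_(i x) = a@_x.
Proof.
move=> i_inj tE; elim/gring_ind: a => [|a b IHa IHb|c y].
- by rewrite rmorph0 !mcoeff0.
- by rewrite rmorphD !mcoeffD IHa IHb.
- by rewrite tE !mcoeffU inj_eq.
Qed.

(** The new group has one factor [V >< B] for each derivation of [G] into [K], read in [V] through
    [j]. The kernel of [h'] is thus the part of [N] where all these derivations vanish, which over a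
    division ring is the condition [H1_null]. *)
Lemma tester_succ m n (G : groupType) (N : G -> Prop) (K : pzRingType)
    (kap : {rmorphism gring int (quo N) -> K}) :
    covers m n -> ore_localization kap -> tester m N ->
  tester n (fun x => N x /\ H1_null (fun g => kap (gring_of int (quo_mk N g))) x).
Proof.
move=> mn ore [B [h [Bloc lB Bk hN]]].
have [k kE] := quo_lift_ex (fun x Nx => (hN x).2 Nx).
have k_inj : injective k.
  move=> u v; rewrite -(quo_reprK u) -(quo_reprK v) !kE => huv.
  by apply/quo_mkP/nc_in/hN; rewrite gmulfM multV huv mulVg.
have [V [phi [psi [v0 [v00 [phi_inv sd_good psiphi psi_bij]]]]]] :=
  locally_good_module f_inj lB.
have [t tE] := gring_map_ex (idfun : {rmorphism int -> int}) k.
pose Psi : {rmorphism gring int (quo N) -> endo V} := psi \o t.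
have [j [jB j_inj jE]] : exists j : K -> V,
    [/\ {morph j : p q / p - q}, forall q, j q = 0 -> q = 0 &
        forall a q, j (kap a * q) = Psi a (j q)].
  apply: (ore_module ore v00) => a a0; apply: psi_bij.
  (* As [k] embeds the quotient into [B], coefficients survive under [t] and a non-zero element
     stays non-zero. *)
  apply: contraNneq a0 => ta; apply/eqP/malgP => u.
  by rewrite -(gring_map_coef a u k_inj tE) ta !mcoeff0.
have j0 : j 0 = 0 by rewrite -[in LHS](subrr 0) jB subrr.
have jD p q : j (p + q) = j p + j q.
  by apply: (addIr (- j q)); rewrite -jB !addrK.
pose r := MonoidAct (gact1 phi) (gactM phi).
have rho1 : kap (gring_of int (quo_mk N 1%g)) = 1 by rewrite mult1 gring_of1 rmorph1.
have rhoM g g' : kap (gring_of int (quo_mk N (g * g')%g)) =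
    kap (gring_of int (quo_mk N g)) * kap (gring_of int (quo_mk N g')).
  by rewrite gmulfM gring_ofM rmorphM.
pose rho := @MonoidAct G K (fun g => kap (gring_of int (quo_mk N g))) rho1 rhoM.
pose J := {delta : G -> K |
  forall g g', delta (g * g')%g = delta g + rho g * delta g'}.
pose B' := gprod (fun _ : J => sdprod r (emod V)).
have [h' h'E] : exists h' : {multiplicative G -> B'},
    h' =1 (fun g (delta : J) => (j (sval delta g), h g)).
  apply: mult_ex => x y; apply: functional_extensionality_dep => -[delta dd] /=.
  rewrite gprod_mulE sd_mulE /= gmulfM dd jD jE /=; congr (_ + _, _).
  by rewrite tE psiphi kE.
exists B', h'; split.
- apply: local_gprod => delta.
  have [i iE] : exists i : {multiplicative B -> B}, i =1 id by apply: mult_ex.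
  by apply: (local_sdprod (t := i) phi_inv) => // b; rewrite iE.
- by apply: locally_good_gprod => delta; apply: sd_good.
- by apply: kills_gprod => delta; apply: (kills_sdprod mn phi_inv).
move=> x; split=> [h'x|[Nx nullx]]; last first.
  rewrite h'E; apply: functional_extensionality_dep => -[delta dd] /=.
  congr pair; last exact/hN.
  by rewrite (@H1_null_derivation _ _ rho K^o delta x dd nullx) j0.
have coord (delta : J) : (j (sval delta x), h x) = (0, 1%g).
  have /(congr1 (fun u : B' => u delta)) /= <- := h'E x.
  exact: (congr1 (fun u : B' => u delta) h'x).
(* The zero derivation gives the product a factor from which [h x = 1] can be read. *)
have J0 (g g' : G) : 0 = 0 + rho g * 0 :> K by rewrite mulr0 addr0.
split; first by apply/hN; case: (coord (exist _ (fun _ => 0) J0)).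
apply: (@H1_null_forms _ _ rho); first exact: ore_left_inverse ore.
by move=> delta dd; case: (coord (exist _ delta dd)) => /j_inj.
Qed.

Lemma tester_harvey (K : ZG_rings) (G : groupType) n :
    (forall m : W, (m < n)%O ->
       ore_localization (zg_map K (quo (@harvey_series d W wfW K m G)))) ->
  tester n (@harvey_series d W wfW K n G).
Proof.
elim/(well_founded_ind wfW): n => n IH ore.
have {}IH m : (m < n)%O -> tester m (@harvey_series d W wfW K m G).
  by move=> mn; apply: IH => // k km; apply: ore; apply: lt_trans mn.
have [[m mn]|lim] := covers_or_limit n.
  have [B [h [Bloc lB Bk hN]]] := tester_succ mn (ore m mn.1) (IH m mn.1).
  by exists B, h; split=> // x; rewrite hN /harvey_series (series_succ _ _ _ mn).
(* At a limit, the product over all smaller indices has the intersection of the terms as kernel; at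
   the least element it is the trivial group, with the whole group as kernel. *)
pose F (k : {k : W | (k < n)%O}) := cid (IH (sval k) (svalP k)).
pose B k := projT1 (F k).
pose h k : {multiplicative G -> B k} := projT1 (cid (projT2 (F k))).
have P k : [/\ local_group R (B k), locally_good (B k),
    kills wfW E L (sval k) (B k) &
    forall x, h k x = 1%g <-> @harvey_series d W wfW K (sval k) G x].
  exact: projT2 (cid (projT2 (F k))).
have [h' h'E] : exists h' : {multiplicative G -> gprod B}, h' =1 (fun g k => h k g).
  by apply: mult_ex => x y; apply: functional_extensionality_dep => k; rewrite gmulfM.
exists (gprod B), h'; split.
- by apply: local_gprod => k; have [] := P k.
- by apply: locally_good_gprod => k; have [] := P k.
- apply: kills_gprod => k; apply: (kills_limit lim (svalP k)).
  by have [] := P k.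
move=> x; rewrite /harvey_series series_limit //; split=> [h'x m mn|Hx].
  have [_ _ _ hx] := P (exist _ m mn); apply/hx.
  have /(congr1 (fun u : gprod B => u (exist _ m mn))) /= <- := h'E x.
  exact: (congr1 (fun u : gprod B => u (exist _ m mn)) h'x).
rewrite h'E; apply: functional_extensionality_dep => k.
by have [_ _ _ hx] := P k; apply/hx; apply: Hx (svalP k).
Qed.

End HarveyTest.

Theorem theorem4p1
    (R : pzRingType) (hR : finite_cyclic_ring R \/ subring_of_rat R)
    (E : vogel_localization R) (L : cohn_localization R) (K : ZG_rings)
    (d : Order.disp_t) (W : orderType d)
    (wfW : well_founded (fun m n : W => (m < n)%O))
    (pi : groupType) (n : W) :
  (forall x : pi, derived_series wfW R n x -> vogel_series wfW E n x) /\
  (forall x : pi, vogel_series wfW E n x -> vogel_cohn_series wfW E L n x) /\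
  (subring_of_rat R ->
   (forall m : W, (m < n)%O ->
      ore_localization (zg_map K (quo (@harvey_series d W wfW K m pi)))) ->
   forall x : pi, vogel_cohn_series wfW E L n x -> harvey_series wfW K n x).
Proof.
split; first exact: derived_vogel.
split; first exact: vogel_vogel_cohn.
move=> [f f_inj] ore x cx.
have [B [h [_ _ Bk hN]]] := tester_harvey f_inj E L ore.
by apply/hN; apply: Bk cx.
Qed.
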